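(* Let $\Omega\subset\mathbb{R}^3$ be a bounded simply-connected Lipschitz domain with connected, piecewise $C^{2,1}$-smooth boundary $\partial\Omega$, let $\lambda>0$, $\mu>0$, $\omega>0$ and $\boldsymbol{f}\in\boldsymbol{H}^1(\Omega)$. Let $\boldsymbol{u}\in\boldsymbol{X}_T$ be a solution of the variational problem $$(\mu\nabla\wedge\boldsymbol{u},\nabla\wedge\boldsymbol{v})+((\lambda+2\mu)\nabla\cdot\boldsymbol{u},\nabla\cdot\boldsymbol{v})-\omega^2(\boldsymbol{u},\boldsymbol{v})=(\boldsymbol{f},\boldsymbol{v})\qquad\text{for all }\boldsymbol{v}\in\boldsymbol{X}_T,$$ and suppose that $\boldsymbol{u}\in\boldsymbol{H}^3(\Omega)$. Put $k_p:=\omega/\sqrt{\lambda+2\mu}$ and $k_s:=\omega/\sqrt{\mu}$. Then $v_p:=-\nabla\cdot\boldsymbol{u}$ and $\boldsymbol{E}_s:=\nabla\wedge\boldsymbol{u}$ satisfy $$\begin{cases}\Delta v_p+k_p^2v_p=\dfrac{1}{\lambda+2\mu}\nabla\cdot\boldsymbol{f}&\text{in }\Omega,\\ \partial_{\boldsymbol{\nu}}v_p=\dfrac{1}{\lambda+2\mu}\boldsymbol{\nu}\cdot\boldsymbol{f}&\text{on }\partial\Omega,\end{cases}$$ and $$\begin{cases}\nabla\wedge(\nabla\wedge\boldsymbol{E}_s)-k_s^2\boldsymbol{E}_s=\dfrac1\mu\nabla\wedge\boldsymbol{f}&\text{in }\Omega,\\ \nabla\cdot\boldsymbol{E}_s=0&\text{in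 }\Omega,\\ \boldsymbol{\nu}\wedge\boldsymbol{E}_s=\boldsymbol{0}&\text{on }\partial\Omega.\end{cases}$$
   Context: $\wedge$ is the cross product in $\mathbb{R}^3$, so $\nabla\wedge\boldsymbol{v}$ is the curl of $\boldsymbol{v}$ and $\nabla\cdot\boldsymbol{v}$ its divergence (distributional). $(\cdot,\cdot)$ is the $L^2(\Omega)$ scalar product (of scalar- or vector-valued functions), over a fixed scalar field. $\boldsymbol{L}^2(\Omega)=L^2(\Omega)^3$, $\boldsymbol{H}^s(\Omega)=H^s(\Omega)^3$. The outward unit normal on $\partial\Omega$ is $\boldsymbol{\nu}$, and $\partial_{\boldsymbol{\nu}}v=\boldsymbol{\nu}\cdot\nabla v$; boundary conditions are understood in the sense of traces. $\boldsymbol{X}:=\{\boldsymbol{v}\in\boldsymbol{L}^2(\Omega):\nabla\wedge\boldsymbol{v}\in\boldsymbol{L}^2(\Omega),\ \nabla\cdot\boldsymbol{v}\in L^2(\Omega)\}$, and $\boldsymbol{X}_T:=\{\boldsymbol{v}\in\boldsymbol{X}:\boldsymbol{v}\cdot\boldsymbol{\nu}=0\text{ on }\partial\Omega\}$ (normal trace in the standard sense). *)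

(* Defs.v *)
From HB Require Import structures.
From mathcomp Require Import all_boot all_order all_algebra.
From mathcomp Require Import all_classical all_reals all_analysis.
From mathcomp Require Import complex.
Import Order.TTheory GRing.Theory Num.Theory numFieldNormedType.Exports.

Set Implicit Arguments.
Unset Strict Implicit.
Unset Printing Implicit Defensive.

Local Open Scope classical_set_scope.
Local Open Scope ring_scope.
Local Open Scope complex_scope.

(* Points of R^3 are triples ((x1, x2), x3). R3 carries the product topology; M3
   is the same type seen as the product of the measurable spaces on which the
   library defines the Lebesgue measure (Borel sets). *)
Notation R3 R := (R * R * R)%type.
Notation M3 R :=
  (measurableTypeR R * measurableTypeR R * measurableTypeR R)%type.

Definition leb3 (R : realType) : {measure set (M3 R) -> \bar R} :=
  ((@lebesgue_measure R \x @lebesgue_measure R) \x @lebesgue_measure R)%E.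

(** Classical differentiability *)

Section Classical.
Context {R : realType} {V : normedModType R}.
Implicit Types (f : V -> R) (s : seq V).

Definition iterD s f : V -> R := foldr (fun v g => 'D_v g) f s.

Definition Ck (n : nat) f : Prop := forall s,
  ((size s < n)%N -> forall v x, derivable (iterD s f) x v) /\
  ((size s <= n)%N -> continuous (iterD s f)).

Definition smooth f : Prop := forall n, Ck n f.

Definition C21 f : Prop := Ck 2 f /\
  forall s, size s = 2%N -> exists k : R, k.-lipschitz (iterD s f).

End Classical.

(** Geometry of the domain *)

Section Domain.
Context {R : realType}.
Implicit Types (Omega : set (R3 R)) (T : R3 R -> R3 R).

Definition boundary Omega : set (R3 R) := closure Omega `\` interior Omega.

(* Every loop in Omega contracts in Omega to its base point. *)
Definition simply_connected Omega : Prop :=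
  connected Omega /\
  forall c : R -> R3 R,
    {within `[0, 1], continuous c} -> c @` `[0, 1] `<=` Omega -> c 0 = c 1 ->
  exists h : R * R -> R3 R,
    [/\ {within `[0, 1] `*` `[0, 1], continuous h},
        h @` (`[0, 1] `*` `[0, 1]) `<=` Omega,
        forall s, s \in `[0, 1] -> h (s, 0) = c s,
        forall s, s \in `[0, 1] -> h (s, 1) = c 0 &
        forall t, t \in `[0, 1] -> h (0, t) = c 0 /\ h (1, t) = c 0].

Definition sqnorm (x : R3 R) : R := x.1.1 ^+ 2 + x.1.2 ^+ 2 + x.2 ^+ 2.

(* Cartesian coordinates: the Euclidean isometries of R^3 are the changes of
   orthonormal frame. *)
Definition rigid T : Prop := forall x y, sqnorm (T x - T y) = sqnorm (x - y).

Definition lipschitz_boundary Omega : Prop :=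
  forall x0, boundary Omega x0 ->
  exists T (g : R * R -> R) (r h : R),
    [/\ rigid T /\ T x0 = 0, 0 < r /\ 0 < h, exists k : R, k.-lipschitz g,
        forall y : R * R, `|y| < r -> `|g y| < h &
        forall x, `|(T x).1| < r -> `|(T x).2| < h ->
          (Omega x <-> g (T x).1 < (T x).2)].

(* The boundary is the union of finitely many closed faces, each of class
   C^{2,1} up to its own boundary; the open faces are disjoint, and what they
   leave out (edges and vertices) is covered by finitely many Lipschitz arcs. *)
Definition piecewise_C21_boundary Omega : Prop :=
  exists (N : nat) (F : 'I_N -> set (R3 R)),
    [/\ forall j, exists2 U, open U & F j = boundary Omega `&` U,
        trivIset setT F,
        boundary Omega = \bigcup_j closure (F j),
        forall j x0, closure (F j) x0 ->
          exists T (g : R * R -> R), [/\ rigid T, C21 g &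
            \forall x \near x0, closure (F j) x -> (T x).2 = g (T x).1] &
        exists (M : nat) (c : 'I_M -> R -> R3 R),
          (forall k, exists a : R, a.-lipschitz (c k)) /\
          boundary Omega `\` \bigcup_j F j `<=` \bigcup_k (c k @` `[0, 1])].

End Domain.

(** Function spaces and differential operators *)

(* Scalar functions take their values in K = R or K = C. Both are treated at
   once as K-valued functions into R[i]. *)
Inductive scalar_field := RealScalars | ComplexScalars.

Definition scalars (R : realType) (K : scalar_field) : set R[i] :=
  match K with RealScalars => [set z | complex.Im z = 0] | ComplexScalars => setT end.

Section Sobolev.
Context {R : realType} (K : scalar_field) (Omega : set (R3 R)).

Local Notation C := R[i].
Local Notation sfun := (R3 R -> C).
Local Notation vfun := (R3 R -> 'rV[C]_3).
Local Notation mu := (leb3 R).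

Definition component (v : vfun) (i : 'I_3) : sfun := fun x => v x 0 i.

Definition cint (f : sfun) : C :=
  (\int[mu]_(x in Omega) complex.Re (f x)) +i* (\int[mu]_(x in Omega) complex.Im (f x)).

Definition ip (f g : sfun) : C := cint (fun x => f x * (g x)^*).
Definition ipv (v w : vfun) : C := cint (fun x => \sum_i v x 0 i * (w x 0 i)^*).

Definition inL2 (f : sfun) : Prop :=
  [/\ forall x, Omega x -> scalars K (f x),
      measurable_fun (Omega : set (M3 R)) (fun x : M3 R => complex.Re (f x)),
      measurable_fun (Omega : set (M3 R)) (fun x : M3 R => complex.Im (f x)) &
      mu.-integrable Omega
        (fun x => (complex.Re (f x) ^+ 2 + complex.Im (f x) ^+ 2)%:E)].

Definition inL2v (v : vfun) : Prop := forall i, inL2 (component v i).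

(* Distributions on Omega, as functionals on (real) test functions. *)

Definition test (phi : R3 R -> R) : Prop :=
  smooth phi /\
  exists A, [/\ compact A, A `<=` Omega & forall x, ~ A x -> phi x = 0].

Local Notation dist := ((R3 R -> R) -> C).

Definition regular (f : sfun) : dist := fun phi => cint (fun x => f x * (phi x)%:C).

Definition basis3 (i : 'I_3) : R3 R :=
  ((i == 0)%:R, (i == 1)%:R, (i == 2)%:R).

Definition pd (i : 'I_3) (D : dist) : dist :=
  fun phi => - D (fun x => 'D_(basis3 i) phi x).

Definition represents (D : dist) (f : sfun) : Prop :=
  inL2 f /\ forall phi, test phi -> D phi = regular f phi.

Definition is_grad (f : sfun) (g : vfun) : Prop :=
  forall i, represents (pd i (regular f)) (component g i).

Definition is_div (v : vfun) (d : sfun) : Prop :=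
  represents (fun phi => \sum_i pd i (regular (component v i)) phi) d.

(* Indices are taken modulo 3 (addition of 'I_3). *)
Definition is_curl (v : vfun) (w : vfun) : Prop :=
  forall i, represents (fun phi =>
    pd (i + 1) (regular (component v (i + 2))) phi -
    pd (i + 2) (regular (component v (i + 1))) phi) (component w i).

(* The operators as total functions. They are meaningful only when the
   distributional derivative is an L^2 function, which is then determined
   almost everywhere; the junk value is 0. *)
Definition grad (f : sfun) : vfun := xget (cst 0) [set g | is_grad f g].
Definition div (v : vfun) : sfun := xget (cst 0) [set d | is_div v d].
Definition curl (v : vfun) : vfun := xget (cst 0) [set w | is_curl v w].
Definition laplacian (f : sfun) : sfun := div (grad f).

Fixpoint inH (m : nat) (f : sfun) : Prop :=
  if m is m'.+1 then
    inL2 f /\ forall i, exists2 g, represents (pd i (regular f)) g & inH m' g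
  else inL2 f.

Definition inHv (m : nat) (v : vfun) : Prop := forall i, inH m (component v i).

Definition inX (v : vfun) : Prop :=
  [/\ inL2v v, exists w, is_curl v w & exists d, is_div v d].

(* Traces of fields of H(div) and H(curl), in H^{-1/2}(boundary Omega). Such an
   element is given as an (anti)linear form on H^1(Omega), acting on w through
   the trace of w:
     < nu . v, q > = (v, grad q) + (div v, q),
     < nu ^ v, w > = (curl v, w) - (v, curl w). *)
Definition normal_trace (v : vfun) (q : sfun) : C :=
  ipv v (grad q) + ip (div v) q.

Definition tangential_trace (v w : vfun) : C :=
  ipv (curl v) w - ipv v (curl w).

Definition normal_derivative (f : sfun) : sfun -> C := normal_trace (grad f).

Definition eq_trace (g1 g2 : sfun -> C) : Prop :=
  forall q, inH 1 q -> g1 q = g2 q.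

Definition eq_tracev (g1 g2 : vfun -> C) : Prop :=
  forall w, inHv 1 w -> g1 w = g2 w.

Definition inXT (v : vfun) : Prop := inX v /\ eq_trace (normal_trace v) (cst 0).

End Sobolev.

(* Main.v *)
From HB Require Import structures.
Require Import Defs.
From mathcomp Require Import all_boot all_order all_algebra.
From mathcomp Require Import all_classical all_reals all_analysis.
From mathcomp Require Import measurable_realfun complex ring lra.
Import Order.TTheory GRing.Theory Num.Theory numFieldNormedType.Exports.

(** The boundary conditions are weak: a trace vanishes when its Green's formula
    has no boundary term. Test fields for them are produced by solving Neumann
    problems, which are themselves stated in weak form.

    Testing the variational problem with smooth fields of compact support
    gives the equation mu curl curl u - (lambda + 2 mu) grad div u
    - omega^2 u = f almost everywhere ([strong_equation]). Its divergence and
    its curl are the two differential equations, because curl grad = 0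
    ([curl_grad]) and div curl = 0 ([div_curl]).

    Write E = curl u. Comparing the strong equation with the variational one,
    and using that the normal trace of v vanishes against div u, one finds
      (E, curl v) = (curl E, v)  for all v in X_T         ([curl_curl_XT]),
    that is, the tangential trace of E vanishes against the fields of X_T. It
    remains to pass from X_T to all of H^1. The tool is the Neumann problem
    [neumann]: for square-integrable w and h there is q in H^1 with
      (w, grad p) + (h, p) = (grad q, grad p) + (q, p)  for all p in H^1.
    It is solved by orthogonal projection onto the graph of the gradient in
    (L^2)^4 ([hilbert_projection]); the graph is complete because L^2 is
    ([L2_complete]) and weak derivatives pass to the limit.

    First, (curl E, grad q) = 0 for every q in H^1 ([curl_curl_grad]). Let r
    solve the Neumann problem with data (curl E, 0), and s the one with data
    (0, r). Then grad s lies in X_T and is curl-free, so (curl E, grad s) = 0,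
    and testing the two problems against each other gives (r, r) = 0. Since r
    represents the functional p |-> (curl E, grad p), this functional is zero.
    This is the density of the domain of the Neumann Laplacian in H^1.

    Next, let w be in H^1 and let q solve the Neumann problem with data (w, 0).
    Then w - grad q lies in X_T and has the curl of w, so
    (E, curl w) = (curl E, w - grad q) = (curl E, w): the tangential trace of E
    is zero ([tangential_trace_curl]).

    Last, testing the strong equation with grad q, where the terms in curl E
    and in the normal trace of u vanish, gives the Neumann condition of the
    pressure v_p ([pressure_neumann]).

    Almost everywhere equalities come from the fundamental lemma of the
    calculus of variations ([fundamental_lemma]). *)

Set Implicit Arguments.
Unset Strict Implicit.
Unset Printing Implicit Defensive.

Local Open Scope classical_set_scope.
Local Open Scope ring_scope.

(** * Functions of class C^k *)

Section Ck_theory.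
Context {R : realType} {V : normedModType R}.
Implicit Types (f g : V -> R) (x v w : V).

(** A directional derivative is the derivative of the restriction to a line;
    one-variable theorems are transferred through this. *)
Lemma derive_line f x v (t : R) :
  'D_1 (fun s : R => f (x + s *: v)) t = 'D_v f (x + t *: v).
Proof.
rewrite /derive; set F := (X in lim (X @ _) = _).
set G := (X in _ = lim (X @ _)); suff -> : F = G by [].
apply/funext => h; rewrite /F /G /= /shift /= scalerDl [h *: (1 : R)]mulr1.
by rewrite addrCA.
Qed.

Lemma derivable_line f x v (t : R) :
  derivable (fun s : R => f (x + s *: v)) t 1 <-> derivable f (x + t *: v) v.
Proof.
rewrite /derivable; set F := (X in cvg (X @ _) <-> _).
set G := (X in _ <-> cvg (X @ _)).
suff -> : F = G by [].
apply/funext => h; rewrite /F /G /= /shift /= scalerDl [h *: (1 : R)]mulr1.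
by rewrite addrCA.
Qed.

Lemma derive_line0 f x v : 'D_v f x = 'D_1 (fun s : R => f (x + s *: v)) 0.
Proof. by rewrite derive_line scale0r addr0. Qed.

Lemma derivable_line0 f x v :
  derivable (fun s : R => f (x + s *: v)) 0 1 <-> derivable f x v.
Proof. by rewrite derivable_line scale0r addr0. Qed.

Lemma Ck0 f : Ck 0 f <-> continuous f.
Proof.
split; first by move=> /(_ [::])[_]; exact.
by move=> cf [|v s]; split=> //.
Qed.

(** The innermost derivation of [iterD] is peeled off, so that closure
    properties of C^k follow by induction on k. *)
Lemma CkS n f : Ck n.+1 f <->
  [/\ continuous f, forall v x, derivable f x v & forall v, Ck n ('D_v f)].
Proof.
have iterD_rcons s v : Defs.iterD (rcons s v) f = Defs.iterD s ('D_v f).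
  by rewrite /Defs.iterD foldr_rcons.
split=> [Cf|[cf df Cf] s].
  split; [exact: (Cf [::]).2 | exact: (Cf [::]).1 |] => v s.
  by have := Cf (rcons s v); rewrite size_rcons iterD_rcons !ltnS.
by elim/last_ind: s => [//|s v _]; rewrite size_rcons iterD_rcons !ltnS; exact: Cf.
Qed.

Lemma CkW n f : Ck n.+1 f -> Ck n f.
Proof.
move=> Cf s; split=> sn; first by apply: (Cf s).1; exact: leqW.
by apply: (Cf s).2; exact: leqW.
Qed.

Lemma Ck_cst n (c : R) : Ck n (cst c : V -> R).
Proof.
elim: n c => [|n IH] c; first by apply/Ck0 => x; exact: cvg_cst.
apply/CkS; split=> [x|v x|v]; [exact: cvg_cst | exact: derivable_cst |].
have -> // : 'D_v (cst c : V -> R) = cst 0.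
by apply/funext => x; exact: derive_cst.
Qed.

Lemma CkD n f g : Ck n f -> Ck n g -> Ck n (f + g).
Proof.
elim: n f g => [|n IH] f g.
  by rewrite !Ck0 => cf cg x; apply: cvgD; [exact: cf | exact: cg].
rewrite !CkS => -[cf df Cf] [cg dg Cg]; split=> [x|v x|v].
- by apply: cvgD; [exact: cf | exact: cg].
- exact: derivableD.
- have -> : 'D_v (f + g) = 'D_v f + 'D_v g.
    by apply/funext => x; rewrite deriveD.
  exact: IH.
Qed.

Lemma CkM n f g : Ck n f -> Ck n g -> Ck n (f * g).
Proof.
elim: n f g => [|n IH] f g.
  by rewrite !Ck0 => cf cg x; apply: cvgM; [exact: cf | exact: cg].
move=> Cf Cg; have [Cf' Cg'] := (CkW Cf, CkW Cg).
move: Cf Cg; rewrite !CkS => -[cf df Cf] [cg dg Cg]; split=> [x|v x|v].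
- by apply: cvgM; [exact: cf | exact: cg].
- exact: derivableM.
- have -> : 'D_v (f * g) = f * 'D_v g + g * 'D_v f.
    by apply/funext => x; rewrite deriveM.
  by apply: CkD; exact: IH.
Qed.

Lemma smooth_cst (c : R) : smooth (cst c : V -> R).
Proof. by move=> n; exact: Ck_cst. Qed.

Lemma smoothD f g : smooth f -> smooth g -> smooth (f + g).
Proof. by move=> sf sg n; exact: CkD. Qed.

Lemma smoothM f g : smooth f -> smooth g -> smooth (f * g).
Proof. by move=> sf sg n; exact: CkM. Qed.

Lemma smooth_derive v f : smooth f -> smooth ('D_v f).
Proof. by move=> sf n; have /CkS[_ _] := sf n.+1; exact. Qed.

Lemma smooth_continuous f : smooth f -> continuous f.
Proof. by move=> sf; apply/Ck0. Qed.

Lemma smooth_derivable f x v : smooth f -> derivable f x v.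
Proof. by move=> /(_ 1%N)/CkS[_]. Qed.

Lemma smooth_linear (f : V -> R) : continuous f ->
  (forall x v (t : R), f (x + t *: v) = f x + t * f v) -> smooth f.
Proof.
move=> cf lf [|n]; first exact/Ck0.
have fE x v : (fun t : R => f (x + t *: v)) = cst (f x) + (f v \*: id).
  by apply/funext => t; rewrite lf /= mulrC.
have Df x v : is_derive (0 : R) 1 (fun t : R => f (x + t *: v)) (f v).
  by rewrite fE; apply: is_derive_eq; rewrite add0r [_ *: _]mulr1.
apply/CkS; split=> // [v x|v].
  by apply/derivable_line0; have [] := Df x v.
have -> : 'D_v f = cst (f v); last exact: Ck_cst.
by apply/funext => x; rewrite derive_line0; have [_ ->] := Df x v.
Qed.

(** The mean value theorem is applied along v to the difference of two
    translates of f, and then along w to the derivative so obtained. *)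
Lemma mixed_difference f v w (t : R) x : Ck 2 f -> 0 < t ->
  exists2 p : R * R, (0 < p.1 < t) && (0 < p.2 < t) &
  f (x + t *: v + t *: w) - f (x + t *: v) - (f (x + t *: w) - f x)
  = t ^+ 2 * 'D_w ('D_v f) (x + p.1 *: v + p.2 *: w).
Proof.
move=> /CkS[cf df Cf] t0.
have line g y u : (forall x, derivable g x u) ->
    exists2 s, 0 < s < t & g (y + t *: u) - g y = t * 'D_u g (y + s *: u).
  move=> dg.
  have [||s st] := @MVT R (fun r => g (y + r *: u)) (fun r => 'D_u g (y + r *: u)) 0 t t0.
  - move=> r _; rewrite -derive_line; apply: derivableP.
    exact/derivable_line.
  - apply: derivable_within_continuous => r _; exact/derivable_line.
  - rewrite scale0r addr0 subr0 mulrC => E.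
    by exists s => //; move: st; rewrite in_itv.
pose g y := f (y + t *: w) - f y.
have dsh y u : derivable (fun z => f (z + t *: w)) y u.
  apply/derivable_line0.
  have -> : (fun s : R => f (y + s *: u + t *: w)) = (fun s : R => f ((y + t *: w) + s *: u)).
    by apply/funext => s; rewrite addrAC.
  exact/derivable_line0.
have dg y u : derivable g y u by apply: derivableB.
have [s s0t gE] := line g x v (fun y => dg y v).
have /CkS[_ dv _] := Cf v.
have [r r0t hE] := line ('D_v f) (x + s *: v) w (fun y => dv w y).
exists (s, r); first exact/andP.
rewrite /g in gE; rewrite gE.
rewrite deriveB //.
rewrite derive_line0.
have -> : (fun s0 : R => f (x + s *: v + s0 *: v + t *: w)) =
          (fun s0 : R => f ((x + s *: v + t *: w) + s0 *: v)).
  by apply/funext => s0; rewrite addrAC.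
by rewrite -derive_line0 hE expr2 mulrA.
Qed.

(** The mixed difference of f is symmetric in v and w. By [mixed_difference]
    both second derivatives therefore take a common value at points
    arbitrarily close to x, and they are continuous. *)
Lemma derive_comm f v w x : Ck 2 f -> 'D_w ('D_v f) x = 'D_v ('D_w f) x.
Proof.
move=> Cf.
have cvw (a b : V) : continuous ('D_a ('D_b f)).
  by move/CkS: Cf => [_ _ /(_ b)/CkS[_ _ /(_ a)/Ck0]].
have near_diag (a b : V) (e : R) : 0 < e ->
   exists2 d : R, 0 < d & forall p q : R, 0 < p < d -> 0 < q < d ->
     `|'D_a ('D_b f) x - 'D_a ('D_b f) (x + p *: b + q *: a)| < e.
  move=> e0.
  have cp : {for ((0, 0) : R * R), continuous (fun p : R * R => x + p.1 *: b + p.2 *: a)}.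
    apply: cvgD; [apply: cvgD; [exact: cvg_cst|]|]; apply: cvgZr_tmp.
    - exact: cvg_fst.
    - exact: cvg_snd.
  have := @continuous_comp _ _ _ _ ('D_a ('D_b f)) _ cp (cvw a b _).
  move=> /cvgrPdist_lt /(_ e e0).
  rewrite /= !scale0r !addr0 => /nbhs_ballP[d /= d0 H].
  exists d => // p q /andP[p0 pd] /andP[q0 qd].
  by apply: (H (p, q)); split; rewrite /ball /= sub0r normrN gtr0_norm.
apply/eqP; rewrite -subr_eq0 -normr_le0; apply/ler_addgt0Pr => e e0.
rewrite add0r.
have e20 : 0 < e / 2 by rewrite divr_gt0.
have [d1 d10 H1] := near_diag w v _ e20.
have [d2 d20 H2] := near_diag v w _ e20.
pose t := Num.min d1 d2 / 2.
have m0 : 0 < Num.min d1 d2 by rewrite lt_min d10.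
have t0 : 0 < t by rewrite divr_gt0.
have tm : t < Num.min d1 d2 by rewrite /t; move: m0; clear; lra.
have td1 : t < d1 by rewrite (lt_le_trans tm)// ge_min lexx.
have td2 : t < d2 by rewrite (lt_le_trans tm)// ge_min lexx orbT.
have [[p q] /= /andP[/andP[p0 pt] /andP[q0 qt]] E1] := mixed_difference v w x Cf t0.
have [[p' q'] /= /andP[/andP[p0' pt'] /andP[q0' qt']] E2] := mixed_difference w v x Cf t0.
have E : 'D_w ('D_v f) (x + p *: v + q *: w) = 'D_v ('D_w f) (x + p' *: w + q' *: v).
  have t20 : t ^+ 2 != 0 by rewrite expf_neq0 ?gt_eqF.
  apply: (mulfI t20); apply: (etrans (esym E1)); apply: etrans E2.
  by rewrite [x + t *: w + t *: v]addrAC; ring.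
have {}H1 := H1 p q (introT andP (conj p0 (lt_trans pt td1)))
  (introT andP (conj q0 (lt_trans qt td1))).
have {}H2 := H2 p' q' (introT andP (conj p0' (lt_trans pt' td2)))
  (introT andP (conj q0' (lt_trans qt' td2))).
rewrite E in H1.
move: H1 H2; move: ('D_w ('D_v f) x) ('D_v ('D_w f) x) => P Q.
move: ('D_v ('D_w f) _) => Z H1 H2.
apply: (le_trans (ler_distD Z _ _)); rewrite [`|Z - Q|]distrC.
by rewrite [leRHS]splitr ltW// ltrD.
Qed.

End Ck_theory.

Section Ck_comp.
Context {R : realType} {V : normedModType R}.

(** By the chain rule the derivative of g \o f is (g' \o f) * f', a product
    to which the induction hypothesis applies. *)
Lemma Ck_comp n (g : R -> R) (f : V -> R) : Ck n g -> Ck n f -> Ck n (g \o f).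
Proof.
elim: n g f => [|n IH] g f.
  by rewrite !Ck0 => cg cf x; apply: continuous_comp; [exact: cf | exact: cg].
move=> Cg Cf; have Cf' := CkW Cf.
move: Cg Cf; rewrite !CkS => -[cg dg Cg] [cf df Cf].
have Dgf x v : is_derive (0 : R) 1 (fun s : R => (g \o f) (x + s *: v)) ('D_1 g (f x) * 'D_v f x).
  apply: (@is_derive1_comp _ g (fun s : R => f (x + s *: v))).
    by rewrite scale0r addr0; exact: derivableP.
  by rewrite derive_line0; apply: derivableP; exact/derivable_line0.
split=> [x|v x|v].
- by apply: continuous_comp; [exact: cf | exact: cg].
- by apply/derivable_line0; have [] := Dgf x v.
- have -> : 'D_v (g \o f) = ('D_1 g \o f) * 'D_v f.
    by apply/funext => x; rewrite derive_line0; have [_ ->] := Dgf x v.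
  by apply: CkM => //; exact: IH.
Qed.

Lemma smooth_comp (g : R -> R) (f : V -> R) : smooth g -> smooth f -> smooth (g \o f).
Proof. by move=> sg sf n; exact: Ck_comp. Qed.

End Ck_comp.

(** * A smooth function vanishing to infinite order *)

Section flat.
Context {R : realType}.

(** Derivatives of exp (- 1 / t), extended by 0 to t <= 0, are combinations
    of members of this family; keeping k general makes smoothness an induction
    that is uniform in k. *)
Definition flat (k : nat) (t : R) : R := if 0 < t then t^-1 ^+ k * expR (- t^-1) else 0.

Lemma flat_le0 k t : t <= 0 -> flat k t = 0.
Proof. by move=> t0; rewrite /flat ltNge t0. Qed.

(** With y = 1 / t > 0 this is exp y >= y ^ (k + 1) / (k + 1)!. The bound is
    linear in t, which yields both continuity and a zero derivative at 0. *)
Lemma flat_bound k t : `|flat k t| <= k.+1`!%:R * `|t|.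
Proof.
have [t0|t0] := leP t 0.
  by rewrite flat_le0// normr0 mulr_ge0.
rewrite /flat t0 !gtr0_norm//; last first.
  by rewrite mulr_gt0 ?expR_gt0// exprn_gt0// invr_gt0.
have y0 : 0 < t^-1 by rewrite invr_gt0.
have f0 : 0 < k.+1`!%:R :> R by rewrite ltr0n fact_gt0.
have := expR_ge1Dxn k (ltW y0).
rewrite expRN => H.
have {}H : t^-1 ^+ k.+1 / k.+1`!%:R <= expR t^-1 by apply: le_trans H; rewrite lerDr.
rewrite ler_pdivrMr ?expR_gt0//.
rewrite ler_pdivrMr// in H.
have : t * t^-1 ^+ k.+1 <= t * (expR t^-1 * k.+1`!%:R) by rewrite ler_pM2l.
by rewrite exprS mulVKf ?gt_eqF// => /le_trans; apply; rewrite le_eqVlt; apply/orP; left; apply/eqP; ring.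
Qed.

Lemma is_derive_flat k (t : R) :
  is_derive t 1 (flat k) (flat k.+2 t - k%:R * flat k.+1 t).
Proof.
case: (ltgtP t 0) => t0.
- apply: (near_eq_is_derive (f := cst 0)).
    near=> s; rewrite flat_le0//; apply: ltW; near: s; exact: lt_nbhsl.
  by rewrite !flat_le0 ?ltW// mulr0 subr0; exact: is_derive_cst.
- apply: (near_eq_is_derive (f := (fun y : R => y ^+ k * expR (- y)) \o (fun s => s^-1))).
    near=> s; rewrite /flat/=; suff -> : 0 < s by [].
    by near: s; exact: lt_nbhsr.
  have tn : t != 0 by rewrite gt_eqF.
  have Dinv : is_derive t 1 (fun s : R => s^-1) (- t^-1 ^+ 2).
    apply: DeriveDef; first exact: derivableV.
    by rewrite deriveV// derive_id exprVn [_ *: _]mulr1.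
  have Dg (y : R) : is_derive y 1 (fun y : R => y ^+ k * expR (- y))
     (k%:R * y ^+ k.-1 * expR (- y) - y ^+ k * expR (- y)).
    have DN : is_derive y 1 (expR \o -%R) (expR (- y) * (-1)).
      exact: is_derive1_comp.
    have DX : is_derive y 1 ((id : R -> R) ^+ k) ((k%:R * y ^+ k.-1) *: 1).
      exact: is_deriveX.
    have -> : (fun y : R => y ^+ k * expR (- y)) = (id : R -> R) ^+ k * (expR \o -%R).
      by apply/funext => z; rewrite -[RHS]/((id ^+ k : R -> R) z * expR (- z)) exprfctE.
    apply: (is_derive_eq (is_deriveM DX DN)).
    rewrite exprfctE /= /GRing.scale/=; ring.
  apply: (is_derive_eq (is_derive1_comp (Dg t^-1) Dinv)).
  rewrite /flat t0; case: k {Dg} => [|k]; first by rewrite /= !expr0; ring.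
  by rewrite /= !exprS; ring.
- have -> : flat k.+2 t - k%:R * flat k.+1 t = 0.
    by rewrite t0 !flat_le0// mulr0 subr0.
  rewrite {}t0.
  have H : h^-1 *: ((flat k \o shift 0) (h *: 1) - flat k 0) @[h --> 0^'] --> (0 : R).
    apply/cvgrPdist_le => e e0.
    have f0 : 0 < k.+2`!%:R :> R by rewrite ltr0n fact_gt0.
    near=> h; rewrite sub0r normrN /= (flat_le0 k (lexx 0)) subr0 addr0 [h *: (1 : R)]mulr1.
    have -> : h^-1 *: flat k h = flat k.+1 h.
      rewrite /flat; case: ifPn => _; last by rewrite scaler0.
      by rewrite exprS -mulrA.
    apply: (le_trans (flat_bound _ _)); rewrite -ler_pdivlMl//.
    near: h; apply: dnbhs0_le; by rewrite mulr_gt0 ?invr_gt0.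
  by apply: DeriveDef; [apply/cvg_ex; exists 0 | exact/cvg_lim].
Unshelve. all: by end_near. Qed.

Lemma smooth_flat k : smooth (flat k : R -> R).
Proof.
move=> n; elim: n k => [|n IH] k.
  apply/Ck0 => t; apply: differentiable_continuous; apply/derivable1_diffP.
  by have [] := is_derive_flat k t.
have cf : continuous (flat k).
  move=> t; apply: differentiable_continuous; apply/derivable1_diffP.
  by have [] := is_derive_flat k t.
have dv t v : is_derive t v (flat k) (v * (flat k.+2 t - k%:R * flat k.+1 t)).
  have [d e] := is_derive_flat k t.
  have df : differentiable (flat k) t by exact/derivable1_diffP.
  apply: DeriveDef; first exact: diff_derivable.
  rewrite (deriveE v df) -[in LHS](mulr1 v) -[v * 1]/(v *: (1 : R)) linearZ/=.
  by rewrite -(deriveE (1 : R) df) e.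
apply/CkS; split=> [//|v x|v]; first by have [] := dv x v.
have -> : 'D_v (flat k) = (cst v : R -> R) * (flat k.+2 + (cst (- k%:R) : R -> R) * flat k.+1).
  by apply/funext => t; have [_ ->] := dv t v; rewrite /= !fctE mulNr.
by apply: CkM; [exact: Ck_cst | apply: CkD; [exact: IH | apply: CkM; [exact: Ck_cst | exact: IH]]].
Qed.

End flat.

(** * Cubes and Borel sets of R^3 *)

Section cubes.
Context {R : realType}.
Implicit Types (c x : R3 R) (r : R) (U : set (R3 R)).

Definition rat3 (c : rat * rat * rat) : R3 R :=
  (ratr c.1.1, ratr c.1.2, ratr c.2).

Lemma ball3P c r x : ball c r x <->
  [/\ `|c.1.1 - x.1.1| < r, `|c.1.2 - x.1.2| < r & `|c.2 - x.2| < r].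
Proof. by split=> [[[]]|[]]; do ?split. Qed.

Lemma cubeE c r : ball c r =
  (`]c.1.1 - r, c.1.1 + r[ `*` `]c.1.2 - r, c.1.2 + r[) `*` `]c.2 - r, c.2 + r[.
Proof.
apply/seteqP; split=> x /=.
  move/ball3P; rewrite !in_itv/= !ltr_distlC => -[/andP[-> ->] /andP[-> ->] /andP[-> ->]].
  by [].
by rewrite !in_itv/= => -[[a b] d]; apply/ball3P; rewrite !ltr_distlC.
Qed.

Lemma measurable_cube c r : measurable (ball c r : set (M3 R)).
Proof. by rewrite cubeE; apply: measurableX => //; exact: measurableX. Qed.

Lemma leb3_rect (A B D : set (measurableTypeR R)) :
  measurable A -> measurable B -> measurable D ->
  leb3 R ((A `*` B) `*` D) =
    (lebesgue_measure A * lebesgue_measure B * lebesgue_measure D)%E.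
Proof.
move=> mA mB mD.
have := @product_measure1E _ _ _ _ _ (@lebesgue_measure R \x @lebesgue_measure R)%E
    (@lebesgue_measure R) (A `*` B) D (measurableX mA mB) mD.
move=> E; apply: (etrans E); congr (_ * _)%E.
exact: (@product_measure1E _ _ _ _ _ (@lebesgue_measure R) (@lebesgue_measure R)).
Qed.

Lemma cube_fin c r : (leb3 R (ball c r) < +oo)%E.
Proof.
rewrite cubeE leb3_rect// !lebesgue_measure_itv /=.
by do 3 case: ifP => _; rewrite -?EFinB -?EFinM ?mul0e ?mule0 ?ltry.
Qed.

(** The cube with twice the radius must fit in U, so that the closure of the
    smaller one is a compact subset of U. *)
Lemma rat_cube U x : open U -> U x -> exists p : (rat * rat * rat) * rat,
  ball (rat3 p.1) (ratr p.2) x /\ ball (rat3 p.1) (2 * ratr p.2) `<=` U.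
Proof.
move=> oU Ux; have /nbhs_ballP[e /= e0 eU] : nbhs x U by exact: open_nbhs_nbhs.
have [r] : exists q : rat, ratr q \in `]0, e / 3[ by apply: rat_in_itvoo; rewrite divr_gt0.
rewrite in_itv/= => /andP[r0 re].
have near_rat (t : R) : exists q : rat, `|ratr q - t| < ratr r.
  have [q] : exists q : rat, ratr q \in `]t - ratr r, t + ratr r[.
    by apply: rat_in_itvoo; move: r0; clear; lra.
  by rewrite in_itv/= -ltr_distl; exists q.
have [a ax] := near_rat x.1.1; have [b bx] := near_rat x.1.2.
have [c cx] := near_rat x.2.
exists ((a, b, c), r); split; first exact/ball3P.
have tri (s t y : R) : `|s - t| < ratr r -> `|s - y| < 2 * ratr r -> `|t - y| < e.
  move=> st sy; apply: (le_lt_trans (ler_distD s _ _)).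
  by rewrite [`|t - s|]distrC; move: st sy re; clear; lra.
move=> y /ball3P/=[ay byy cy]; apply: eU; apply/ball3P.
by split; [exact: tri ay | exact: tri byy| exact: tri cy].
Qed.

Lemma open_bigcup_cube U : open U -> U = \bigcup_(p : (rat * rat * rat) * rat)
  (if `[< ball (rat3 p.1) (2 * ratr p.2) `<=` U >] then ball (rat3 p.1) (ratr p.2)
   else set0).
Proof.
move=> oU; apply/seteqP; split=> [x /(rat_cube oU)[p [px pU]]|x [p _]].
  by exists p => //; case: asboolP.
case: asboolP => // pU px; apply: pU.
have r0 : 0 < ratr p.2 :> R.
  by case/ball3P: px => + _ _; exact: le_lt_trans.
by apply: le_ball px; rewrite ler_peMl ?ler1n// ltW.
Qed.

Lemma open_measurable3 U : open U -> measurable (U : set (M3 R)).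
Proof.
move=> /open_bigcup_cube ->; apply: countable_bigcupT_measurable => // p.
by case: asboolP => _ //; exact: measurable_cube.
Qed.

Lemma continuous_measurable3 (f : R3 R -> R) : continuous f ->
  measurable_fun setT (f : M3 R -> R).
Proof.
move=> /continuousP cf.
apply: (measurability _ (measurable_realfun.RGenOInfty.measurableE R)).
move=> _ [_ [a ->] <-]; rewrite setTI; apply: open_measurable3; apply: cf.
exact: interval_open.
Qed.

(** Octants are stable under intersection and generate the Borel sets, and
    the trace of an octant on an open cube is an open box. *)
Definition octant c : set (R3 R) :=
  (`]c.1.1, +oo[ `*` `]c.1.2, +oo[) `*` `]c.2, +oo[.

(** A set is Borel as soon as it is the preimage of a Borel set under the
    identity seen as a map from the sigma-algebra generated by octants; the
    latter is measurable because its coordinates are. *)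
Lemma octant_gen : @measurable _ (M3 R) = <<s [set octant c | c in setT] >>.
Proof.
apply/seteqP; split => [S mS|].
  pose T' := g_sigma_algebraType [set octant c | c in setT].
  have ray (pr : T' -> R) (g : R -> nat -> R3 R) :
     (forall a, [set x | a < pr x] = \bigcup_n octant (g a n)) ->
     measurable_fun setT (pr : T' -> measurableTypeR R).
    move=> prE; apply: (measurability _ (measurable_realfun.RGenOInfty.measurableE R)).
    move=> _ [_ [a ->] <-]; rewrite setTI.
    have -> : pr @^-1` `]a, +oo[ = [set x | a < pr x].
      by apply/seteqP; split=> x /=; rewrite in_itv/= andbT.
    rewrite prE; apply: bigcupT_measurable => n.
    by apply: sub_sigma_algebra; exists (g a n).
  have neg (t s : R) : exists n : nat, - n%:R < t /\ - n%:R < s.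
    exists (Num.Def.archi_bound (`|t| + `|s|)); have := archi_boundP (addr_ge0 (normr_ge0 t) (normr_ge0 s)).
    have := ler_norm (- t); have := ler_norm (- s); rewrite !normrN.
    have := normr_ge0 t; have := normr_ge0 s.
    by split; lra.
  have mid : measurable_fun setT (id : T' -> M3 R).
    apply/measurable_fun_pairP; split.
      apply/measurable_fun_pairP; split.
      - apply: (ray _ (fun a n => (a, - n%:R, - n%:R))) => a.
        apply/seteqP; split => x /=.
          move=> ax; have [n [n1 n2]] := neg x.1.2 x.2.
          by exists n => //; rewrite /octant /= !in_itv/= !andbT.
        by case=> n _; rewrite /octant /= !in_itv/= !andbT => -[[]].
      - apply: (ray _ (fun a n => (- n%:R, a, - n%:R))) => a.
        apply/seteqP; split => x /=.
          move=> ax; have [n [n1 n2]] := neg x.1.1 x.2.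
          by exists n => //; rewrite /octant /= !in_itv/= !andbT.
        by case=> n _; rewrite /octant /= !in_itv/= !andbT => -[[]].
    apply: (ray _ (fun a n => (- n%:R, - n%:R, a))) => a.
    apply/seteqP; split => x /=.
      move=> ax; have [n [n1 n2]] := neg x.1.1 x.1.2.
      by exists n => //; rewrite /octant /= !in_itv/= !andbT.
    by case=> n _; rewrite /octant /= !in_itv/= !andbT => -[].
  by have := mid measurableT S mS; rewrite setTI preimage_id.
apply: smallest_sub; first exact: sigma_algebra_measurable.
move=> _ [c _ <-]; apply: measurableX => //; exact: measurableX.
Qed.

Lemma octantI : setI_closed [set octant c | c in setT].
Proof.
move=> _ _ [c _ <-] [d _ <-].
exists (Num.max c.1.1 d.1.1, Num.max c.1.2 d.1.2, Num.max c.2 d.2) => //.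
apply/seteqP; split => x; rewrite /octant /= !in_itv/= !andbT !gt_max.
  by move=> [[/andP[-> ->] /andP[-> ->]] /andP[-> ->]].
by move=> [[[-> ->] ->] [[-> ->] ->]].
Qed.

End cubes.

(** * Integration by parts on R^3 *)

Section bounded_support.
Context d (T : measurableType d) (R : realType) (m : {measure set T -> \bar R}).

Lemma bounded_support_integrable (D : set T) (F : T -> R) (C : R) :
  measurable D -> (m D < +oo)%E -> measurable_fun setT F ->
  (forall x, `|F x| <= C) -> (forall x, ~ D x -> F x = 0) ->
  m.-integrable setT (EFin \o F).
Proof.
move=> mD Dfin mF FC F0.
have -> : EFin \o F = (EFin \o F) \_ D.
  by apply/funext => x; rewrite patchE; case: ifPn => // /negP;
     rewrite inE /= => /F0 ->.
apply/(integrable_mkcond _ mD).1.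
apply: measurable_bounded_integrable => //; first exact: measurable_funTS.
exists C; split; first exact: num_real.
by move=> y Cy x _ /=; apply: le_trans (FC x) (ltW Cy).
Qed.

End bounded_support.

Section prod_sf.
Context d1 d2 (T1 : measurableType d1) (T2 : measurableType d2) (R : realType).
Context (m1 : {sigma_finite_measure set T1 -> \bar R})
  (m2 : {sigma_finite_measure set T2 -> \bar R}).

Lemma product_sigma_finite : sigma_finite setT (m1 \x m2)%E.
Proof.
have /sigma_finiteP[F [TF ndF Foo]] := sigma_finiteT m1.
have /sigma_finiteP[G [TG ndG Goo]] := sigma_finiteT m2.
exists (fun n => F n `*` G n).
  rewrite -setXTT TF TG predeqE => -[x y]; split.
    move=> [/= [n _ Fnx] [k _ Gky]]; exists (maxn n k) => //; split.
    - by move: x Fnx; exact/subsetPset/ndF/leq_maxl.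
    - by move: y Gky; exact/subsetPset/ndG/leq_maxr.
  by move=> [n _ []/= ? ?]; split; exists n.
move=> k; have [? ?] := Foo k; have [? ?] := Goo k.
split; first exact: measurableX.
by rewrite product_measure1E// lte_mul_pinfty// ge0_fin_numE.
Qed.

(** The product packed with its sigma-finiteness, so that it can in turn be
    the first factor of a product. *)
Definition product_sigma_finite_measure :
  {sigma_finite_measure set (T1 * T2)%type -> \bar R} :=
  HB.pack_for {sigma_finite_measure set (T1 * T2)%type -> \bar R} (m1 \x m2)%E
   (Measure_isSigmaFinite.Build _ _ _ (m1 \x m2)%E product_sigma_finite).

End prod_sf.

Section triple_integral.
Context d1 d2 d3 (T1 : measurableType d1) (T2 : measurableType d2)
  (T3 : measurableType d3) (R : realType).
Context (m1 : {sigma_finite_measure set T1 -> \bar R})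
  (m2 : {sigma_finite_measure set T2 -> \bar R})
  (m3 : {sigma_finite_measure set T3 -> \bar R}).
Context (f : (T1 * T2) * T3 -> \bar R).
Let m12 := product_sigma_finite_measure m1 m2.
Context (fi : ((m1 \x m2) \x m3)%E.-integrable setT f).

Lemma integral_third0 : (forall x y, \int[m3]_z f ((x, y), z) = 0)%E ->
  (\int[(m1 \x m2) \x m3]_p f p = 0)%E.
Proof.
move=> f0; apply: (etrans (esym (@integral12_prod_meas1 _ _ _ _ R m12 m3 f fi))).
by apply: integral0_eq => -[x y] _; exact: f0.
Qed.

Context (f12 : forall z, (m1 \x m2)%E.-integrable setT (fun p => f (p, z))).

Lemma integral_second0 : (forall x z, \int[m2]_y f ((x, y), z) = 0)%E ->
  (\int[(m1 \x m2) \x m3]_p f p = 0)%E.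
Proof.
move=> f0; apply: (etrans (esym (@integral21_prod_meas1 _ _ _ _ R m12 m3 f fi))).
apply: integral0_eq => z _; apply: (etrans (esym (integral12_prod_meas1 (f12 z)))).
by apply: integral0_eq => x _; exact: f0.
Qed.

Lemma integral_first0 : (forall y z, \int[m1]_x f ((x, y), z) = 0)%E ->
  (\int[(m1 \x m2) \x m3]_p f p = 0)%E.
Proof.
move=> f0; apply: (etrans (esym (@integral21_prod_meas1 _ _ _ _ R m12 m3 f fi))).
apply: integral0_eq => z _; apply: (etrans (esym (integral21_prod_meas1 (f12 z)))).
by apply: integral0_eq => y _; exact: f0.
Qed.

End triple_integral.

Section ibp.
Context {R : realType}.
Local Notation leb := (@lebesgue_measure R).

Lemma integral_derive_line (f : R -> R) (M : R) : 0 < M ->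
  (forall t, derivable f t 1) -> continuous ('D_1 f) ->
  (forall t, M <= `|t| -> f t = 0 /\ 'D_1 f t = 0) ->
  (\int[leb]_t ('D_1 f t)%:E = 0)%E.
Proof.
move=> M0 df cf f0.
have cf0 : continuous f.
  by move=> t; apply: differentiable_continuous; apply/derivable1_diffP.
have NM : - M < M by rewrite gtrN.
transitivity (\int[leb]_(t in `[(- M)%R, M]) ('D_1 f t)%:E)%E.
  rewrite [RHS]integral_mkcond; apply: eq_integral => t _.
  rewrite patchE; case: ifPn => // /negP; rewrite inE /= in_itv /= => /negP h.
  by rewrite (f0 t _).2// leNgt ltr_norml; apply: contra h => /andP[/ltW-> /ltW->].
rewrite (@continuous_FTC2 _ _ f).
- by rewrite (f0 M _).1 ?(f0 (- M) _).1 ?subee// ?normrN ger0_norm// ltW.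
- exact: NM.
- exact: continuous_subspaceT.
- split=> [t _//||].
  + by apply: cvg_at_right_filter; exact: cf0.
  + by apply: cvg_at_left_filter; exact: cf0.
- by move=> t _; rewrite derive1E.
Qed.

(** Compact support, without reference to the domain Omega. *)
Definition csupp (F : R3 R -> R) : Prop :=
  exists2 A : set (R3 R), compact A & forall x, ~ A x -> F x = 0.

Lemma csupp_bounded F : continuous F -> csupp F -> exists M C, [/\ 0 < M,
  forall x, `|F x| <= C & forall x, ~ ball 0 M x -> F x = 0].
Proof.
move=> cF [A cA FA].
have /compact_bounded[M [_ HM]] := cA.
have cFA : compact (F @` A).
  by apply: continuous_compact => //; exact: continuous_subspaceT.
have /compact_bounded[C [_ HC]] := cFA.
exists (`|M| + 1 + 1), (`|C| + 1); split.
- by rewrite addr_gt0// ltr_pwDr.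
- move=> x; have [Ax|/FA ->] := pselect (A x).
    by apply: HC; [rewrite ltr_pwDr// ler_norm | exists x].
  by rewrite normr0 addr_ge0.
- move=> x nb; apply: FA => Ax; apply: nb.
  rewrite -ball_normE /= sub0r normrN.
  apply: (@le_lt_trans _ _ (`|M| + 1)); last by rewrite ltrDl.
  by apply: HM => //; rewrite ltr_pwDr// ler_norm.
Qed.

Lemma csupp_integrable F : continuous F -> csupp F ->
  (leb3 R).-integrable setT (EFin \o F).
Proof.
move=> cF sF; have [M [C [M0 FC F0]]] := csupp_bounded cF sF.
apply: (bounded_support_integrable (measurable_cube 0 M) (cube_fin 0 M) _ FC F0).
exact: continuous_measurable3.
Qed.

Lemma csupp_derive F v : csupp F -> csupp ('D_v F).
Proof.
move=> [A cA FA]; exists A => // x Ax.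
have oA : open (~` A) by apply: closed_openC; apply: compact_closed => //; exact: norm_hausdorff.
rewrite (near_eq_derive (g := cst 0)); first by rewrite derive_cst.
have : nbhs x (~` A) by exact: open_nbhs_nbhs.
by apply: filterS => y /FA.
Qed.

Lemma line_first (x y z : R) i3 :
  (0, y, z) + x *: basis3 (@Ordinal 3 0 i3) = (x, y, z) :> R3 R.
Proof.
rewrite -[LHS]/(0 + x * 1, y + x * 0, z + x * 0).
by rewrite !mulr0 !addr0 add0r mulr1.
Qed.

Lemma line_second (x y z : R) i3 :
  (x, 0, z) + y *: basis3 (@Ordinal 3 1 i3) = (x, y, z) :> R3 R.
Proof.
rewrite -[LHS]/(x + y * 0, 0 + y * 1, z + y * 0).
by rewrite !mulr0 !addr0 add0r mulr1.
Qed.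

Lemma line_third (x y z : R) i3 :
  (x, y, 0) + z *: basis3 (@Ordinal 3 2 i3) = (x, y, z) :> R3 R.
Proof.
rewrite -[LHS]/(x + z * 0, y + z * 0, 0 + z * 1).
by rewrite !mulr0 !addr0 add0r mulr1.
Qed.

(** By Fubini the integral is computed first along the lines parallel to the
    i-th axis, where the fundamental theorem of calculus gives 0. *)
Lemma integral_derive_csupp (F : R3 R -> R) i : Ck 1 F -> csupp F ->
  (\int[leb3 R]_x ('D_(basis3 i) F x)%:E = 0)%E.
Proof.
move=> C1 sF; have /CkS[cF dF Cd] := C1.
have cD : continuous ('D_(basis3 i) F) by apply/Ck0.
have sD := csupp_derive (basis3 i) sF.
have [M [_ [M0 _ F0]]] := csupp_bounded cF sF.
have [M' [C [M'0 DC D0]]] := csupp_bounded cD sD.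
pose N := Num.max M M'.
have N0 : 0 < N by rewrite lt_max M0.
have FN x : ~ ball 0 N x -> F x = 0.
  by move=> h; apply: F0 => b; apply: h; apply: le_ball b; rewrite le_max lexx.
have DN x : ~ ball 0 N x -> 'D_(basis3 i) F x = 0.
  by move=> h; apply: D0 => b; apply: h; apply: le_ball b; rewrite le_max lexx orbT.
have line (x : R3 R) : (forall t, ball 0 N (x + t *: basis3 i) -> `|t| < N) ->
    (\int[leb]_t ('D_(basis3 i) F (x + t *: basis3 i))%:E = 0)%E.
  move=> xN.
  pose f (t : R) := F (x + t *: basis3 i).
  have fE t : 'D_1 f t = 'D_(basis3 i) F (x + t *: basis3 i) by exact: derive_line.
  under eq_integral do rewrite -fE.
  apply: (integral_derive_line N0) => [t||t Nt].
  - exact/derivable_line.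
  - have -> : 'D_1 f = ('D_(basis3 i) F) \o (fun t : R => x + t *: basis3 i).
      by apply/funext => t; rewrite fE.
    move=> t; apply: continuous_comp; last exact: cD.
    by apply: cvgD; [exact: cvg_cst | apply: cvgZr_tmp].
  - have nb : ~ ball 0 N (x + t *: basis3 i) by move=> /xN; rewrite ltNge Nt.
    by rewrite fE; split; [exact: FN | exact: DN].
have mD : measurable_fun setT ('D_(basis3 i) F : M3 R -> R) by exact: continuous_measurable3.
have iD : (leb3 R).-integrable setT (EFin \o 'D_(basis3 i) F) by exact: csupp_integrable.
have i2 (z : measurableTypeR R) : (leb \x leb)%E.-integrable setT
    (EFin \o (fun x : measurableTypeR R * measurableTypeR R => 'D_(basis3 i) F (x, z))).
  have fz := @bounded_support_integrable _ _ _ (leb \x leb)%E (`]-N, N[ `*` `]-N, N[)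
    (fun x => 'D_(basis3 i) F (x, z)) C; apply: fz => //.
  - exact: measurableX.
  - have E := @product_measure1E _ _ _ _ _ leb leb `]-N, N[ `]-N, N[
      (measurable_itv _) (measurable_itv _).
    have Efin : (mule (leb `](- N)%R, N%R[) (leb `](- N)%R, N%R[) < +oo)%E.
      by rewrite !lebesgue_measure_itv /=; case: ifP => _;
        rewrite -?EFinB -?EFinM ?mul0e ?mule0 ?ltry.
    exact: (eq_ind_r (fun r => (r < +oo)%E) Efin E).
  - exact: (measurable_fun_pair1 z mD).
  - move=> x h; apply: DN => /ball3P[/= a b _]; apply: h.
    by split; rewrite /= in_itv/= -ltr_norml -normrN -sub0r.
case: i i2 line iD {cD sD DC D0 DN mD} => -[|[|[|//]]] i3 i2 line iD.
- apply: (integral_first0 iD i2) => y z; rewrite -[RHS](line (0, y, z)).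
    by apply: eq_integral => x _ /=; rewrite line_first.
  by move=> t; rewrite line_first => /ball3P[/= + _ _]; rewrite sub0r normrN.
- apply: (integral_second0 iD i2) => x z; rewrite -[RHS](line (x, 0, z)).
    by apply: eq_integral => y _ /=; rewrite line_second.
  by move=> t; rewrite line_second => /ball3P[/= _ + _]; rewrite sub0r normrN.
- apply: (integral_third0 iD) => x y; rewrite -[RHS](line (x, y, 0)).
    by apply: eq_integral => z _ /=; rewrite line_third.
  by move=> t; rewrite line_third => /ball3P[/= _ _]; rewrite sub0r normrN.
Qed.

End ibp.

(** * The fundamental lemma of the calculus of variations *)

Section pi_system.
Context d (T : measurableType d) (R : realType) (m : {measure set T -> \bar R}).

(** The sets S for which the integral of h over Q and S vanishes form a
    Dynkin system; it contains G, hence every measurable set. *)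
Lemma ae_eq0_pi_system (Q : set T) (G : set (set T)) (h : T -> R) :
  @measurable _ T = <<s G >> -> setI_closed G -> measurable Q ->
  m.-integrable Q (EFin \o h) -> (\int[m]_(x in Q) (h x)%:E = 0)%E ->
  (forall S, G S -> (\int[m]_(x in Q `&` S) (h x)%:E = 0)%E) ->
  {ae m, forall x, Q x -> h x = 0}.
Proof.
move=> GE GI mQ ih h0 hG.
have mG S : G S -> measurable S by rewrite GE; exact: sub_gen_smallest.
have ihS S : measurable S -> m.-integrable (Q `&` S) (EFin \o h).
  by move=> mS; apply: integrableS ih => //; exact: measurableI.
have key S : <<s G >> S -> (\int[m]_(x in Q `&` S) (h x)%:E = 0)%E.
  move: S; apply: (dynkin_induction GE GI) => //.
  - by rewrite setIT.
  - move=> S mS PS.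
    have := h0; rewrite -{1}(setIT Q) -(setUv S) setIUr integral_setU.
    + by rewrite PS add0e.
    + exact: measurableI.
    + by apply: measurableI => //; exact: measurableC.
    + by rewrite -setIUr setUv setIT; exact: measurable_int ih.
    + apply/disj_setPS => x [[_ Sx] [_ nSx]]; exact: nSx.
  - move=> F mF tF PF; rewrite setI_bigcupr integral_bigcup.
    + by apply: eseries0 => n _ _; exact: PF.
    + exact: trivIset_setIl.
    + by move=> k; exact: measurableI.
    + rewrite -setI_bigcupr; apply: ihS; exact: bigcupT_measurable.
have : ae_eq m Q (EFin \o h) (cst 0%E).
  apply: integral_ae_eq => // E EQ mE.
  rewrite integral_cst// mul0e -[E](setIidr EQ); apply: key.
  by rewrite -GE.
by apply: filterS => x + Qx => /(_ Qx) [].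
Qed.

End pi_system.

Section bump.
Context {R : realType}.
Local Notation flat0 := (@flat R 0).

Lemma flat_ge0 t : 0 <= flat0 t.
Proof. by rewrite /flat; case: ifP => // _; rewrite expr0 mul1r expR_ge0. Qed.

Lemma flat_le1 t : flat0 t <= 1.
Proof.
rewrite /flat; case: ifPn => // t0.
by rewrite expr0 mul1r -expR0 ler_expR oppr_le0 invr_ge0 ltW.
Qed.

Lemma flat_cvg t : flat0 (n.+1%:R * t) @[n --> \oo] --> ((0 < t)%R%:R : R).
Proof.
case: ltP => t0; last first.
  apply: cvg_near_cst; near=> n; apply: flat_le0.
  by rewrite mulr_ge0_le0.
have -> : (fun n : nat => flat0 (n.+1%:R * t)) = (fun n => expR (- (harmonic n * t^-1))).
  apply/funext => n; rewrite /flat mulr_gt0// expr0 mul1r invfM.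
  by rewrite /harmonic.
rewrite -[X in _ --> X]expR0; apply: continuous_cvg; first exact: continuous_expR.
rewrite -[X in _ --> X]oppr0; apply: cvgN; rewrite -(mul0r t^-1).
by apply: cvgM; [exact: cvg_harmonic|exact: cvg_cst].
Unshelve. all: by end_near. Qed.

(** Smooth, with values in [0, 1], and equal to 0 off ]a, b[; since n
    multiplies the argument of the flat function, the limit as n grows is the
    indicator of ]a, b[. *)
Definition slab (n : nat) (a b t : R) : R :=
  flat0 (n.+1%:R * (t - a)) * flat0 (n.+1%:R * (b - t)).

Lemma slab_ge0 n a b t : 0 <= slab n a b t.
Proof. by rewrite mulr_ge0 ?flat_ge0. Qed.

Lemma slab_le1 n a b t : slab n a b t <= 1.
Proof. by rewrite mulr_ile1 ?flat_ge0 ?flat_le1. Qed.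

Lemma slab_out n a b t : t \notin `]a, b[ -> slab n a b t = 0.
Proof.
rewrite in_itv/= negb_and -!leNgt => /orP[ta|bt].
  by rewrite /slab flat_le0 ?mul0r// mulr_ge0_le0// subr_le0.
by rewrite /slab [X in _ * X]flat_le0 ?mulr0// mulr_ge0_le0// subr_le0.
Qed.

Lemma slab_cvg a b t : slab n a b t @[n --> \oo] --> ((t \in `]a, b[)%R%:R : R).
Proof.
rewrite in_itv/= -(subr_gt0 a) -(subr_gt0 t) -mulnb natrM.
by apply: cvgM; exact: flat_cvg.
Qed.

Lemma smooth_slab n a b : smooth (slab n a b : R -> R).
Proof.
have sid : smooth (id : R -> R).
  by apply: smooth_linear => [x|//]; exact: cvg_id.
have sl (c e : R) : smooth (fun t : R => flat0 (n.+1%:R * (c + e * t))).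
  apply: (@smooth_comp _ _ flat0
    ((cst n.+1%:R : R -> R) * ((cst c : R -> R) + (cst e : R -> R) * id))).
    exact: smooth_flat.
  apply: smoothM; first exact: smooth_cst.
  apply: smoothD; first exact: smooth_cst.
  by apply: smoothM => //; exact: smooth_cst.
have -> : slab n a b = (fun t : R => flat0 (n.+1%:R * (- a + 1 * t))) *
    (fun t : R => flat0 (n.+1%:R * (b + (- 1) * t))).
  apply/funext => t.
  rewrite -[RHS]/(flat0 (n.+1%:R * (- a + 1 * t)) * flat0 (n.+1%:R * (b + (- 1) * t))).
  by rewrite /slab mulN1r mul1r [- a + t]addrC.
by apply: smoothM; exact: sl.
Qed.

Definition box (a b : R3 R) : set (R3 R) :=
  [set x | [&& x.1.1 \in `]a.1.1, b.1.1[, x.1.2 \in `]a.1.2, b.1.2[ &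
              x.2 \in `]a.2, b.2[]].

Definition bump n (a b : R3 R) (x : R3 R) : R :=
  slab n a.1.1 b.1.1 x.1.1 * slab n a.1.2 b.1.2 x.1.2 * slab n a.2 b.2 x.2.

Lemma smooth_bump n a b : smooth (bump n a b).
Proof.
have -> : bump n a b = (slab n a.1.1 b.1.1 \o (fun x : R3 R => x.1.1)) *
    (slab n a.1.2 b.1.2 \o (fun x : R3 R => x.1.2)) *
    (slab n a.2 b.2 \o (fun x : R3 R => x.2)).
  by apply/funext.
apply: smoothM; [apply: smoothM|]; apply: smooth_comp; try exact: smooth_slab.
- apply: smooth_linear => [x|//].
  by apply: (@continuous_comp _ _ _ fst fst); exact: cvg_fst.
- apply: smooth_linear => [x|//].
  by apply: (@continuous_comp _ _ _ fst snd); [exact: cvg_fst|exact: cvg_snd].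
- by apply: smooth_linear => [x|//]; exact: cvg_snd.
Qed.

Lemma bump_out n a b x : ~ box a b x -> bump n a b x = 0.
Proof.
move=> nb; rewrite /bump.
have [h1|/slab_out ->] := boolP (x.1.1 \in `]a.1.1, b.1.1[); last by rewrite !mul0r.
have [h2|/slab_out ->] := boolP (x.1.2 \in `]a.1.2, b.1.2[); last by rewrite mulr0 mul0r.
have [h3|/slab_out ->] := boolP (x.2 \in `]a.2, b.2[); last by rewrite mulr0.
by exfalso; apply: nb; exact/and3P.
Qed.

Lemma bump_cvg a b x : bump n a b x @[n --> \oo] --> (\1_(box a b) x : R).
Proof.
have -> : \1_(box a b) x = (x.1.1 \in `]a.1.1, b.1.1[)%:R *
   (x.1.2 \in `]a.1.2, b.1.2[)%:R * (x.2 \in `]a.2, b.2[)%:R :> R.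
  rewrite indicE -!natrM !mulnb -andbA; congr ((nat_of_bool _)%:R).
  by apply/idP/idP; rewrite inE.
by apply: cvgM; [apply: cvgM|]; exact: slab_cvg.
Qed.

Lemma bump_bound n a b x : `|bump n a b x| <= 1.
Proof.
rewrite /bump.
move: (slab n a.1.1 b.1.1 x.1.1) (slab_ge0 n a.1.1 b.1.1 x.1.1) (slab_le1 n a.1.1 b.1.1 x.1.1).
move: (slab n a.1.2 b.1.2 x.1.2) (slab_ge0 n a.1.2 b.1.2 x.1.2) (slab_le1 n a.1.2 b.1.2 x.1.2).
move: (slab n a.2 b.2 x.2) (slab_ge0 n a.2 b.2 x.2) (slab_le1 n a.2 b.2 x.2).
move=> p p0 p1 q q0 q1 r r0 r1.
have rq : 0 <= r * q by exact: mulr_ge0.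
by rewrite (ger0_norm (mulr_ge0 rq p0)) (mulr_ile1 rq p0 (mulr_ile1 r0 q0 r1 q1)).
Qed.

Lemma compact_cube (c : R3 R) (r : R) :
  compact [set x : R3 R | [/\ `|c.1.1 - x.1.1| <= r, `|c.1.2 - x.1.2| <= r & `|c.2 - x.2| <= r]].
Proof.
have -> : [set x : R3 R | [/\ `|c.1.1 - x.1.1| <= r, `|c.1.2 - x.1.2| <= r & `|c.2 - x.2| <= r]]
  = (`[c.1.1 - r, c.1.1 + r] `*` `[c.1.2 - r, c.1.2 + r]) `*` `[c.2 - r, c.2 + r].
  apply/seteqP; split=> x /=; rewrite !in_itv/= !ler_distlC.
    by move=> [-> -> ->].
  by move=> [[-> ->] ->].
by apply: compact_setX; [apply: compact_setX|]; exact: segment_compact.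
Qed.

Lemma test_bump (Omega : set (R3 R)) n a b (c : R3 R) r : 0 < r ->
  ball c (2 * r) `<=` Omega -> box a b `<=` ball c r -> test Omega (bump n a b).
Proof.
move=> r0 cO ab; split; first exact: smooth_bump.
exists [set x : R3 R | [/\ `|c.1.1 - x.1.1| <= r, `|c.1.2 - x.1.2| <= r & `|c.2 - x.2| <= r]].
split; first exact: compact_cube.
- move=> x [h1 h2 h3]; apply: cO; apply/ball3P.
  by split; apply: le_lt_trans (_ : r < _) => //; rewrite ltr_pMl ?ltr1n.
- move=> x nx; apply: bump_out => bx; apply: nx.
  by have /ball3P[? ? ?] := ab _ bx; split; exact: ltW.
Qed.

End bump.

Section fundamental_lemma.
Context {R : realType}.

(** On a cube Q inside Omega, bumps converge boundedly to the indicator of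
    the trace on Q of an octant. By dominated convergence the integral of h
    over all such traces is 0, and octants generate the Borel sets. Countably
    many cubes cover Omega. *)
Lemma fundamental_lemma (Omega : set (R3 R)) (h : M3 R -> R) : open Omega ->
  measurable_fun (Omega : set (M3 R)) h ->
  (forall c r, ball c r `<=` Omega -> (leb3 R).-integrable (ball c r) (EFin \o h)) ->
  (forall phi, test Omega phi -> \int[leb3 R]_(x in Omega) (h x * phi x) = 0) ->
  {ae leb3 R, forall x, Omega x -> h x = 0}.
Proof.
move=> oO mh ih h0.
have loc (c : R3 R) r : 0 < r -> ball c (2 * r) `<=` Omega ->
    {ae leb3 R, forall x, ball c r x -> h x = 0}.
  move=> r0 cO.
  have crO : ball c r `<=` Omega.
    by apply: subset_trans cO; apply: le_ball; rewrite ler_peMl ?ler1n// ltW.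
  have mQ := measurable_cube c r.
  have iQ := ih c r crO.
  have oct d : (\int[leb3 R]_(x in ball c r `&` octant d) (h x)%:E = 0)%E.
    (* the trace of the octant on the cube is the open box from a to b *)
    pose a : R3 R := (Num.max d.1.1 (c.1.1 - r), Num.max d.1.2 (c.1.2 - r), Num.max d.2 (c.2 - r)).
    pose b : R3 R := (c.1.1 + r, c.1.2 + r, c.2 + r).
    have boxE : box a b = ball c r `&` octant d.
      rewrite cubeE; apply/seteqP; split=> x; rewrite /box /octant /= !in_itv/= !gt_max !andbT.
        by case/and3P=> /andP[/andP[-> ->] ->] /andP[/andP[-> ->] ->] /andP[/andP[-> ->] ->].
      by move=> [[[/andP[-> ->] /andP[-> ->]] /andP[-> ->]] [[-> ->] ->]].
    have bQ : box a b `<=` ball c r by rewrite boxE; exact: subIsetl.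
    pose G n : M3 R -> R := fun x => h x * bump n a b x.
    pose F n := EFin \o G n.
    have mF n : measurable_fun (ball c r : set (M3 R)) (F n).
      apply/measurable_EFinP; apply: measurable_funM.
        by apply: measurable_funS mh => //; exact: open_measurable3.
      by apply: measurable_funTS; apply: continuous_measurable3; exact/smooth_continuous/smooth_bump.
    have FE n : (\int[leb3 R]_(x in ball c r) F n x = 0)%E.
      have iF : (leb3 R).-integrable (ball c r) (F n).
        apply: le_integrable (mF n) _ iQ => // x _.
        by rewrite /F /G /= lee_fin normrM ler_piMr// bump_bound.
      have : \int[leb3 R]_(x in ball c r) (h x * bump n a b x) = 0.
        rewrite -(h0 (bump n a b)); last exact: test_bump r0 cO bQ.
        rewrite Rintegral_mkcond [RHS]Rintegral_mkcond; congr (Rintegral _ _ _).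
        apply/funext => x; rewrite !patchE; case: ifPn => xQ.
          by rewrite mem_set//; apply: crO; rewrite inE in xQ.
        case: ifPn => // _; rewrite bump_out ?mulr0// => /bQ /mem_set.
        by rewrite (negbTE xQ).
      rewrite /Rintegral => E.
      have := integrable_fin_num mQ iF; rewrite fin_numE.
      by move=> _; rewrite -[LHS]fineK ?E//; exact: integrable_fin_num.
    have mI : measurable (box a b : set (M3 R)).
      rewrite boxE; apply: measurableI => //.
      by apply: measurableX => //; exact: measurableX.
    have mh' : measurable_fun (ball c r : set (M3 R))
        (EFin \o (fun x : M3 R => h x * \1_(box a b) x)).
      apply/measurable_EFinP; apply: measurable_funM.
        by apply: measurable_funS mh => //; exact: open_measurable3.
      exact: measurable_indic.
    have cF : {ae leb3 R, forall x : M3 R, ball c r x ->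
        F ^~ x @ \oo --> (EFin \o (fun x : M3 R => h x * \1_(box a b) x)) x}.
      apply: aeW => x _; apply/cvg_EFin; first by near=> n.
      by apply: cvgM; [exact: cvg_cst|exact: bump_cvg].
    have bF : {ae leb3 R, forall (x : M3 R) n, ball c r x ->
        (`|F n x| <= (abse \o (EFin \o h)) x)%E}.
      by apply: aeW => x n _; rewrite /F/G/= lee_fin normrM ler_piMr// bump_bound.
    have [_ _] := dominated_convergence mQ mF mh' cF (integrable_abse iQ) bF.
    have -> : [sequence (\int[leb3 R]_(x in ball c r) F n x)%E]_n = cst 0%E.
      by apply/funext => n /=.
    move=> /(cvg_lim (@ereal_hausdorff _)) /=; rewrite lim_cst// => E.
    rewrite -boxE -(setIidr bQ) integral_mkcondr E.
    apply: eq_integral => x _; rewrite patchE indicE; case: ifPn => _.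
      by rewrite mulr1.
    by rewrite mulr0.
  apply: (ae_eq0_pi_system octant_gen octantI mQ iQ).
    rewrite -(oct (c.1.1 - r, c.1.2 - r, c.2 - r)); congr (integral _ _ _).
    rewrite cubeE; apply/seteqP; split=> x; rewrite /octant /= !in_itv/= !andbT.
      by move=> [[/andP[-> ->] /andP[-> ->]] /andP[-> ->]].
    by move=> [].
  by move=> _ [d _ <-]; exact: oct.
have cover := open_bigcup_cube oO.
pose Np (p : (rat * rat * rat) * rat) := [set x : M3 R |
  ball (rat3 p.1) (2 * ratr p.2) `<=` Omega /\ (ball (rat3 p.1) (ratr p.2) x /\ h x <> 0)].
have nNp p : (leb3 R).-negligible (Np p).
  have [r0|r0] := ltP 0 (ratr p.2 : R); last first.
    apply: negligibleS (negligible_set0 _) => x [_ [/ball3P[+ _ _] _]].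
    by rewrite ltNge (le_trans r0).
  have [cO|ncO] := pselect (ball (rat3 p.1) (2 * ratr p.2) `<=` Omega); last first.
    by apply: negligibleS (negligible_set0 _) => x [].
  apply: negligibleS (loc _ _ r0 cO) => x [_ [bx hx]] /= H; exact/hx/H.
pose N (n : nat) := if unpickle n is Some p then Np p else set0.
have : (leb3 R).-negligible (\bigcup_n N n).
  apply: negligible_bigcup => n; rewrite /N; case: unpickle => // ; exact: negligible_set0.
apply: negligibleS => x /= /not_implyP[Ox hx].
move: Ox; rewrite {1}cover => -[p _]; case: asboolP => // pO bx.
have Nx : N (pickle p) x by rewrite /N pickleK.
exact: (ex_intro2 _ _ (pickle p) I Nx).
Unshelve. all: by end_near. Qed.

End fundamental_lemma.

(** * Orthogonal projection *)

(** Used with errors of order 2 ^- k along a minimizing or converging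
    sequence. *)
Lemma le0_geometric {R : realType} (a C : R) :
  (forall k, a <= (2 ^+ k)^-1 * C) -> a <= 0.
Proof.
move=> aC; rewrite leNgt; apply/negP => a0.
have C0 : 0 <= C by have := aC 0%N; rewrite expr0 invr1 mul1r; apply: le_trans; exact: ltW.
pose n := Num.Def.archi_bound (C / a).
have Cn : C / a < n%:R by apply: archi_boundP; rewrite divr_ge0// ltW.
have n2 : n%:R <= 2 ^+ n :> R by rewrite -natrX ler_nat ltnW// ltn_expl.
have := aC n; rewrite leNgt => /negP; apply.
rewrite mulrC ltr_pdivrMr ?exprn_gt0// mulrC -ltr_pdivrMr//.
exact: lt_le_trans n2.
Qed.

Section projection.
Context {R : realType} (V : Type) (lin : V -> R -> V -> V) (B : V -> V -> R).
Context (H M : set V).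
Context (lin_H : forall x t y, H x -> H y -> H (lin x t y)).
Context (lin_M : forall x t y, M x -> M y -> M (lin x t y)).
Context (MH : M `<=` H).
Context (BC : forall x y, H x -> H y -> B x y = B y x).
Context (B_lin : forall x t y z, H x -> H y -> H z ->
  B (lin x t y) z = B x z + t * B y z).
Context (B_ge0 : forall x, H x -> 0 <= B x x).

Let dist2 x y := B x x - 2 * B x y + B y y.

Context (complete : exists c, forall x_ : nat -> V, (forall k, M (x_ k)) ->
  (forall k, dist2 (x_ k.+1) (x_ k) <= (4 ^+ k * 2 ^+ k.+1)^-1) ->
  exists2 x, M x & forall k, dist2 x (x_ k) <= c * (4 ^+ k)^-1).

Let B_linr x t y z : H x -> H y -> H z -> B z (lin x t y) = B z x + t * B z y.
Proof.
move=> Hx Hy Hz; rewrite BC ?B_lin//; last exact: lin_H.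
by rewrite (BC Hz Hx) (BC Hz Hy).
Qed.

Let B_lin2 x t y : H x -> H y ->
  B (lin x t y) (lin x t y) = B x x + 2 * t * B x y + t ^+ 2 * B y y.
Proof.
move=> Hx Hy; rewrite B_lin// ?B_linr//; last exact: lin_H.
by rewrite (BC Hy Hx); ring.
Qed.

Let cauchy x y p (t : R) : H x -> H y -> H p -> 0 < t ->
  2 * (B x p - B y p) <= dist2 x y / t + t * B p p.
Proof.
move=> Hx Hy Hp t0.
have Hxy : H (lin x (- 1) y) by exact: lin_H.
have := B_ge0 (lin_H (- t) Hxy Hp).
rewrite B_lin2// !B_lin2 // B_lin// => h.
rewrite -(ler_pM2r t0) [leRHS]mulrDl divfK ?gt_eqF//.
by rewrite /dist2; move: h; lra.
Qed.

(** Take a minimizing sequence of the distance from w to M. By the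
    parallelogram identity its steps are as small as wished, so it converges,
    and the limit satisfies the Euler equation of the minimization.
    The operation [lin x t y] stands for x + t y, and no structure is put on
    V itself, because in the application B is a form that is linear on
    square-integrable functions only. Completeness is asked for sequences with
    quickly decreasing steps: those are the only ones that occur. *)
Lemma hilbert_projection w : H w -> (exists m, M m) ->
  exists2 m, M m & forall p, M p -> B w p = B m p.
Proof.
move=> Hw [m0 Mm0].
pose E := [set dist2 w m | m in M].
have dist_ge0 x y : H x -> H y -> 0 <= dist2 x y.
  by move=> Hx Hy; have := B_ge0 (lin_H (- 1) Hx Hy); rewrite B_lin2// /dist2; lra.
have infE : has_inf E.
  split; first by exists (dist2 w m0), m0.
  by exists 0 => _ [m Mm <-]; apply: dist_ge0 => //; exact: MH.
pose d := inf E.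
have dle m : M m -> d <= dist2 w m.
  by move=> Mm; apply: ge_inf; [have [] := infE | exists m].
(* one quarter of the step allowed by completeness: the parallelogram
   identity bounds the squared step by 2 (eps k + eps k.+1) <= 4 eps k *)
pose eps k : R := (4 ^+ k * 2 ^+ k.+1)^-1 / 4.
have e0 k : 0 < eps k by rewrite divr_gt0// invr_gt0 mulr_gt0// exprn_gt0.
have /choice[x_ x_P] : forall k, exists m, M m /\ dist2 w m < d + eps k.
  move=> k; have [_ [m Mm <-] md] := inf_adherent (e0 k) infE.
  by exists m.
have Mx k : M (x_ k) by have [] := x_P k.
have Hx k : H (x_ k) by exact: MH.
have [c completeP] := complete.
have [k|x Mxx xc] := completeP x_ Mx.
  have [x_k x_k1] := ((x_P k).2, (x_P k.+1).2).
  pose mid := lin (x_ k) (2^-1) (lin (x_ k.+1) (- 1) (x_ k)).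
  have Hs : H (lin (x_ k.+1) (- 1) (x_ k)) by exact: lin_H.
  have dmid : d <= dist2 w mid by apply: dle; do 2 apply: lin_M => //.
  have epsS : eps k.+1 = eps k / 8.
    rewrite /eps !exprS; field.
    by rewrite !expf_neq0.
  have ek := e0 k.
  have epsE : (4 ^+ k * 2 ^+ k.+1)^-1 = 4 * eps k by rewrite /eps [RHS]mulrC divfK.
  move: dmid x_k x_k1 ek; rewrite epsS epsE /dist2 /mid B_linr// B_linr// B_lin2// B_linr//.
  rewrite B_lin2// (BC (Hx k.+1) (Hx k)).
  by move: (eps k) => e; lra.
exists x => // .
have le p : M p -> B w p <= B x p.
  move=> Mp; have Hp := MH Mp.
  suff : 2 * (B w p - B x p) <= 0 by rewrite pmulr_rle0// subr_le0.
  apply: (@le0_geometric _ _ (1 + c + 2 * B p p)) => k.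
  pose t : R := (2 ^+ k)^-1.
  have t0 : 0 < t by rewrite invr_gt0 exprn_gt0.
  have tt : (4 ^+ k)^-1 = t * t.
    by rewrite /t -invfM -exprMn; congr ((_ ^+ _)^-1); ring.
  have wk : 2 * (B w p - B (x_ k) p) <= t * (1 + B p p).
    have := dle _ (lin_M t (Mx k) Mp).
    rewrite /dist2 B_linr// B_lin2// => h1.
    have := (x_P k).2; rewrite /dist2 => h2.
    have e2 : eps k <= t * t.
      rewrite -tt /eps invfM -mulrA ler_piMr ?invr_ge0 ?exprn_ge0//.
      have i2 : (2 ^+ k.+1 : R)^-1 <= 1.
        by rewrite invf_le1 ?exprn_gt0// exprn_ege1// ler1n.
      by have : 0 <= (2 ^+ k.+1 : R)^-1; [rewrite invr_ge0 exprn_ge0 | lra].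
    rewrite -(ler_pM2l t0).
    by move: h1 h2 e2; lra.
  have kx : 2 * (B (x_ k) p - B x p) <= t * (c + B p p).
    have Hxx := MH Mxx.
    apply: le_trans (cauchy (Hx k) Hxx Hp t0) _.
    have := xc k; rewrite tt /dist2 (BC Hxx (Hx k)) => h.
    rewrite mulrDr lerD2r ler_pdivrMr//.
    by move: h; lra.
  by rewrite -/t; move: wk kx; lra.
move=> p Mp; apply/eqP; rewrite eq_le le//=.
have := le _ (lin_M (- 2) Mp Mp).
have [Hp Hxx] := (MH Mp, MH Mxx).
by rewrite !B_linr//; lra.
Qed.

End projection.

(** * Completeness of L^2 *)

Lemma cvg_geometric_steps {R : realType} (a : nat -> R) (c : R) :
  (forall k, `|a k.+1 - a k| <= c * (2 ^+ k)^-1) ->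
  exists2 l, a @ \oo --> l & forall k, `|l - a k| <= 2 * c * (2 ^+ k)^-1.
Proof.
move=> ac.
have c0 : 0 <= c.
  by have := ac 0%N; rewrite expr0 invr1 mulr1; apply: le_trans.
have step k m : `|a (k + m)%N - a k| <= 2 * c * ((2 ^+ k)^-1 - (2 ^+ (k + m))^-1).
  elim: m => [|m IH]; first by rewrite addn0 !subrr normr0 mulr0.
  rewrite addnS (le_trans (ler_distD (a (k + m)%N) _ _))//.
  have := lerD (ac (k + m)%N) IH; rewrite exprS.
  have e0 : (2 ^+ (k + m) : R) != 0 by rewrite expf_neq0.
  by rewrite invfM; lra.
have bnd k m : `|a (k + m)%N - a k| <= 2 * c * (2 ^+ k)^-1.
  apply: le_trans (step k m) _; rewrite ler_wpM2l ?mulr_ge0//.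
  by rewrite gerBl invr_ge0 exprn_ge0.
have ca : cvgn a.
  apply/cauchy_cvgP; apply: cauchy_exP => e e0.
  pose k := Num.Def.archi_bound (2 * c / e).
  have ke : 2 * c / e < 2 ^+ k.
    apply: (@lt_le_trans _ _ k%:R).
      by apply: archi_boundP; rewrite divr_ge0 ?mulr_ge0// ltW.
    by rewrite -natrX ler_nat ltnW// ltn_expl.
  exists (a k); exists k => // n /= kn.
  rewrite -ball_normE /= -(subnKC kn) distrC (le_lt_trans (bnd _ _))//.
  by rewrite ltr_pdivrMr ?exprn_gt0// [ltRHS]mulrC -ltr_pdivrMr.
exists (limn a) => // k.
have c1 : (fun n => `|a n - a k|) @ \oo --> `|limn a - a k|.
  by apply: cvg_norm; apply: cvgB => //; exact: cvg_cst.
rewrite -(cvg_lim _ c1)//; apply: limr_le; first by apply/cvg_ex; exists `|limn a - a k|.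
exists k => // n /= kn; rewrite -(subnKC kn); exact: bnd.
Qed.

Section L2.
Context d (T : measurableType d) (R : realType) (mu : {measure set T -> \bar R}).
Context (D : set T) (mD : measurable D).
Implicit Types f g h : T -> R.

Definition L2 f := measurable_fun D f /\
  mu.-integrable D (fun x => (f x ^+ 2)%:E).

Definition dot f g : R := \int[mu]_(x in D) (f x * g x).

(** From |a b| <= a ^ 2 + b ^ 2. *)
Lemma L2M f g : L2 f -> L2 g -> mu.-integrable D (fun x => (f x * g x)%:E).
Proof.
move=> [mf f2] [mg g2].
apply: le_integrable (integrableD mD f2 g2) => //.
  by apply/measurable_EFinP; exact: measurable_funM.
move=> x _ /=; rewrite lee_fin normrM [leRHS]ger0_norm ?addr_ge0 ?sqr_ge0//.
rewrite -(ger0_norm (sqr_ge0 (f x))) -(ger0_norm (sqr_ge0 (g x))) !normrX.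
have := sqr_ge0 (`|f x| - `|g x|).
by have := normr_ge0 (f x); have := normr_ge0 (g x); nra.
Qed.

Lemma L2Z a f : L2 f -> L2 (fun x => a * f x).
Proof.
move=> [mf f2]; split; first exact: measurable_funM.
under eq_fun do rewrite exprMn EFinM.
exact: integrableZl.
Qed.

Lemma L2D f g : L2 f -> L2 g -> L2 (fun x => f x + g x).
Proof.
move=> Lf Lg; have [mf f2] := Lf; have [mg g2] := Lg.
split; first exact: measurable_funD.
have -> : (fun x => ((f x + g x) ^+ 2)%:E) =
   ((fun x => (f x ^+ 2)%:E) \+ ((fun x => (2%:E * (f x * g x)%:E)%E) \+ (fun x => (g x ^+ 2)%:E)))%E.
  by apply/funext => x; rewrite -EFinM -!EFinD; congr EFin; ring.
apply: integrableD => //; apply: integrableD => //; apply: integrableZl => //.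
exact: L2M.
Qed.

Lemma L2B f g : L2 f -> L2 g -> L2 (fun x => f x - g x).
Proof.
move=> Lf Lg; have := L2D Lf (L2Z (- 1) Lg).
by congr L2; apply/funext => x; rewrite mulN1r.
Qed.

Lemma dotC f g : dot f g = dot g f.
Proof. by congr Rintegral; apply/funext => x; rewrite mulrC. Qed.

Lemma dot_ge0 f : 0 <= dot f f.
Proof.
by apply: fine_ge0; apply: integral_ge0 => x _; rewrite lee_fin -expr2 sqr_ge0.
Qed.

Lemma dotDl f g h : L2 f -> L2 g -> L2 h ->
  dot (fun x => f x + g x) h = dot f h + dot g h.
Proof.
move=> Lf Lg Lh; rewrite /dot -RintegralD//; [|exact: L2M|exact: L2M].
by congr Rintegral; apply/funext => x; rewrite mulrDl.
Qed.

Lemma dotZl a f g : L2 f -> L2 g -> dot (fun x => a * f x) g = a * dot f g.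
Proof.
move=> Lf Lg; rewrite /dot -RintegralZl//; last exact: L2M.
by congr Rintegral; apply/funext => x; rewrite mulrA.
Qed.

Lemma integral_sqr f : L2 f -> (\int[mu]_(x in D) (f x ^+ 2)%:E)%E = (dot f f)%:E.
Proof. by move=> Lf; rewrite fineK//; exact: integrable_fin_num (L2M Lf Lf). Qed.

(** The sum S of the 4 ^ k (f_(k+1) - f_k) ^ 2 has integral at most 1, hence
    is finite almost everywhere. Where it is finite the steps are at most
    sqrt S * 2 ^- k, so the sequence converges there, and
    (f - f_k) ^ 2 <= 4 * 4 ^- k * S can be integrated. The last clause serves
    to keep limits of real-valued functions real-valued. *)
Lemma L2_complete (f_ : nat -> T -> R) : (forall k, L2 (f_ k)) ->
  (forall k, dot (fun x => f_ k.+1 x - f_ k x) (fun x => f_ k.+1 x - f_ k x)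
             <= (4 ^+ k * 2 ^+ k.+1)^-1) ->
  exists f, [/\ L2 f,
    forall k, dot (fun x => f x - f_ k x) (fun x => f x - f_ k x) <= 4 * (4 ^+ k)^-1 &
    forall x, (forall k, f_ k x = 0) -> f x = 0].
Proof.
move=> Lf fc.
pose dd k x := f_ k.+1 x - f_ k x.
have Ld k : L2 (dd k) by exact: L2B.
pose s k x : \bar R := (4 ^+ k * dd k x ^+ 2)%:E.
have s0 k x : (0 <= s k x)%E.
  by rewrite lee_fin mulr_ge0 ?sqr_ge0 ?exprn_ge0.
have ms k : measurable_fun D (s k).
  apply/measurable_EFinP; apply: measurable_funM => //.
  by apply: measurable_funX; have [] := Ld k.
pose S x : \bar R := (\sum_(0 <= k <oo) s k x)%E.
have mS : measurable_fun D S by exact: ge0_emeasurable_sum.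
have S0 x : (0 <= S x)%E by exact: nneseries_ge0.
have iS1 : (\int[mu]_(x in D) S x <= 1%:E)%E.
  rewrite integral_nneseries//.
  apply: le_trans (epsilon_trick0 xpredT (ler01)).
  apply: lee_nneseries => [k _ _|k _]; first exact: integral_ge0.
  rewrite /s; under eq_integral do rewrite EFinM.
  rewrite integralZl//; last by have [] := Ld k.
  rewrite integral_sqr// -EFinM lee_fin.
  apply: le_trans (ler_wpM2l _ (fc k)) _; first by rewrite exprn_ge0.
  by rewrite invfM mulrA divff ?expf_neq0// !mul1r natrX.
have iS : mu.-integrable D S.
  apply/integrableP; split => //.
  under eq_integral do rewrite gee0_abs//.
  by apply: le_lt_trans iS1 _; rewrite ltry.
(* the upper limit is measurable whether or not the sequence converges *)
pose f x := fine (limn_esup (fun n => (f_ n x)%:E)).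
have mf : measurable_fun D f.
  apply: (@measurableT_comp _ _ _ _ _ _ fine _ (fun x => limn_esup (fun n => (f_ n x)%:E))).
    exact: fine_measurable.
  by apply: measurable_fun_limn_esup => n; apply/measurable_EFinP; have [] := Lf n.
have fE x l : f_ n x @[n --> \oo] --> l -> f x = l.
  move=> fl; have : (f_ n x)%:E @[n --> \oo] --> l%:E by apply: cvg_EFin => //; exact: nearW.
  by move=> /cvg_limn_einf_sup[_]; rewrite /f => ->.
have ptw k x : S x \is a fin_num ->
    (((f x - f_ k x) ^+ 2)%:E <= (4 * (4 ^+ k)^-1)%:E * S x)%E.
  move=> Sfin; have SE : S x = (fine (S x))%:E by rewrite fineK.
  have fS0 : 0 <= fine (S x) by apply: fine_ge0.
  pose c := Num.sqrt (fine (S x)).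
  have E2 j : (2 ^+ j : R) ^+ 2 = 4 ^+ j by rewrite exprAC; congr (_ ^+ _); ring.
  have dc j : `|f_ j.+1 x - f_ j x| <= c * (2 ^+ j)^-1.
    rewrite ler_pdivlMr ?exprn_gt0// -(@ler_pXn2r _ 2%N)// ?nnegrE ?mulr_ge0 ?exprn_ge0 ?sqrtr_ge0//.
    rewrite sqr_sqrtr// exprMn -normrX ger0_norm ?sqr_ge0// E2 mulrC.
    rewrite -lee_fin -SE; apply: le_trans (@nneseries_lim_ge _ (fun i => s i x) xpredT 0 j.+1 _).
      rewrite big_nat_recr//= leeDr//; apply: sume_ge0 => i _; exact: s0.
    by move=> i _ _; exact: s0.
  have [l fl lk] := cvg_geometric_steps dc.
  rewrite (fE x l fl) SE -EFinM lee_fin -E2.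
  rewrite -(ger0_norm (sqr_ge0 (l - f_ k x))) normrX.
  have -> : 4 * (2 ^+ k ^+ 2)^-1 * fine (S x) = (2 * c * (2 ^+ k)^-1) ^+ 2.
    by rewrite -{1}(sqr_sqrtr fS0) -/c -exprVn !exprMn; ring.
  by rewrite ler_pXn2r// ?nnegrE ?mulr_ge0 ?sqrtr_ge0 ?invr_ge0 ?exprn_ge0.
have mfk k : measurable_fun D (fun x => f x - f_ k x).
  by apply: measurable_funB => //; have [] := Lf k.
have bound k : (\int[mu]_(x in D) ((f x - f_ k x) ^+ 2)%:E <= (4 * (4 ^+ k)^-1)%:E)%E.
  apply: (@le_trans _ _ (\int[mu]_(x in D) ((4 * (4 ^+ k)^-1)%:E * S x))%E).
    apply: ae_ge0_le_integral => //.
    - by move=> x _; rewrite lee_fin sqr_ge0.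
    - by apply/measurable_EFinP; exact: measurable_funX.
    - by move=> x _; rewrite mule_ge0// lee_fin mulr_ge0// invr_ge0 exprn_ge0.
    - exact: measurable_funeM.
    - by apply: filterS (integrable_ae mD iS) => x h Dx; exact: ptw (h Dx).
  rewrite integralZl// -[leRHS]mule1 lee_pmul2l ?lte_fin ?mulr_gt0 ?invr_gt0 ?exprn_gt0//.
have Lfk k : L2 (fun x => f x - f_ k x).
  split => //; apply/integrableP; split.
    by apply/measurable_EFinP; exact: measurable_funX.
  under eq_integral do rewrite gee0_abs ?lee_fin ?sqr_ge0//.
  by apply: le_lt_trans (bound k) _; rewrite ltry.
exists f; split.
- have := L2D (Lfk 0%N) (Lf 0%N).
  by congr L2; apply/funext => x; rewrite subrK.
- by move=> k; rewrite -lee_fin -integral_sqr.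
- by move=> x f0; apply: fE; under eq_cvg do rewrite f0; exact: cvg_cst.
Qed.

End L2.

Local Open Scope complex_scope.

(** * The L^2 pairing of complex-valued functions *)

Lemma L2_dot0 d (T : measurableType d) (R : realType)
    (mu : {measure set T -> \bar R}) (D : set T) (f : T -> R) :
  measurable D -> L2 mu D f -> dot mu D f f = 0 ->
  {ae mu, forall x, D x -> f x = 0}.
Proof.
move=> mD Lf f0; have [mf _] := Lf.
have : (\int[mu]_(x in D) `|(f x ^+ 2)%:E| = 0)%E.
  under eq_integral do rewrite gee0_abs ?lee_fin ?sqr_ge0//.
  by rewrite integral_sqr// f0.
have mF : measurable_fun D (fun x => (f x ^+ 2)%:E).
  by apply/measurable_EFinP; exact: measurable_funX.
move=> /(ae_eq_integral_abs mu mD mF) h.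
by apply: filterS h => x h Dx; have /= [/eqP] := h Dx; rewrite sqrf_eq0 => /eqP.
Qed.

Section complex_integral.
Context {R : realType} (Omega : set (R3 R)) (oO : open Omega).
Local Notation C := R[i].
Local Notation mu := (leb3 R).
Implicit Types f g h : R3 R -> C.

Definition re f : M3 R -> R := fun x => complex.Re (f x).
Definition im f : M3 R -> R := fun x => complex.Im (f x).

Definition cintegrable f := mu.-integrable Omega (EFin \o re f) /\
  mu.-integrable Omega (EFin \o im f).

Definition L2c f := L2 mu Omega (re f) /\ L2 mu Omega (im f).

Let mO : measurable (Omega : set (M3 R)). Proof. exact: open_measurable3. Qed.

Lemma cReD (a b : C) : complex.Re (a + b) = complex.Re a + complex.Re b.
Proof. by case: a b => [? ?] [? ?]. Qed.
Lemma cImD (a b : C) : complex.Im (a + b) = complex.Im a + complex.Im b.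
Proof. by case: a b => [? ?] [? ?]. Qed.
Lemma cReM (a b : C) : complex.Re (a * b) =
  complex.Re a * complex.Re b - complex.Im a * complex.Im b.
Proof. by case: a b => [? ?] [? ?]. Qed.
Lemma cImM (a b : C) : complex.Im (a * b) =
  complex.Re a * complex.Im b + complex.Im a * complex.Re b.
Proof. by case: a b => [? ?] [? ?]. Qed.
Lemma cReC (a : C) : complex.Re a^* = complex.Re a. Proof. by case: a. Qed.
Lemma cImC (a : C) : complex.Im a^* = - complex.Im a. Proof. by case: a. Qed.

Lemma complex_ext (a b : C) : complex.Re a = complex.Re b ->
  complex.Im a = complex.Im b -> a = b.
Proof. by case: a b => [? ?] [? ?] /= -> ->. Qed.

Lemma cintegrableD f g : cintegrable f -> cintegrable g ->
  cintegrable (fun x => f x + g x).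
Proof.
move=> [f1 f2] [g1 g2]; split.
- have := integrableD mO f1 g1; congr (_.-integrable _ _).
  by apply/funext => x; rewrite /re /= cReD.
- have := integrableD mO f2 g2; congr (_.-integrable _ _).
  by apply/funext => x; rewrite /im /= cImD.
Qed.

Lemma cintD f g : cintegrable f -> cintegrable g ->
  cint Omega (fun x => f x + g x) = cint Omega f + cint Omega g.
Proof.
move=> [f1 f2] [g1 g2]; apply: complex_ext; rewrite ?cReD ?cImD /cint /=.
- rewrite -RintegralD//; congr Rintegral; apply/funext => x; exact: cReD.
- rewrite -RintegralD//; congr Rintegral; apply/funext => x; exact: cImD.
Qed.

Lemma integrable_scale (a : R) (u : M3 R -> R) : mu.-integrable Omega (EFin \o u) ->
  mu.-integrable Omega (EFin \o (fun x => a * u x)).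
Proof.
by move=> iu; exact: (integrableZl mO a iu).
Qed.

Lemma cintZ (a : C) f : cintegrable f ->
  cint Omega (fun x => a * f x) = a * cint Omega f.
Proof.
move=> [f1 f2]; apply: complex_ext; rewrite ?cReM ?cImM /cint /=.
- rewrite -!RintegralZl// -RintegralB//; [|exact: integrable_scale|exact: integrable_scale].
  by congr Rintegral; apply/funext => x; rewrite cReM.
- rewrite -!RintegralZl// -RintegralD//; [|exact: integrable_scale|exact: integrable_scale].
  by congr Rintegral; apply/funext => x; rewrite cImM.
Qed.

Lemma cint_sum n (F : 'I_n -> R3 R -> C) : (forall i, cintegrable (F i)) ->
  cintegrable (fun x => \sum_i F i x) /\
  cint Omega (fun x => \sum_i F i x) = \sum_i cint Omega (F i).
Proof.
have i0 : cintegrable (fun=> 0) by split; exact: integrable0.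
elim: n F => [|n IH] F iF.
  have -> : (fun x => \sum_(i < 0) F i x) = (fun=> 0).
    by apply/funext => x; rewrite big_ord0.
  split=> //; rewrite big_ord0 /cint /=.
  by rewrite /Rintegral integral0.
have -> : (fun x => \sum_(i < n.+1) F i x) =
    (fun x => F ord0 x + \sum_(i < n) F (lift ord0 i) x).
  by apply/funext => x; rewrite big_ord_recl.
have [iG eG] := IH (fun i => F (lift ord0 i)) (fun i => iF _).
by split; [exact: cintegrableD|rewrite cintD// eG big_ord_recl].
Qed.

Lemma L2c_mulC f g : L2c f -> L2c g -> cintegrable (fun x => f x * (g x)^*).
Proof.
move=> [f1 f2] [g1 g2]; split.
- have := integrableD mO (L2M mO f1 g1) (L2M mO f2 g2).
  congr (_.-integrable _ _); apply/funext => x.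
  by rewrite /re /im /= cReM cReC cImC mulrN opprK -EFinD.
- have := integrableD mO (L2M mO f2 g1) (integrable_scale (- 1) (L2M mO f1 g2)).
  congr (_.-integrable _ _); apply/funext => x.
  by rewrite /re /im /= cImM cReC cImC -EFinD mulN1r mulrN addrC.
Qed.

Lemma L2cD f g : L2c f -> L2c g -> L2c (fun x => f x + g x).
Proof.
move=> [f1 f2] [g1 g2]; split.
- have := L2D mO f1 g1; congr L2; apply/funext => x; exact/esym/cReD.
- have := L2D mO f2 g2; congr L2; apply/funext => x; exact/esym/cImD.
Qed.

Lemma L2cZ (a : C) f : L2c f -> L2c (fun x => a * f x).
Proof.
move=> [f1 f2]; split.
- have := L2D mO (L2Z mO (complex.Re a) f1) (L2Z mO (- complex.Im a) f2).
  by congr L2; apply/funext => x; rewrite /re cReM mulNr.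
- have := L2D mO (L2Z mO (complex.Re a) f2) (L2Z mO (complex.Im a) f1).
  by congr L2; apply/funext => x; rewrite /im cImM.
Qed.

Lemma ipDl f g h : L2c f -> L2c g -> L2c h ->
  ip Omega (fun x => f x + g x) h = ip Omega f h + ip Omega g h.
Proof.
move=> Lf Lg Lh; rewrite /ip -cintD; [|exact: L2c_mulC|exact: L2c_mulC].
by congr cint; apply/funext => x; rewrite mulrDl.
Qed.

Lemma ipZl a f h : L2c f -> L2c h ->
  ip Omega (fun x => a * f x) h = a * ip Omega f h.
Proof.
move=> Lf Lh; rewrite /ip -cintZ; last exact: L2c_mulC.
by congr cint; apply/funext => x; rewrite mulrA.
Qed.

Lemma cint_conj f : cintegrable f -> cint Omega (fun x => (f x)^*) = (cint Omega f)^*.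
Proof.
move=> [f1 f2]; apply: complex_ext; rewrite ?cReC ?cImC /cint /=.
  by congr Rintegral; apply/funext => x; rewrite cReC.
rewrite -mulN1r -RintegralZl//; congr Rintegral; apply/funext => x.
by rewrite cImC mulN1r.
Qed.

Lemma ipC f g : L2c f -> L2c g -> ip Omega g f = (ip Omega f g)^*.
Proof.
move=> Lf Lg; rewrite /ip -cint_conj; last exact: L2c_mulC.
by congr cint; apply/funext => x; rewrite rmorphM/= conjcK mulrC.
Qed.

Lemma ipDr f g h : L2c f -> L2c g -> L2c h ->
  ip Omega h (fun x => f x + g x) = ip Omega h f + ip Omega h g.
Proof.
move=> Lf Lg Lh.
by rewrite (ipC (L2cD Lf Lg) Lh) ipDl// rmorphD /= (ipC Lf Lh) (ipC Lg Lh).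
Qed.

Lemma ipZr a f h : L2c f -> L2c h ->
  ip Omega h (fun x => a * f x) = a^* * ip Omega h f.
Proof.
move=> Lf Lh.
by rewrite (ipC (L2cZ a Lf) Lh) ipZl// rmorphM /= (ipC Lf Lh).
Qed.

(** Equality almost everywhere in Omega, in the form in which the equations
    of the theorem are stated. *)
Definition ae_eqO (A : Type) (f g : R3 R -> A) :=
  {ae mu, forall x : M3 R, Omega x -> f x = g x}.

Lemma Rintegral_ae (u v : M3 R -> R) :
  measurable_fun (Omega : set (M3 R)) u -> measurable_fun (Omega : set (M3 R)) v ->
  ae_eqO u v -> \int[mu]_(x in Omega) u x = \int[mu]_(x in Omega) v x.
Proof.
move=> mu' mv uv; congr fine; apply: ae_eq_integral => //; try exact/measurable_EFinP.
by apply: filterS uv => x h Ox; rewrite (h Ox).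
Qed.

Lemma cint_ae f g : cintegrable f -> cintegrable g -> ae_eqO f g ->
  cint Omega f = cint Omega g.
Proof.
move=> [/measurable_int/measurable_EFinP f1 /measurable_int/measurable_EFinP f2].
move=> [/measurable_int/measurable_EFinP g1 /measurable_int/measurable_EFinP g2] fg.
congr Complex; apply: Rintegral_ae => //.
- by apply: filterS fg => x h Ox; rewrite (h Ox).
- by apply: filterS fg => x h Ox; rewrite (h Ox).
Qed.

Lemma ip_ael f g h : L2c f -> L2c g -> L2c h -> ae_eqO f g ->
  ip Omega f h = ip Omega g h.
Proof.
move=> Lf Lg Lh fg; apply: cint_ae; [exact: L2c_mulC|exact: L2c_mulC|].
by apply: filterS fg => x e Ox; rewrite (e Ox).
Qed.

Lemma ip_aer f g h : L2c f -> L2c g -> L2c h -> ae_eqO f g ->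
  ip Omega h f = ip Omega h g.
Proof.
move=> Lf Lg Lh fg; apply: cint_ae; [exact: L2c_mulC|exact: L2c_mulC|].
by apply: filterS fg => x e Ox; rewrite (e Ox).
Qed.

Lemma Re_ip f h : L2c f -> L2c h ->
  complex.Re (ip Omega f h) = dot mu Omega (re f) (re h) + dot mu Omega (im f) (im h).
Proof.
move=> [f1 f2] [h1 h2].
rewrite /ip /cint /dot /= -RintegralD//; [|exact: (L2M mO f1 h1)|exact: (L2M mO f2 h2)].
by congr Rintegral; apply/funext => x; rewrite cReM cReC cImC mulrN opprK.
Qed.

Lemma ip_ge0 f : L2c f -> 0 <= complex.Re (ip Omega f f).
Proof. by move=> Lf; rewrite Re_ip// addr_ge0// dot_ge0. Qed.

Lemma ip_eq0 f : L2c f -> complex.Re (ip Omega f f) = 0 -> ae_eqO f (fun=> 0).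
Proof.
move=> Lf; rewrite Re_ip// => /eqP; rewrite paddr_eq0 ?dot_ge0// => /andP[/eqP f1 /eqP f2].
have [L1 L2] := Lf.
apply: filterS2 (L2_dot0 mO L1 f1) (L2_dot0 mO L2 f2) => x h1 h2 Ox.
by apply: complex_ext; [exact: h1|exact: h2].
Qed.

End complex_integral.

(** * Test functions *)

Lemma sum3 (V : zmodType) (F : 'I_3 -> V) : \sum_i F i = F 0 + F 1 + F 2.
Proof.
rewrite !big_ord_recl big_ord0 addr0 addrA.
by congr (F _ + F _ + F _); apply/val_inj.
Qed.

(** Curl indices are computed modulo 3. *)
Lemma ord3E :
  (((0 + 1)%R = 1%R :> 'I_3) * ((0 + 2)%R = 2%R :> 'I_3) *
   ((1 + 1)%R = 2%R :> 'I_3) * ((1 + 2)%R = 0%R :> 'I_3) *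
   ((2 + 1)%R = 0%R :> 'I_3) * ((2 + 2)%R = 1%R :> 'I_3))%type.
Proof. by do !split; apply/val_inj. Qed.

Lemma ord3P (P : 'I_3 -> Prop) : P 0 -> P 1 -> P 2 -> forall i, P i.
Proof.
move=> p0 p1 p2 [[|[|[|//]]] i3].
- by have -> : Ordinal i3 = 0 by apply/val_inj.
- by have -> : Ordinal i3 = 1 by apply/val_inj.
- by have -> : Ordinal i3 = 2 by apply/val_inj.
Qed.

Section sobolev.
Context {R : realType} (K : scalar_field) (Omega : set (R3 R)) (oO : open Omega).
Local Notation C := R[i].
Local Notation mu := (leb3 R).
Implicit Types (f g h q : R3 R -> C) (v w : R3 R -> 'rV[C]_3) (phi psi : R3 R -> R).

Let mO : measurable (Omega : set (M3 R)). Proof. exact: open_measurable3. Qed.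

Lemma scalarsD (a b : C) : scalars K a -> scalars K b -> scalars K (a + b).
Proof. by case: K => //=; rewrite cImD => -> ->; rewrite addr0. Qed.

Lemma scalarsZ (t : R) (a : C) : scalars K a -> scalars K (t%:C * a).
Proof. by case: K => //=; rewrite cImM /= => ->; rewrite mulr0 mul0r addr0. Qed.

Lemma inL2_L2c f : inL2 K Omega f -> L2c Omega f.
Proof.
move=> [_ mr mi i2]; split; split=> //; apply: le_integrable i2 => //.
- by apply/measurable_EFinP; exact: measurable_funX.
- by move=> x _ /=; rewrite lee_fin !ger0_norm ?addr_ge0 ?sqr_ge0// lerDl sqr_ge0.
- by apply/measurable_EFinP; exact: measurable_funX.
- by move=> x _ /=; rewrite lee_fin !ger0_norm ?addr_ge0 ?sqr_ge0// lerDr sqr_ge0.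
Qed.

Lemma L2c_inL2 f : L2c Omega f -> (forall x, Omega x -> scalars K (f x)) ->
  inL2 K Omega f.
Proof.
by move=> [[mr r2] [mi i2]] Kf; split => //; exact: (integrableD mO r2 i2).
Qed.

Lemma inL2D f g : inL2 K Omega f -> inL2 K Omega g ->
  inL2 K Omega (fun x => f x + g x).
Proof.
move=> Lf Lg; apply: L2c_inL2 => [|x Ox].
  by apply: L2cD => //; exact: inL2_L2c.
by apply: scalarsD; [have [+ _ _ _] := Lf | have [+ _ _ _] := Lg]; exact.
Qed.

Lemma inL2Z (t : R) f : inL2 K Omega f -> inL2 K Omega (fun x => t%:C * f x).
Proof.
move=> Lf; apply: L2c_inL2 => [|x Ox].
  by apply: L2cZ => //; exact: inL2_L2c.
by apply: scalarsZ; have [+ _ _ _] := Lf; exact.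
Qed.

Lemma inL2_0 : inL2 K Omega (fun=> 0).
Proof.
apply: L2c_inL2; last by case: K.
have z : mu.-integrable Omega (fun x : M3 R => ((0 : R) ^+ 2)%:E).
  by rewrite expr0n; exact: integrable0.
by split; split; [exact: measurable_cst|exact: z|exact: measurable_cst|exact: z].
Qed.

(** Test functions are real-valued; they enter the pairings as
    complex-valued functions. *)
Definition cfun_of phi : R3 R -> C := fun x => (phi x)%:C.

Lemma test_csupp phi : test Omega phi -> csupp phi.
Proof. by move=> [_ [A [cA _ A0]]]; exists A. Qed.

Lemma test_derive (v : R3 R) phi : test Omega phi -> test Omega ('D_v phi).
Proof.
move=> [sphi [A [cA AO A0]]]; split; first exact: smooth_derive.
exists A; split => // x Ax.
have oA : open (~` A) by apply: closed_openC; apply: compact_closed => //; exact: norm_hausdorff.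
rewrite (near_eq_derive (g := cst 0)); first by rewrite derive_cst.
have : nbhs x (~` A) by exact: open_nbhs_nbhs.
by apply: filterS => y /A0.
Qed.

Lemma test_mul phi psi : test Omega phi -> test Omega psi -> test Omega (phi * psi).
Proof.
move=> [sphi [A [cA AO A0]]] [spsi _]; split; first exact: smoothM.
exists A; split => // x Ax.
by rewrite -[LHS]/(phi x * psi x) A0 ?mul0r.
Qed.

Lemma test_inL2 phi : test Omega phi -> inL2 K Omega (cfun_of phi).
Proof.
move=> tphi; have [sphi _] := tphi.
have cphi' : continuous phi by exact: smooth_continuous.
apply: L2c_inL2 => [|x _]; last by case: K.
split; split.
- by apply: measurable_funTS; exact: continuous_measurable3.
- have tp := test_mul tphi tphi.
  apply: (@integrableS _ _ _ mu setT) => //.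
  have := csupp_integrable (smooth_continuous tp.1) (test_csupp tp).
  by congr (_.-integrable _ _); apply/funext => x; rewrite /= expr2.
- exact: measurable_cst.
- have -> : (fun x : M3 R => (im (cfun_of phi) x ^+ 2)%:E) = cst 0%E.
    by apply/funext => x; rewrite /im /= expr0n.
  exact: integrable0.
Qed.

Lemma test_L2c phi : test Omega phi -> L2c Omega (cfun_of phi).
Proof. by move=> /test_inL2/inL2_L2c. Qed.

Lemma regularE f phi : regular Omega f phi = ip Omega f (cfun_of phi).
Proof.
by rewrite /regular /ip; congr cint; apply/funext => x; rewrite [X in _ = _ * X]conjc_real.
Qed.

Lemma ip_test f phi : ip Omega f (cfun_of phi) =
  dot mu Omega (re f) phi +i* dot mu Omega (im f) phi.
Proof.
rewrite /ip /cint /dot; congr Complex; congr Rintegral; apply/funext => x.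
  by rewrite cReM /cfun_of /= oppr0 mulr0 subr0.
by rewrite cImM /cfun_of /= oppr0 mulr0 add0r.
Qed.

(** The integral over Omega of the derivative of phi * psi vanishes. *)
Lemma dot_derive phi psi i : test Omega phi -> test Omega psi ->
  dot mu Omega ('D_(basis3 i) phi) psi = - dot mu Omega phi ('D_(basis3 i) psi).
Proof.
move=> tp ts; apply/eqP; rewrite -addr_eq0; apply/eqP.
have tm := test_mul tp ts.
have [L1 L2] := (test_L2c tp, test_L2c ts).
have [L3 L4] := (test_L2c (test_derive (basis3 i) tp), test_L2c (test_derive (basis3 i) ts)).
rewrite /dot -RintegralD//; [|exact: (L2M mO L3.1 L2.1)|exact: (L2M mO L1.1 L4.1)].
transitivity (\int[mu]_x ('D_(basis3 i) (phi * psi) x)).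
  rewrite Rintegral_mkcond; congr Rintegral; apply/funext => x.
  rewrite deriveM; [|by apply: smooth_derivable; case: tp|by apply: smooth_derivable; case: ts].
  rewrite patchE; case: ifPn => xO.
    by rewrite addrC -[phi x *: _]/(phi x * _) -[psi x *: _]/(psi x * _) [psi x * _]mulrC.
  have out (th : R3 R -> R) : test Omega th -> th x = 0.
    move=> [_ [A [_ AO A0]]]; apply: A0 => /AO Ox.
    by move/negP: xO; apply; rewrite inE.
  by rewrite (out _ tp) (out _ ts) !scale0r addr0.
rewrite /Rintegral integral_derive_csupp//; last exact: test_csupp.
exact: tm.1.
Qed.

(** The fundamental lemma applied to the real and to the imaginary part. *)
Lemma fundamental_lemma_L2 f g : L2c Omega f -> L2c Omega g ->
  (forall phi, test Omega phi -> ip Omega f (cfun_of phi) = ip Omega g (cfun_of phi)) ->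
  ae_eqO Omega f g.
Proof.
move=> Lf Lg fg.
have real (r s : M3 R -> R) : L2 mu Omega r -> L2 mu Omega s ->
   (forall phi, test Omega phi -> dot mu Omega r phi = dot mu Omega s phi) ->
   {ae mu, forall x : M3 R, Omega x -> r x = s x}.
  move=> Lr Ls rs.
  have Lrs := L2B mO Lr Ls.
  have : {ae mu, forall x : M3 R, Omega x -> r x - s x = 0}.
    apply: fundamental_lemma => //.
    - by have [] := Lrs.
    - move=> c e cO; have mc := measurable_cube c e.
      have L1 : L2 mu (ball c e) (cst 1).
        split=> //; under eq_fun do rewrite expr1n.
        apply/integrableP; split; first exact: measurable_cst.
        by rewrite /= integral_cst// normr1 mul1e; exact: cube_fin.
      have L2' : L2 mu (ball c e) (fun x => r x - s x).
        by split; [exact: measurable_funS Lrs.1 | exact: integrableS Lrs.2].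
      have := L2M mc L2' L1; congr (_.-integrable _ _).
      by apply/funext => x; rewrite mulr1.
    - move=> phi tphi; have Lp := (test_L2c tphi).1.
      have := dotDl mO Lr (L2Z mO (-1) Ls) Lp.
      rewrite dotZl// mulN1r rs// subrr => <-.
      by congr Rintegral; apply/funext => x; rewrite mulN1r.
  by move=> H; apply: filterS H => x h Ox; apply/eqP; rewrite -subr_eq0; apply/eqP/h.
have [f1 f2] := Lf; have [g1 g2] := Lg.
have fg1 phi : test Omega phi -> dot mu Omega (re f) phi = dot mu Omega (re g) phi.
  by move=> /fg; rewrite !ip_test => -[].
have fg2 phi : test Omega phi -> dot mu Omega (im f) phi = dot mu Omega (im g) phi.
  by move=> /fg; rewrite !ip_test => -[].
apply: filterS2 (real _ _ f1 g1 fg1) (real _ _ f2 g2 fg2) => x h1 h2 Ox.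
by apply: complex_ext; [exact: h1|exact: h2].
Qed.

End sobolev.

(** * Weak gradient, divergence and curl *)

Section operators.
Context {R : realType} (K : scalar_field) (Omega : set (R3 R)) (oO : open Omega).
Local Notation C := R[i].
Local Notation mu := (leb3 R).
Implicit Types (f h q d : R3 R -> C) (g v w z : R3 R -> 'rV[C]_3) (phi psi : R3 R -> R).

Local Notation D i phi := ('D_(basis3 i) phi).
Local Notation "'<< f , phi >>" := (ip Omega f (cfun_of phi)).

Lemma ip0l h : ip Omega (fun=> 0) h = 0.
Proof.
rewrite /ip /cint; apply: complex_ext => /=; rewrite /Rintegral.
  by rewrite integral0_eq// => x _; rewrite mul0r.
by rewrite integral0_eq// => x _; rewrite mul0r.
Qed.

Lemma pd_regularE f phi i : pd i (regular Omega f) phi = - ip Omega f (cfun_of (D i phi)).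
Proof. by rewrite /pd regularE. Qed.

(** The weak gradient, read through the L^2 pairing. *)
Lemma is_gradP f g : is_grad K Omega f g <-> inL2v K Omega g /\
  forall i phi, test Omega phi ->
    - ip Omega f (cfun_of (D i phi)) = ip Omega (component g i) (cfun_of phi).
Proof.
split=> [fg|[Lg fg] i].
  by split=> [i|i phi tp]; [exact: (fg i).1|rewrite -pd_regularE (fg i).2// regularE].
by split=> [|phi tp]; [exact: Lg|rewrite pd_regularE fg// regularE].
Qed.

Lemma is_divP v d : is_div K Omega v d <-> inL2 K Omega d /\
  forall phi, test Omega phi ->
    - (\sum_i ip Omega (component v i) (cfun_of (D i phi))) = ip Omega d (cfun_of phi).
Proof.
have E phi : \sum_i pd i (regular Omega (component v i)) phi =
    - (\sum_i ip Omega (component v i) (cfun_of (D i phi))).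
  by rewrite -sumrN; apply: eq_bigr => i _; rewrite pd_regularE.
split=> [[Ld vd]|[Ld vd]]; split=> // phi tp.
  by rewrite -E vd// regularE.
by rewrite E vd// regularE.
Qed.

Lemma is_curlP v w : is_curl K Omega v w <-> inL2v K Omega w /\
  forall i phi, test Omega phi ->
    ip Omega (component v (i + 1)) (cfun_of (D (i + 2) phi)) -
    ip Omega (component v (i + 2)) (cfun_of (D (i + 1) phi)) =
    ip Omega (component w i) (cfun_of phi).
Proof.
have E i phi : pd (i + 1) (regular Omega (component v (i + 2))) phi -
    pd (i + 2) (regular Omega (component v (i + 1))) phi =
    ip Omega (component v (i + 1)) (cfun_of (D (i + 2) phi)) -
    ip Omega (component v (i + 2)) (cfun_of (D (i + 1) phi)).
  by rewrite !pd_regularE opprK addrC.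
split=> [vw|[Lw vw] i].
  by split=> [i|i phi tp]; [exact: (vw i).1|rewrite -E (vw i).2// regularE].
by split=> [|phi tp]; [exact: Lw|rewrite E vw// regularE].
Qed.

Definition L2v v := forall i, L2c Omega (component v i).

Lemma inL2v_L2v v : inL2v K Omega v -> L2v v.
Proof. by move=> Lv i; exact: (inL2_L2c oO (Lv i)). Qed.

Lemma componentD v w i :
  component (fun x => v x + w x) i = (fun x => component v i x + component w i x).
Proof. by apply/funext => x; rewrite /component mxE. Qed.

Lemma componentZ (a : C) v i :
  component (fun x => a *: v x) i = (fun x => a * component v i x).
Proof. by apply/funext => x; rewrite /component mxE. Qed.

Lemma component_row (F : 'I_3 -> R3 R -> C) i :
  component (fun x => \row_j F j x) i = F i.
Proof. by apply/funext => x; rewrite /component mxE. Qed.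

Lemma component0 i : component (fun=> 0) i = (fun=> 0) :> (R3 R -> C).
Proof. by apply/funext => x; rewrite /component mxE. Qed.

Lemma ipvE v w : L2v v -> L2v w ->
  ipv Omega v w = \sum_i ip Omega (component v i) (component w i).
Proof.
move=> Lv Lw.
by have [_ <-] := cint_sum oO (fun i => L2c_mulC oO (Lv i) (Lw i)).
Qed.

Lemma L2vD v w : L2v v -> L2v w -> L2v (fun x => v x + w x).
Proof. by move=> Lv Lw i; rewrite componentD; exact: L2cD. Qed.

Lemma L2vZ a v : L2v v -> L2v (fun x => a *: v x).
Proof. by move=> Lv i; rewrite componentZ; exact: L2cZ. Qed.

Lemma inL2vD v w : inL2v K Omega v -> inL2v K Omega w ->
  inL2v K Omega (fun x => v x + w x).
Proof. by move=> Lv Lw i; rewrite componentD; exact: inL2D. Qed.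

Lemma inL2vZ (t : R) v : inL2v K Omega v -> inL2v K Omega (fun x => t%:C *: v x).
Proof. by move=> Lv i; rewrite componentZ; exact: inL2Z. Qed.

Lemma inL2v_0 : inL2v K Omega (fun=> 0).
Proof. by move=> i; rewrite component0; exact: inL2_0. Qed.

Lemma ipvDl v w z : L2v v -> L2v w -> L2v z ->
  ipv Omega (fun x => v x + w x) z = ipv Omega v z + ipv Omega w z.
Proof.
move=> Lv Lw Lz; rewrite !ipvE//; last exact: L2vD.
by rewrite -big_split; apply: eq_bigr => i _; rewrite componentD ipDl.
Qed.

Lemma ipvZl a v w : L2v v -> L2v w ->
  ipv Omega (fun x => a *: v x) w = a * ipv Omega v w.
Proof.
move=> Lv Lw; rewrite !ipvE//; last exact: L2vZ.
by rewrite mulr_sumr; apply: eq_bigr => i _; rewrite componentZ ipZl.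
Qed.

Lemma ipvC v w : L2v v -> L2v w -> ipv Omega w v = (ipv Omega v w)^*.
Proof.
move=> Lv Lw; rewrite !ipvE// rmorph_sum /=.
by apply: eq_bigr => i _; rewrite ipC.
Qed.

Lemma ipvDr v w z : L2v v -> L2v w -> L2v z ->
  ipv Omega z (fun x => v x + w x) = ipv Omega z v + ipv Omega z w.
Proof.
move=> Lv Lw Lz; rewrite !ipvE//; last exact: L2vD.
by rewrite -big_split; apply: eq_bigr => i _; rewrite componentD ipDr.
Qed.

Lemma ipvZr a v w : L2v v -> L2v w ->
  ipv Omega w (fun x => a *: v x) = a^* * ipv Omega w v.
Proof.
move=> Lv Lw; rewrite !ipvE//; last exact: L2vZ.
by rewrite mulr_sumr; apply: eq_bigr => i _; rewrite componentZ ipZr.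
Qed.

Lemma ae_component v w i : ae_eqO Omega v w ->
  ae_eqO Omega (component v i) (component w i).
Proof. by apply: filterS => x h Ox; rewrite /component h. Qed.

Lemma component_ae v w : (forall i, ae_eqO Omega (component v i) (component w i)) ->
  ae_eqO Omega v w.
Proof.
move=> h; apply: filterS3 (h 0) (h 1) (h 2) => x h0 h1 h2 Ox.
by apply/rowP => i; move: i; apply: ord3P; [exact: h0|exact: h1|exact: h2].
Qed.

Lemma ipv_ael v w z : L2v v -> L2v w -> L2v z -> ae_eqO Omega v w ->
  ipv Omega v z = ipv Omega w z.
Proof.
move=> Lv Lw Lz vw; rewrite !ipvE//; apply: eq_bigr => i _.
by apply: ip_ael => //; exact: ae_component.
Qed.

Lemma ipv_aer v w z : L2v v -> L2v w -> L2v z -> ae_eqO Omega v w ->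
  ipv Omega z v = ipv Omega z w.
Proof.
move=> Lv Lw Lz vw; rewrite !ipvE//; apply: eq_bigr => i _.
by apply: ip_aer => //; exact: ae_component.
Qed.

Lemma ae_eqO_sym (A : Type) (a b : R3 R -> A) : ae_eqO Omega a b -> ae_eqO Omega b a.
Proof. by apply: filterS => x h Ox; rewrite h. Qed.

Lemma fundamental_lemma_L2v v w : L2v v -> L2v w ->
  (forall i phi, test Omega phi ->
    ip Omega (component v i) (cfun_of phi) = ip Omega (component w i) (cfun_of phi)) ->
  ae_eqO Omega v w.
Proof.
move=> Lv Lw vw; apply: component_ae => i.
by apply: (fundamental_lemma_L2 K) => // phi; exact: vw.
Qed.

Lemma grad_unique f g g' : is_grad K Omega f g -> is_grad K Omega f g' ->
  ae_eqO Omega g g'.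
Proof.
move=> /is_gradP[/inL2v_L2v Lg fg] /is_gradP[/inL2v_L2v Lg' fg'].
by apply: fundamental_lemma_L2v => // i phi tp; rewrite -fg// -fg'.
Qed.

Lemma div_unique v d d' : is_div K Omega v d -> is_div K Omega v d' ->
  ae_eqO Omega d d'.
Proof.
move=> /is_divP[/(inL2_L2c oO) Ld vd] /is_divP[/(inL2_L2c oO) Ld' vd'].
by apply: (fundamental_lemma_L2 K) => // phi tp; rewrite -vd// -vd'.
Qed.

Lemma curl_unique v w w' : is_curl K Omega v w -> is_curl K Omega v w' ->
  ae_eqO Omega w w'.
Proof.
move=> /is_curlP[/inL2v_L2v Lw vw] /is_curlP[/inL2v_L2v Lw' vw'].
by apply: fundamental_lemma_L2v => // i phi tp; rewrite -vw// -vw'.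
Qed.

Lemma gradP f g : is_grad K Omega f g -> is_grad K Omega f (grad K Omega f).
Proof. by move=> h; rewrite /grad; apply: (@xgetPex _ _ [set g | is_grad K Omega f g]); exists g. Qed.

Lemma divP v d : is_div K Omega v d -> is_div K Omega v (div K Omega v).
Proof. by move=> h; apply: (@xgetPex _ _ [set d | is_div K Omega v d]); exists d. Qed.

Lemma curlP v w : is_curl K Omega v w -> is_curl K Omega v (curl K Omega v).
Proof. by move=> h; apply: (@xgetPex _ _ [set w | is_curl K Omega v w]); exists w. Qed.

Lemma is_grad_lin (t : R) f g f' g' : L2c Omega f -> L2c Omega f' ->
  is_grad K Omega f g -> is_grad K Omega f' g' ->
  is_grad K Omega (fun x => t%:C * f x + f' x) (fun x => t%:C *: g x + g' x).
Proof.
move=> Lf Lf' /is_gradP[Lg fg] /is_gradP[Lg' fg']; apply/is_gradP.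
have [Lgv Lgv'] := (inL2v_L2v Lg, inL2v_L2v Lg').
split=> [|i phi tp]; first by apply: inL2vD => //; exact: inL2vZ.
have [Lp Ld] := (test_L2c K oO tp, test_L2c K oO (test_derive (basis3 i) tp)).
rewrite componentD componentZ !ipDl//; try exact: L2cZ.
by rewrite !ipZl// -fg// -fg'// opprD mulrN.
Qed.

Lemma is_div_lin (t : R) v d v' d' : L2v v -> L2v v' ->
  is_div K Omega v d -> is_div K Omega v' d' ->
  is_div K Omega (fun x => t%:C *: v x + v' x) (fun x => t%:C * d x + d' x).
Proof.
move=> Lv Lv' /is_divP[Ld vd] /is_divP[Ld' vd']; apply/is_divP.
have [Ldc Ldc'] := (inL2_L2c oO Ld, inL2_L2c oO Ld').
split=> [|phi tp]; first by apply: inL2D => //; exact: inL2Z.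
have Lp := test_L2c K oO tp.
rewrite !ipDl//; last exact: L2cZ.
rewrite ipZl// -vd// -vd'// mulrN -opprD mulr_sumr -big_split; congr (- _).
apply: eq_bigr => i _ /=.
have Li := test_L2c K oO (test_derive (basis3 i) tp).
by rewrite componentD componentZ ipDl ?ipZl//; exact: L2cZ.
Qed.

Lemma is_curl_lin (t : R) v w v' w' : L2v v -> L2v v' ->
  is_curl K Omega v w -> is_curl K Omega v' w' ->
  is_curl K Omega (fun x => t%:C *: v x + v' x) (fun x => t%:C *: w x + w' x).
Proof.
move=> Lv Lv' /is_curlP[Lw vw] /is_curlP[Lw' vw']; apply/is_curlP.
have [Lwv Lwv'] := (inL2v_L2v Lw, inL2v_L2v Lw').
split=> [|i phi tp]; first by apply: inL2vD => //; exact: inL2vZ.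
have Lp := test_L2c K oO tp.
have Ld j := test_L2c K oO (test_derive (basis3 j) tp).
rewrite !componentD !componentZ !ipDl//; try exact: L2cZ.
rewrite !ipZl// -(vw i phi tp) -(vw' i phi tp) mulrBr opprD.
exact: addrACA.
Qed.

Lemma is_div_ae v v' d : L2v v -> L2v v' -> ae_eqO Omega v v' ->
  is_div K Omega v d -> is_div K Omega v' d.
Proof.
move=> Lv Lv' e /is_divP[Ld vd]; apply/is_divP; split=> // phi tp.
rewrite -vd//; congr (- _); apply: eq_bigr => i _.
apply: ip_ael => //; first exact: (test_L2c K oO (test_derive (basis3 i) tp)).
exact/ae_eqO_sym/ae_component.
Qed.

Lemma is_curl_ae v v' w : L2v v -> L2v v' -> ae_eqO Omega v v' ->
  is_curl K Omega v w -> is_curl K Omega v' w.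
Proof.
move=> Lv Lv' e /is_curlP[Lw vw]; apply/is_curlP; split=> // i phi tp.
have Ld j := test_L2c K oO (test_derive (basis3 j) tp).
rewrite -vw//.
by congr (_ - _); apply: ip_ael => //; apply/ae_eqO_sym/ae_component.
Qed.

Lemma test_comm phi i j : test Omega phi -> D i (D j phi) = D j (D i phi).
Proof. by move=> [sp _]; apply/funext => x; apply: derive_comm; exact: sp. Qed.

(** The second derivatives of a test function commute. *)
Lemma curl_grad q g : is_grad K Omega q g -> is_curl K Omega g (fun=> 0).
Proof.
move=> /is_gradP[Lg qg]; apply/is_curlP; split; first exact: inL2v_0.
move=> i phi tp; rewrite component0 ip0l.
have E1 := qg (i + 1) _ (test_derive (basis3 (i + 2)) tp).
have E2 := qg (i + 2) _ (test_derive (basis3 (i + 1)) tp).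
have E3 := congr1 (fun p => - ip Omega q (cfun_of p)) (test_comm (i + 1) (i + 2) tp).
exact: (etrans (congr2 (fun x y => x - y) (esym E1) (etrans (esym E2) (esym E3))) (subrr _)).
Qed.

Lemma cyclic_cancel (V : zmodType) (X : 'I_3 -> 'I_3 -> 'I_3 -> V) :
  (forall m j k, X m j k = X m k j) ->
  (X 1 2 0 - X 2 1 0) + (X 2 0 1 - X 0 2 1) + (X 0 1 2 - X 1 0 2) = 0.
Proof.
move=> XC; rewrite (XC 1 2 0) (XC 2 1 0) (XC 0 2 1).
by rewrite subrKA subrKA subrr.
Qed.

(** The second derivatives of a test function commute, so the six terms
    cancel in pairs. *)
Lemma div_curl v w : is_curl K Omega v w -> is_div K Omega w (fun=> 0).
Proof.
move=> /is_curlP[Lw vw]; apply/is_divP; split; first exact: inL2_0.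
move=> phi tp; rewrite ip0l sum3.
pose X m j k := ip Omega (component v m) (cfun_of (D j (D k phi))).
have XC m j k : X m j k = X m k j.
  exact: (congr1 (fun p => ip Omega (component v m) (cfun_of p)) (test_comm j k tp)).
have W0 : X 1 2 0 - X 2 1 0 = ip Omega (component w 0) (cfun_of (D 0 phi)).
  by have := vw 0 _ (test_derive (basis3 0) tp); rewrite !ord3E.
have W1 : X 2 0 1 - X 0 2 1 = ip Omega (component w 1) (cfun_of (D 1 phi)).
  by have := vw 1 _ (test_derive (basis3 1) tp); rewrite !ord3E.
have W2 : X 0 1 2 - X 1 0 2 = ip Omega (component w 2) (cfun_of (D 2 phi)).
  by have := vw 2 _ (test_derive (basis3 2) tp); rewrite !ord3E.
have E := congr2 +%R (congr2 +%R W0 W1) W2.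
have Z := cyclic_cancel XC.
exact: (etrans (congr1 -%R (etrans (esym E) Z)) (oppr0 _)).
Qed.

End operators.

(** * Operators on Sobolev spaces *)

Section regularity.
Context {R : realType} (K : scalar_field) (Omega : set (R3 R)) (oO : open Omega).
Local Notation C := R[i].
Implicit Types (f h q d : R3 R -> C) (g v w : R3 R -> 'rV[C]_3) (phi : R3 R -> R).
Local Notation D i phi := ('D_(basis3 i) phi).
Local Notation same f h :=
  (forall phi, test Omega phi -> ip Omega f (cfun_of phi) = ip Omega h (cfun_of phi)).

Lemma inH_inL2 m f : inH K Omega m f -> inL2 K Omega f.
Proof. by case: m => [|m] // []. Qed.

Lemma inHv_inL2v m v : inHv K Omega m v -> inL2v K Omega v.
Proof. by move=> Hv i; exact: inH_inL2 (Hv i). Qed.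

Lemma inHS m f : inH K Omega m.+1 f -> inH K Omega m f.
Proof.
elim: m f => [|m IH] f; first exact: inH_inL2.
by move=> [Lf Hf]; split=> // i; have [g fg Hg] := Hf i; exists g => //; exact: IH.
Qed.

(** A function that acts as h on test functions has the weak derivatives
    of h. *)
Lemma inH_congr m f h : inL2 K Omega f -> inH K Omega m h -> same f h ->
  inH K Omega m f.
Proof.
case: m => [//|m] Lf [Lh Hh] fh; split=> // i.
have [g [Lg hg] Hg] := Hh i; exists g => //; split=> // phi tp.
rewrite -(hg _ tp) !pd_regularE; congr (- _); apply: fh.
exact: test_derive.
Qed.

Lemma inH_lin m (t : R) f h : inH K Omega m f -> inH K Omega m h ->
  inH K Omega m (fun x => t%:C * f x + h x).
Proof.
elim: m f h => [|m IH] f h Hf Hh.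
  by apply: inL2D => //; exact: inL2Z.
have [Lf Lh] := (inH_inL2 Hf, inH_inL2 Hh).
have [Lfc Lhc] := (inL2_L2c oO Lf, inL2_L2c oO Lh).
case: Hf Hh => _ Hf [_ Hh].
split=> [|i]; first by apply: inL2D => //; exact: inL2Z.
have [f' [Lf' ff'] Hf'] := Hf i; have [h' [Lh' hh'] Hh'] := Hh i.
have [Lfc' Lhc'] := (inL2_L2c oO Lf', inL2_L2c oO Lh').
exists (fun x => t%:C * f' x + h' x); last exact: IH.
split=> [|phi tp]; first by apply: inL2D => //; exact: inL2Z.
have := ff' _ tp; have := hh' _ tp; rewrite !pd_regularE !regularE => e1 e2.
have Lp := test_L2c K oO tp; have Ld := test_L2c K oO (test_derive (basis3 i) tp).
rewrite (ipDl oO (L2cZ oO _ Lfc) Lhc Ld) (ipDl oO (L2cZ oO _ Lfc') Lhc' Lp).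
by rewrite (ipZl oO _ Lfc Ld) (ipZl oO _ Lfc' Lp) -e1 -e2 opprD mulrN.
Qed.

Lemma inH_test m phi : test Omega phi -> inH K Omega m (cfun_of phi).
Proof.
elim: m phi => [|m IH] phi tp; first exact: test_inL2.
split=> [|i]; first exact: test_inL2.
exists (cfun_of (D i phi)); last by apply: IH; exact: test_derive.
split=> [|psi ts]; first by apply: test_inL2 => //; exact: test_derive.
rewrite pd_regularE regularE !ip_test (dot_derive K oO i tp ts).
apply: complex_ext => //=.
have z (u : M3 R -> R) : dot (leb3 R) Omega (im (cfun_of phi)) u = 0.
  rewrite /dot /Rintegral integral0_eq// => x _.
  by rewrite /im /= mul0r.
have z' (u : M3 R -> R) : dot (leb3 R) Omega (im (cfun_of (D i phi))) u = 0.
  rewrite /dot /Rintegral integral0_eq// => x _.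
  by rewrite /im /= mul0r.
by rewrite z z' oppr0.
Qed.

Lemma inH_weak_grad m f : inH K Omega m.+1 f ->
  exists2 g, is_grad K Omega f g & inHv K Omega m g.
Proof.
move=> [Lf Hf].
have /choice[G GP] : forall i, exists g : R3 R -> C, represents K Omega (pd i (regular Omega f)) g /\ inH K Omega m g.
  by move=> i; have [g fg Hg] := Hf i; exists g.
exists (fun x => \row_j G j x) => i; rewrite component_row; first exact: (GP i).1.
exact: (GP i).2.
Qed.

(** The operator [grad] picks some weak gradient; regularity is transported
    to it by comparing both on test functions. *)
Lemma inH_grad m f : inH K Omega m.+1 f ->
  is_grad K Omega f (grad K Omega f) /\ inHv K Omega m (grad K Omega f).
Proof.
move=> /inH_weak_grad[g fg Hg]; have fG := gradP fg; split=> // i.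
apply: inH_congr (fG i).1 (Hg i) _ => phi tp.
have /is_gradP[_ e1] := fg; have /is_gradP[_ e2] := fG.
exact: (etrans (esym (e2 i phi tp)) (e1 i phi tp)).
Qed.

Lemma inHv_partials m v : inHv K Omega m.+1 v ->
  exists G : 'I_3 -> R3 R -> 'rV[C]_3, forall i,
    is_grad K Omega (component v i) (G i) /\ inHv K Omega m (G i).
Proof.
move=> Hv.
have /choice[G GP] : forall i, exists g, is_grad K Omega (component v i) g /\ inHv K Omega m g.
  by move=> i; have [g ? ?] := inH_weak_grad (Hv i); exists g.
by exists G.
Qed.

(** The divergence acts on test functions as the sum of the diagonal weak
    partial derivatives. *)
Lemma inHv_div m v : inHv K Omega m.+1 v ->
  is_div K Omega v (div K Omega v) /\ inH K Omega m (div K Omega v).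
Proof.
move=> /inHv_partials[G GP].
have Hd : inH K Omega m (fun x => 1%:C * component (G 0) 0 x +
    (1%:C * component (G 1) 1 x + component (G 2) 2 x)).
  apply: inH_lin; first exact: (GP 0).2.
  by apply: inH_lin; [exact: (GP 1).2|exact: (GP 2).2].
set d := (fun x => _) in Hd.
have L i j : L2c Omega (component (G i) j) := inL2_L2c oO (inH_inL2 ((GP i).2 j)).
have vd : is_div K Omega v d.
  apply/is_divP; split; first exact: inH_inL2 Hd.
  move=> phi tp; have Lp := test_L2c K oO tp.
  have e i : - ip Omega (component v i) (cfun_of (D i phi)) = ip Omega (component (G i) i) (cfun_of phi).
    by have /is_gradP[_] := (GP i).1; exact.
  rewrite sum3 /d (ipDl oO (L2cZ oO _ (L 0 0)) (L2cD oO (L2cZ oO _ (L 1 1)) (L 2 2)) Lp).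
  rewrite (ipDl oO (L2cZ oO _ (L 1 1)) (L 2 2) Lp).
  rewrite (ipZl oO _ (L 0 0) Lp) (ipZl oO _ (L 1 1) Lp) !mul1r.
  by rewrite -(e 0) -(e 1) -(e 2) !opprD addrA.
have vD := divP vd; split=> //.
apply: inH_congr vD.1 Hd _ => phi tp.
have /is_divP[_ e1] := vd; have /is_divP[_ e2] := vD.
exact: (etrans (esym (e2 phi tp)) (e1 phi tp)).
Qed.

Lemma inHv_curl m v : inHv K Omega m.+1 v ->
  is_curl K Omega v (curl K Omega v) /\ inHv K Omega m (curl K Omega v).
Proof.
move=> /inHv_partials[G GP].
pose F i x := (- 1)%:C * component (G (i + 1)) (i + 2) x + component (G (i + 2)) (i + 1) x.
have HF i : inH K Omega m (F i).
  by apply: inH_lin; [exact: (GP _).2|exact: (GP _).2].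
have L i j : L2c Omega (component (G i) j) := inL2_L2c oO (inH_inL2 ((GP i).2 j)).
pose w x := \row_j F j x.
have vw : is_curl K Omega v w.
  apply/is_curlP; split=> [i|i phi tp]; first by rewrite component_row; exact: inH_inL2 (HF i).
  have Lp := test_L2c K oO tp.
  have e k j : - ip Omega (component v k) (cfun_of (D j phi)) = ip Omega (component (G k) j) (cfun_of phi).
    by have /is_gradP[_] := (GP k).1; exact.
  rewrite component_row /F (ipDl oO (L2cZ oO _ (L (i + 1) (i + 2))) (L (i + 2) (i + 1)) Lp).
  rewrite (ipZl oO _ (L (i + 1) (i + 2)) Lp) -(e (i + 1) (i + 2)) -(e (i + 2) (i + 1)).
  by rewrite mulrN rmorphN mulNr opprK mul1r.
have vW := curlP vw; split=> // i.
apply: inH_congr (vW i).1 (HF i) _ => phi tp.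
have /is_curlP[_ e1] := vw; have /is_curlP[_ e2] := vW.
apply: (etrans (esym (e2 i phi tp))); apply: (etrans (e1 i phi tp)).
by rewrite component_row.
Qed.

End regularity.

(** * The Hilbert space H^1 *)

Section dot_limits.
Context d (T : measurableType d) (R : realType) (mu : {measure set T -> \bar R}).
Context (D : set T) (mD : measurable D).
Implicit Types r s u : T -> R.

Local Notation dist r s := (dot mu D (fun x => r x - s x) (fun x => r x - s x)).

Lemma dotBl r s u : L2 mu D r -> L2 mu D s -> L2 mu D u ->
  dot mu D (fun x => r x - s x) u = dot mu D r u - dot mu D s u.
Proof.
move=> Lr Ls Lu.
have := dotDl mD Lr (L2Z mD (- 1) Ls) Lu; rewrite dotZl// mulN1r => <-.
by congr Rintegral; apply/funext => x; rewrite mulN1r.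
Qed.

(** From the nonnegativity of the square of r - t u. *)
Lemma dot_young r u (t : R) : L2 mu D r -> L2 mu D u -> 0 < t ->
  2 * dot mu D r u <= dot mu D r r / t + t * dot mu D u u.
Proof.
move=> Lr Lu t0; have Lt := L2Z mD t Lu.
have := dot_ge0 mu D (fun x => r x - t * u x).
rewrite dotBl//; last exact: L2B.
rewrite ![dot _ _ _ (fun x => r x - _)]dotC !dotBl// !dotZl// ![dot _ _ _ (fun x => t * _)]dotC.
rewrite !dotZl// [dot mu D u r]dotC => h.
rewrite -(ler_pM2r t0) [leRHS]mulrDl divfK ?gt_eqF//.
by move: (dot mu D r r) (dot mu D r u) (dot mu D u u) h => a b c; lra.
Qed.

Lemma dot_close r r' u (c : R) k : L2 mu D r -> L2 mu D r' -> L2 mu D u ->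
  dist r r' <= c * (4 ^+ k)^-1 ->
  2 * (dot mu D r u - dot mu D r' u) <= (2 ^+ k)^-1 * (c + dot mu D u u).
Proof.
move=> Lr Lr' Lu h; rewrite -dotBl//.
have t0 : 0 < (2 ^+ k : R)^-1 by rewrite invr_gt0 exprn_gt0.
apply: le_trans (dot_young (L2B mD Lr Lr') Lu t0) _.
rewrite mulrDr lerD2r invrK.
have -> : (2 ^+ k : R)^-1 * c = c * (4 ^+ k)^-1 * 2 ^+ k.
  have -> : (4 : R) = 2 * 2 by ring.
  by rewrite exprMn invfM mulrA mulfVK ?expf_neq0// mulrC.
by rewrite ler_pM2r// exprn_gt0.
Qed.

Lemma dot_limit_le r s (r_ s_ : nat -> T -> R) u1 u2 (c : R) :
  L2 mu D r -> L2 mu D s -> (forall k, L2 mu D (r_ k)) -> (forall k, L2 mu D (s_ k)) ->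
  L2 mu D u1 -> L2 mu D u2 ->
  (forall k, dist r (r_ k) <= c * (4 ^+ k)^-1) ->
  (forall k, dist s (s_ k) <= c * (4 ^+ k)^-1) ->
  (forall k, dot mu D (r_ k) u1 = dot mu D (s_ k) u2) ->
  dot mu D r u1 <= dot mu D s u2.
Proof.
move=> Lr Ls Lrk Lsk L1 L2' rc sc E.
suff : 2 * (dot mu D r u1 - dot mu D s u2) <= 0 by rewrite pmulr_rle0// subr_le0.
apply: (@le0_geometric _ _ (c + dot mu D u1 u1 + (c + dot mu D u2 u2))) => k.
have h1 := dot_close Lr (Lrk k) L1 (rc k).
have sc' : dist (s_ k) s <= c * (4 ^+ k)^-1.
  have -> : dist (s_ k) s = dist s (s_ k); last exact: sc.
  by congr Rintegral; apply/funext => x; ring.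
have h2 := dot_close (Lsk k) Ls L2' sc'.
rewrite mulrDr; have := E k.
move: h1 h2; move: (dot mu D r u1) (dot mu D (r_ k) u1) (dot mu D s u2) (dot mu D (s_ k) u2).
by move=> x1 x2 x3 x4; lra.
Qed.

(** Weak derivatives are identities of this shape; they survive limits in
    L^2. *)
Lemma dot_limit r s (r_ s_ : nat -> T -> R) u1 u2 (c : R) :
  L2 mu D r -> L2 mu D s -> (forall k, L2 mu D (r_ k)) -> (forall k, L2 mu D (s_ k)) ->
  L2 mu D u1 -> L2 mu D u2 ->
  (forall k, dist r (r_ k) <= c * (4 ^+ k)^-1) ->
  (forall k, dist s (s_ k) <= c * (4 ^+ k)^-1) ->
  (forall k, dot mu D (r_ k) u1 = - dot mu D (s_ k) u2) ->
  dot mu D r u1 = - dot mu D s u2.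
Proof.
move=> Lr Ls Lrk Lsk L1 L2' rc sc E.
have Ln := L2Z mD (- 1) L2'.
have N q : L2 mu D q -> dot mu D q (fun x => - 1 * u2 x) = - dot mu D q u2.
  by move=> Lq; rewrite dotC dotZl// dotC mulN1r.
rewrite -N//; apply/eqP; rewrite eq_le; apply/andP; split.
- by apply: (dot_limit_le Lr Ls Lrk Lsk L1 Ln rc sc) => k; rewrite N.
- by apply: (dot_limit_le Ls Lr Lsk Lrk Ln L1 sc rc) => k; rewrite N.
Qed.

End dot_limits.

Section neumann.
Context {R : realType} (K : scalar_field) (Omega : set (R3 R)) (oO : open Omega).
Local Notation C := R[i].
Local Notation mu := (leb3 R).
Implicit Types (f h q : R3 R -> C) (g v w : R3 R -> 'rV[C]_3).
Let mO : measurable (Omega : set (M3 R)). Proof. exact: open_measurable3. Qed.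

Definition sqdist f h : R :=
  dot mu Omega (fun x => re f x - re h x) (fun x => re f x - re h x) +
  dot mu Omega (fun x => im f x - im h x) (fun x => im f x - im h x).

Lemma sqdist_ge0 f h : 0 <= sqdist f h.
Proof. by rewrite addr_ge0// dot_ge0. Qed.

Lemma sqdistE f h : L2c Omega f -> L2c Omega h ->
  sqdist f h = complex.Re (ip Omega f f) - 2 * complex.Re (ip Omega f h) +
    complex.Re (ip Omega h h).
Proof.
move=> Lf Lh; rewrite !Re_ip//.
have E (r s : M3 R -> R) : L2 mu Omega r -> L2 mu Omega s ->
   dot mu Omega (fun x => r x - s x) (fun x => r x - s x) =
   dot mu Omega r r - 2 * dot mu Omega r s + dot mu Omega s s.
  move=> Lr Ls; have Lrs := L2B mO Lr Ls.
  rewrite dotBl// ![dot _ _ _ (fun x => r x - _)]dotC !dotBl// [dot _ _ s r]dotC.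
  by ring.
by rewrite /sqdist (E _ _ Lf.1 Lh.1) (E _ _ Lf.2 Lh.2); ring.
Qed.

Lemma inL2_complete (f_ : nat -> R3 R -> C) : (forall k, inL2 K Omega (f_ k)) ->
  (forall k, sqdist (f_ k.+1) (f_ k) <= (4 ^+ k * 2 ^+ k.+1)^-1) ->
  exists2 f, inL2 K Omega f & forall k, sqdist f (f_ k) <= 8 * (4 ^+ k)^-1.
Proof.
move=> Lf fc; have Lc k := inL2_L2c oO (Lf k).
have [|k|fr [Lr rk _]] := @L2_complete _ _ _ mu Omega mO (fun k => re (f_ k)).
- by move=> k; exact: (Lc k).1.
- by apply: le_trans (fc k); rewrite lerDl dot_ge0.
have [|k|fi [Li ik i0]] := @L2_complete _ _ _ mu Omega mO (fun k => im (f_ k)).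
- by move=> k; exact: (Lc k).2.
- by apply: le_trans (fc k); rewrite lerDr dot_ge0.
exists (fun x => fr x +i* fi x).
  apply: L2c_inL2 => // x Ox.
  have sc k : scalars K (f_ k x) by have [+ _ _ _] := Lf k; exact.
  by case: K sc => //= sc; apply: i0.
move=> k; have := lerD (rk k) (ik k); rewrite -mulrDl.
by have -> : (4 + 4 : R) = 8 by ring.
Qed.

Definition pair_lin (x : (R3 R -> C) * (R3 R -> 'rV[C]_3)) (t : R)
    (y : (R3 R -> C) * (R3 R -> 'rV[C]_3)) : (R3 R -> C) * (R3 R -> 'rV[C]_3) :=
  (fun p => x.1 p + t%:C * y.1 p, fun p => x.2 p + t%:C *: y.2 p).

(** The real part of the H^1 product. Minimization is a real problem, and the
    real part makes sense alike for both scalar fields. *)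
Definition h1_form (x y : (R3 R -> C) * (R3 R -> 'rV[C]_3)) : R :=
  complex.Re (ip Omega x.1 y.1 + ipv Omega x.2 y.2).

Definition L2pair (x : (R3 R -> C) * (R3 R -> 'rV[C]_3)) :=
  inL2 K Omega x.1 /\ inL2v K Omega x.2.

(** H^1 is handled as the graph of the weak gradient in (L^2)^4, whose norm
    is that of H^1. *)
Definition H1graph (x : (R3 R -> C) * (R3 R -> 'rV[C]_3)) :=
  inL2 K Omega x.1 /\ is_grad K Omega x.1 x.2.

Lemma H1graph_L2pair x : H1graph x -> L2pair x.
Proof. by move=> [L xg]; split=> // i; exact: (xg i).1. Qed.

Lemma L2pair_lin x t y : L2pair x -> L2pair y -> L2pair (pair_lin x t y).
Proof.
move=> [x1 x2] [y1 y2]; split; first by apply: inL2D => //; exact: inL2Z.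
by apply: inL2vD => //; exact: inL2vZ.
Qed.

Lemma H1graph_lin x t y : H1graph x -> H1graph y -> H1graph (pair_lin x t y).
Proof.
move=> Hx Hy; have [] := L2pair_lin t (H1graph_L2pair Hx) (H1graph_L2pair Hy).
move=> Ll _; split=> //.
have [[Lx gx] [Ly gy]] := (Hx, Hy).
have := is_grad_lin oO t (inL2_L2c oO Ly) (inL2_L2c oO Lx) gy gx.
by rewrite /pair_lin /=; congr is_grad; apply/funext => p; rewrite addrC.
Qed.

Lemma h1_formC x y : L2pair x -> L2pair y -> h1_form x y = h1_form y x.
Proof.
move=> [x1 x2] [y1 y2]; rewrite /h1_form !cReD.
have [Lx Ly] := (inL2_L2c oO x1, inL2_L2c oO y1).
have [Vx Vy] := (inL2v_L2v oO x2, inL2v_L2v oO y2).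
by rewrite (ipC oO Ly Lx) (ipvC oO Vy Vx) !cReC.
Qed.

Lemma h1_form_lin x t y z : L2pair x -> L2pair y -> L2pair z ->
  h1_form (pair_lin x t y) z = h1_form x z + t * h1_form y z.
Proof.
move=> [x1 x2] [y1 y2] [z1 z2].
have [Lx Ly Lz] := And3 (inL2_L2c oO x1) (inL2_L2c oO y1) (inL2_L2c oO z1).
have [Vx Vy Vz] := And3 (inL2v_L2v oO x2) (inL2v_L2v oO y2) (inL2v_L2v oO z2).
have Lt : L2c Omega (fun p => t%:C * y.1 p) by exact: L2cZ.
have Vt : L2v Omega (fun p => t%:C *: y.2 p) by exact: L2vZ.
have E1 : ip Omega (pair_lin x t y).1 z.1 = ip Omega x.1 z.1 + t%:C * ip Omega y.1 z.1.
  by rewrite -(ipZl oO _ Ly Lz); exact: (ipDl oO Lx Lt Lz).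
have E2 : ipv Omega (pair_lin x t y).2 z.2 = ipv Omega x.2 z.2 + t%:C * ipv Omega y.2 z.2.
  by rewrite -(ipvZl oO _ Vy Vz); exact: (ipvDl oO Vx Vt Vz).
rewrite /h1_form E1 E2.
by rewrite !cReD !cReM /= !mul0r !subr0; ring.
Qed.

Lemma h1_form_dist x y : L2pair x -> L2pair y ->
  h1_form x x - 2 * h1_form x y + h1_form y y =
  sqdist x.1 y.1 + \sum_i sqdist (component x.2 i) (component y.2 i).
Proof.
move=> [x1 x2] [y1 y2]; rewrite /h1_form !cReD.
have [Lx Ly] := (inL2_L2c oO x1, inL2_L2c oO y1).
have [Vx Vy] := (inL2v_L2v oO x2, inL2v_L2v oO y2).
rewrite (ipvE oO Vx Vx) (ipvE oO Vx Vy) (ipvE oO Vy Vy) !sum3 !cReD.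
rewrite (sqdistE Lx Ly) !sqdistE//.
by ring.
Qed.

Lemma h1_form_ge0 x : L2pair x -> 0 <= h1_form x x.
Proof.
move=> [x1 x2]; rewrite /h1_form cReD.
have [Lx Vx] := (inL2_L2c oO x1, inL2v_L2v oO x2).
rewrite (ipvE oO Vx Vx) sum3 !cReD.
by rewrite !addr_ge0// ip_ge0.
Qed.

(** Each of the eight real components converges in L^2 by [L2_complete], and
    the limit is again in the graph by [dot_limit]. *)
Lemma H1graph_complete (x_ : nat -> (R3 R -> C) * (R3 R -> 'rV[C]_3)) :
  (forall k, H1graph (x_ k)) ->
  (forall k, h1_form (x_ k.+1) (x_ k.+1) - 2 * h1_form (x_ k.+1) (x_ k) +
     h1_form (x_ k) (x_ k) <= (4 ^+ k * 2 ^+ k.+1)^-1) ->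
  exists2 x, H1graph x & forall k,
    h1_form x x - 2 * h1_form x (x_ k) + h1_form (x_ k) (x_ k) <= 32 * (4 ^+ k)^-1.
Proof.
move=> Hx xc.
have Lx k := H1graph_L2pair (Hx k).
have xc' k : sqdist (x_ k.+1).1 (x_ k).1 +
    \sum_i sqdist (component (x_ k.+1).2 i) (component (x_ k).2 i) <= (4 ^+ k * 2 ^+ k.+1)^-1.
  by rewrite -h1_form_dist.
have [k|k|q Lq qk] := inL2_complete (f_ := fun k => (x_ k).1).
- exact: (Lx k).1.
- by apply: le_trans (xc' k); rewrite lerDl sumr_ge0// => i _; exact: sqdist_ge0.
have /choice[G GP] : forall i, exists f, inL2 K Omega f /\
    forall k, sqdist f (component (x_ k).2 i) <= 8 * (4 ^+ k)^-1.
  move=> i; have [k|k|f Lf fk] := inL2_complete (f_ := fun k => component (x_ k).2 i).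
  - exact: (Lx k).2.
  - apply: le_trans (xc' k); rewrite (bigD1 i)//= addrCA lerDl addr_ge0 ?sqdist_ge0//.
    by rewrite sumr_ge0// => j _; exact: sqdist_ge0.
  - by exists f.
have LG i : inL2 K Omega (G i) by have [] := GP i.
exists (q, fun p => \row_j G j p).
  split=> //=; apply/is_gradP; split=> [i|i phi tp].
    by rewrite component_row.
  rewrite component_row !ip_test.
  have Lp := (test_L2c K oO tp).1; have Ld := (test_L2c K oO (test_derive (basis3 i) tp)).1.
  have Lqc := inL2_L2c oO Lq; have LGc := inL2_L2c oO (LG i).
  have Lkc k := inL2_L2c oO (Lx k).1; have Lkg k := inL2_L2c oO ((Lx k).2 i).
  have E k : - ip Omega (x_ k).1 (cfun_of ('D_(basis3 i) phi)) =
      ip Omega (component (x_ k).2 i) (cfun_of phi).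
    by have [_ /is_gradP[_]] := Hx k; exact.
  have Er k : dot mu Omega (re (x_ k).1) ('D_(basis3 i) phi) =
      - dot mu Omega (re (component (x_ k).2 i)) phi.
    by have := E k; rewrite !ip_test => -[<- _]; rewrite opprK.
  have Ei k : dot mu Omega (im (x_ k).1) ('D_(basis3 i) phi) =
      - dot mu Omega (im (component (x_ k).2 i)) phi.
    by have := E k; rewrite !ip_test => -[_ <-]; rewrite opprK.
  have bndl (a b c : R) : 0 <= b -> a + b <= c -> a <= c.
    by move=> b0; apply: le_trans; rewrite lerDl.
  have bndr (a b c : R) : 0 <= a -> a + b <= c -> b <= c.
    by move=> b0; apply: le_trans; rewrite lerDr.
  have qr k := bndl _ _ _ (dot_ge0 _ _ _) (qk k).
  have qi k := bndr _ _ _ (dot_ge0 _ _ _) (qk k).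
  have gr k := bndl _ _ _ (dot_ge0 _ _ _) ((GP i).2 k).
  have gi k := bndr _ _ _ (dot_ge0 _ _ _) ((GP i).2 k).
  have Lr := dot_limit mO Lqc.1 LGc.1 (fun k => (Lkc k).1) (fun k => (Lkg k).1) Ld Lp qr gr Er.
  have Li := dot_limit mO Lqc.2 LGc.2 (fun k => (Lkc k).2) (fun k => (Lkg k).2) Ld Lp qi gi Ei.
  by apply: complex_ext => /=; [rewrite [X in - X]Lr opprK | rewrite [X in - X]Li opprK].
move=> k; rewrite h1_form_dist//; last first.
  by split=> //= i; rewrite component_row.
rewrite sum3 /= !component_row.
have := qk k; have := (GP 0).2 k; have := (GP 1).2 k; have := (GP 2).2 k.
by lra.
Qed.

End neumann.

(** * The Neumann problem and fields of X_T *)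

Section variational.
Context {R : realType} (K : scalar_field) (Omega : set (R3 R)) (oO : open Omega).
Local Notation C := R[i].
Local Notation mu := (leb3 R).
Implicit Types (f h q p r s d : R3 R -> C) (g v w gp : R3 R -> 'rV[C]_3) (phi : R3 R -> R).
Local Notation D i phi := ('D_(basis3 i) phi).
Local Notation lc := (inL2_L2c oO).
Local Notation lv := (inL2v_L2v oO).

Lemma ip_scalars f h : inL2 K Omega f -> inL2 K Omega h -> scalars K (ip Omega f h).
Proof.
move=> [+ _ _ _] [+ _ _ _]; case: K => //= Kf Kh.
rewrite /ip /cint /= /Rintegral integral0_eq// => x Ox.
by rewrite cImM cImC Kf// Kh// oppr0 mulr0 mul0r addr0.
Qed.

Lemma ipv_scalars v w : inL2v K Omega v -> inL2v K Omega w -> scalars K (ipv Omega v w).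
Proof.
move=> Lv Lw; rewrite (ipvE oO (lv Lv) (lv Lw)) sum3.
by do 2 (apply: scalarsD; last exact: ip_scalars); exact: ip_scalars.
Qed.

Lemma scalars_eq (a b : C) : scalars K a -> scalars K b ->
  complex.Re a = complex.Re b ->
  (K = ComplexScalars -> complex.Im a = complex.Im b) -> a = b.
Proof.
case: K => /= sa sb e h; apply: complex_ext => //; first by rewrite sa sb.
exact: h.
Qed.

Lemma H1graph_mulC (a : C) q g : K = ComplexScalars -> H1graph K Omega (q, g) ->
  H1graph K Omega (fun x => a * q x, fun x => a *: g x).
Proof.
move=> KC [/= Lq /is_gradP[Lg qg]].
have cx f : L2c Omega f -> inL2 K Omega f.
  by move=> Lf; apply: L2c_inL2 => // x _; rewrite KC.
split; first by apply: cx; apply: L2cZ => //; exact: lc Lq.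
apply/is_gradP; split=> [i|i phi tp].
  by rewrite componentZ; apply: cx; apply: L2cZ => //; exact: (lv Lg).
rewrite componentZ (ipZl oO _ (lv Lg i) (test_L2c K oO tp)).
rewrite (ipZl oO _ (lc Lq) (test_L2c K oO (test_derive (basis3 i) tp))).
by rewrite -(qg i phi tp) mulrN.
Qed.

(** Weak form of - div grad q + q = h - div w with its natural boundary
    condition. Projecting (h, w) onto the graph of the gradient yields the
    identity for real parts; with complex scalars, replacing p by i p yields
    the imaginary parts, and with real scalars both sides are real. *)
Lemma neumann w h : inL2v K Omega w -> inL2 K Omega h ->
  exists q g, [/\ inL2 K Omega q, is_grad K Omega q g &
    forall p gp, inL2 K Omega p -> is_grad K Omega p gp ->
      ipv Omega w gp + ip Omega h p = ipv Omega g gp + ip Omega q p].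
Proof.
move=> Lw Lh.
have H0 : H1graph K Omega (fun=> 0, fun=> 0).
  split; first exact: inL2_0.
  apply/is_gradP; split; first exact: inL2v_0.
  by move=> i phi tp; rewrite component0 !ip0l oppr0.
have complete : exists c : R, forall x_ : nat -> (R3 R -> C) * (R3 R -> 'rV[C]_3),
    (forall k, H1graph K Omega (x_ k)) ->
    (forall k, h1_form Omega (x_ k.+1) (x_ k.+1) - 2 * h1_form Omega (x_ k.+1) (x_ k) +
      h1_form Omega (x_ k) (x_ k) <= (4 ^+ k * 2 ^+ k.+1)^-1) ->
    exists2 x, H1graph K Omega x & forall k,
      h1_form Omega x x - 2 * h1_form Omega x (x_ k) + h1_form Omega (x_ k) (x_ k)
        <= c * (4 ^+ k)^-1.
  by exists 32 => x_ Hx xc; exact: (H1graph_complete oO Hx xc).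
have [[q g] Hqg ortho] := @hilbert_projection R _ (@pair_lin R) (h1_form Omega)
  (L2pair K Omega) (H1graph K Omega)
  (fun x t y Hx Hy => L2pair_lin oO t Hx Hy)
  (fun x t y Hx Hy => H1graph_lin oO t Hx Hy)
  (fun x Hx => H1graph_L2pair Hx)
  (fun x y Hx Hy => h1_formC oO Hx Hy)
  (fun x t y z Hx Hy Hz => h1_form_lin oO t Hx Hy Hz)
  (fun x Hx => h1_form_ge0 oO Hx)
  complete
  (h, w) (conj Lh Lw) (ex_intro _ _ H0).
have [Lq qg] := Hqg; have Lg : inL2v K Omega g by move=> i; exact: (qg i).1.
exists q, g; split=> // p gp Lp pg.
have Lgp : inL2v K Omega gp by move=> i; exact: (pg i).1.
have Hp : H1graph K Omega (p, gp) by [].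
apply: scalars_eq.
- by apply: scalarsD; [exact: ipv_scalars|exact: ip_scalars].
- by apply: scalarsD; [exact: ipv_scalars|exact: ip_scalars].
- by rewrite addrC [in RHS]addrC; exact: ortho Hp.
move=> KC; have := ortho _ (H1graph_mulC (0 +i* 1) KC Hp).
rewrite /h1_form.
have E1 (f : R3 R -> C) : inL2 K Omega f ->
    ip Omega f (fun x => (0 +i* 1) * p x) = (0 +i* 1)^* * ip Omega f p.
  by move=> Lf; exact: (ipZr oO _ (lc Lp) (lc Lf)).
have E2 v : inL2v K Omega v ->
    ipv Omega v (fun x => (0 +i* 1) *: gp x) = (0 +i* 1)^* * ipv Omega v gp.
  by move=> Lv; exact: (ipvZr oO _ (lv Lgp) (lv Lv)).
move=> E; have {}E := etrans (esym (congr1 (@complex.Re R) (congr2 +%R (E1 _ Lh) (E2 _ Lw))))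
  (etrans E (congr1 (@complex.Re R) (congr2 +%R (E1 _ Lq) (E2 _ Lg)))).
move: E; rewrite -!mulrDr !cReM /= !mul0r !sub0r !mulN1r !opprK.
by rewrite addrC => ->; rewrite addrC.
Qed.

Lemma test0 : test Omega (fun=> 0).
Proof.
split; first exact: smooth_cst.
by exists set0; split=> //; exact: compact0.
Qed.

Lemma test_weak phi psi i : test Omega phi -> test Omega psi ->
  ip Omega (cfun_of phi) (cfun_of (D i psi)) = - ip Omega (cfun_of (D i phi)) (cfun_of psi).
Proof.
move=> tp ts; have [_ /(_ i)[g pg _]] := inH_test K oO 1 tp.
rewrite !ip_test (dot_derive K oO i tp ts).
have z (u1 u2 : R3 R -> R) : dot mu Omega (im (cfun_of u1)) u2 = 0.
  by rewrite /dot /Rintegral integral0_eq// => x _; rewrite /im /= mul0r.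
by apply: complex_ext; rewrite /= ?opprK ?z ?oppr0.
Qed.

Lemma is_grad_test phi : test Omega phi ->
  is_grad K Omega (cfun_of phi) (fun x => \row_i cfun_of (D i phi) x).
Proof.
move=> tp; apply/is_gradP; split=> [i|i psi ts].
  by rewrite component_row; apply: test_inL2 => //; exact: test_derive.
by rewrite component_row (test_weak i tp ts) opprK.
Qed.

(** The test functions are among the admissible p. *)
Lemma variational_div v d : inL2v K Omega v -> inL2 K Omega d ->
  (forall p gp, inL2 K Omega p -> is_grad K Omega p gp ->
     ipv Omega v gp + ip Omega d p = 0) -> is_div K Omega v d.
Proof.
move=> Lv Ld vd; apply/is_divP; split=> // phi tp.
have Lt i : L2c Omega (cfun_of (D i phi)) by exact: (test_L2c K oO (test_derive (basis3 i) tp)).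
have := vd _ _ (test_inL2 K oO tp) (is_grad_test tp).
rewrite (ipvE oO (lv Lv)); last by move=> i; rewrite component_row.
move=> /eqP; rewrite addr_eq0 => /eqP E.
rewrite -[RHS]opprK -E; congr (- _); apply: eq_bigr => i _.
by rewrite component_row.
Qed.

(** The hypothesis on p is the weak form of div v = d together with a
    vanishing normal trace. *)
Lemma inXT_intro v d w : inL2v K Omega v -> is_curl K Omega v w -> inL2 K Omega d ->
  (forall p gp, inL2 K Omega p -> is_grad K Omega p gp ->
     ipv Omega v gp + ip Omega d p = 0) -> inXT K Omega v.
Proof.
move=> Lv vw Ld vd; have dv := variational_div Lv Ld vd.
split; first by split=> //; [exists w|exists d].
move=> q Hq; rewrite /normal_trace.
have [qg _] := inH_grad Hq; have Lq := inH_inL2 Hq.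
have dD := divP dv.
rewrite (ip_ael oO (lc dD.1) (lc Ld) (lc Lq) (div_unique oO dD dv)).
exact: vd.
Qed.

(** For vector fields of test functions the classical curl and divergence are
    also the weak ones, which puts them in X_T. *)
Definition vtest (Phi : 'I_3 -> R3 R -> R) : R3 R -> 'rV[C]_3 :=
  fun x => \row_i cfun_of (Phi i) x.

Definition vtest_curl (Phi : 'I_3 -> R3 R -> R) : R3 R -> 'rV[C]_3 :=
  fun x => \row_i (cfun_of (D (i + 1) (Phi (i + 2))) x + (- 1)%:C * cfun_of (D (i + 2) (Phi (i + 1))) x).

Definition vtest_div (Phi : 'I_3 -> R3 R -> R) : R3 R -> C :=
  fun x => cfun_of (D 0 (Phi 0)) x + (cfun_of (D 1 (Phi 1)) x + cfun_of (D 2 (Phi 2)) x).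

Section test_field.
Context (Phi : 'I_3 -> R3 R -> R) (tPhi : forall i, test Omega (Phi i)).

Let LD i j : inL2 K Omega (cfun_of (D i (Phi j))).
Proof. by apply: test_inL2 => //; exact: test_derive. Qed.
Let LDc i j : L2c Omega (cfun_of (D i (Phi j))). Proof. exact: lc (LD i j). Qed.
Let LDn i j : L2c Omega (fun x => (- 1)%:C * cfun_of (D i (Phi j)) x).
Proof. exact: L2cZ. Qed.

Lemma vtest_inL2v : inL2v K Omega (vtest Phi).
Proof. by move=> i; rewrite component_row; exact: test_inL2. Qed.

Lemma vtest_curl_inL2v : inL2v K Omega (vtest_curl Phi).
Proof. by move=> i; rewrite component_row; apply: inL2D => //; exact: inL2Z. Qed.

Lemma vtest_div_inL2 : inL2 K Omega (vtest_div Phi).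
Proof. by apply: inL2D => //; exact: inL2D. Qed.

Lemma ip_curl_component f h i : inL2 K Omega f -> component (vtest_curl Phi) i = h ->
  ip Omega f h = ip Omega f (cfun_of (D (i + 1) (Phi (i + 2)))) -
                 ip Omega f (cfun_of (D (i + 2) (Phi (i + 1)))).
Proof.
move=> Lf <-; rewrite component_row.
apply: (etrans (ipDr oO (LDc _ _) (LDn _ _) (lc Lf))); congr (_ + _).
apply: (etrans (ipZr oO _ (LDc _ _) (lc Lf))).
by rewrite -[RHS]mulN1r; congr (_ * _).
Qed.

Lemma vtest_is_curl : is_curl K Omega (vtest Phi) (vtest_curl Phi).
Proof.
apply/is_curlP; split=> [|i psi ts]; first exact: vtest_curl_inL2v.
have Lp := test_L2c K oO ts; have Lpsi := test_inL2 K oO ts.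
rewrite !component_row (test_weak _ (tPhi _) ts) (test_weak _ (tPhi _) ts) opprK addrC.
apply/esym; apply: (etrans (ipDl oO (LDc _ _) (LDn _ _) Lp)); congr (_ + _).
apply: (etrans (ipZl oO _ (LDc _ _) Lp)).
by rewrite rmorphN1 mulN1r.
Qed.

Lemma ip_vtest_div f : inL2 K Omega f ->
  ip Omega f (vtest_div Phi) = \sum_i ip Omega f (cfun_of (D i (Phi i))).
Proof.
move=> Lf; rewrite sum3 -addrA.
apply: (etrans (ipDr oO (LDc 0 0) (L2cD oO (LDc 1 1) (LDc 2 2)) (lc Lf))).
congr (_ + _); exact: (ipDr oO (LDc 1 1) (LDc 2 2) (lc Lf)).
Qed.

Lemma ipv_vtest v : inL2v K Omega v ->
  ipv Omega v (vtest Phi) = \sum_i ip Omega (component v i) (cfun_of (Phi i)).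
Proof.
move=> Lv; rewrite (ipvE oO (lv Lv) (lv vtest_inL2v)).
by apply: eq_bigr => i _; rewrite component_row.
Qed.

Lemma ip_vtest_div_grad f g : inL2 K Omega f -> is_grad K Omega f g ->
  ip Omega f (vtest_div Phi) = - ipv Omega g (vtest Phi).
Proof.
move=> Lf fg; have /is_gradP[Lg fgE] := fg.
rewrite ip_vtest_div// ipv_vtest// -sumrN; apply: eq_bigr => i _.
by rewrite -(fgE i _ (tPhi i)) opprK.
Qed.

Lemma vtest_variational p gp : inL2 K Omega p -> is_grad K Omega p gp ->
  ipv Omega (vtest Phi) gp + ip Omega (vtest_div Phi) p = 0.
Proof.
move=> Lp pg; have Lgp : inL2v K Omega gp by move=> i; exact: (pg i).1.
rewrite (ipvC oO (lv Lgp) (lv vtest_inL2v)) (ipC oO (lc Lp) (lc vtest_div_inL2)).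
by rewrite (ip_vtest_div_grad Lp pg) rmorphN subrr.
Qed.

Lemma vtest_is_div : is_div K Omega (vtest Phi) (vtest_div Phi).
Proof.
apply: variational_div; [exact: vtest_inL2v|exact: vtest_div_inL2|].
exact: vtest_variational.
Qed.

Lemma vtest_inXT : inXT K Omega (vtest Phi).
Proof.
apply: inXT_intro vtest_inL2v vtest_is_curl vtest_div_inL2 _.
exact: vtest_variational.
Qed.

(** Both sides are the same six terms, by the definition of the weak curl. *)
Lemma ipv_vtest_curl E w : inL2v K Omega E -> is_curl K Omega E w ->
  ipv Omega E (vtest_curl Phi) = ipv Omega w (vtest Phi).
Proof.
move=> LE /is_curlP[Lw Ew]; rewrite ipv_vtest//.
rewrite (ipvE oO (lv LE) (lv vtest_curl_inL2v)) !sum3.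
pose X k i j := ip Omega (component E k) (cfun_of (D i (Phi j))).
have S i : ip Omega (component E i) (component (vtest_curl Phi) i) =
    X i (i + 1) (i + 2) - X i (i + 2) (i + 1).
  by apply: ip_curl_component => //; exact: LE.
have W i : X (i + 1) (i + 2) i - X (i + 2) (i + 1) i = ip Omega (component w i) (cfun_of (Phi i)).
  by exact: Ew.
have S0 := S 0; have S1 := S 1; have S2 := S 2.
have W0 := W 0; have W1 := W 1; have W2 := W 2.
rewrite !ord3E in S0 S1 S2 W0 W1 W2.
apply: (etrans (congr2 +%R (congr2 +%R S0 S1) S2)).
apply: (etrans _ (congr2 +%R (congr2 +%R W0 W1) W2)).
move: (X 0 1 2) (X 0 2 1) (X 1 2 0) (X 1 0 2) (X 2 0 1) (X 2 1 0).
clear; move=> a b c e f g; ring.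
Qed.

End test_field.

(** Fields with a single nonzero component suffice to recover an equation
    componentwise. *)
Lemma vtest_single phi (j : 'I_3) : test Omega phi ->
  exists2 Phi : 'I_3 -> R3 R -> R, forall i, test Omega (Phi i) &
  forall v, inL2v K Omega v ->
    ipv Omega v (vtest Phi) = ip Omega (component v j) (cfun_of phi).
Proof.
move=> tp; pose Phi i := if i == j then phi else (fun=> 0).
have tPhi i : test Omega (Phi i) by rewrite /Phi; case: ifP => // _; exact: test0.
exists Phi => // z Lz; rewrite (ipv_vtest tPhi Lz) (bigD1 j)//= big1.
  by rewrite addr0 /Phi eqxx.
move=> i ij; rewrite /Phi (negbTE ij).
have -> : cfun_of (fun=> 0) = (fun=> 0) :> (R3 R -> C) by apply/funext.
rewrite (ipC oO (lc (inL2_0 K oO)) (lc (Lz i))).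
by rewrite ip0l conjc0.
Qed.

End variational.

(** * The time-harmonic elasticity equation *)

Section elasticity.
Context {R : realType} (K : scalar_field) (Omega : set (R3 R)) (oO : open Omega).
Local Notation C := R[i].
Implicit Types (h q p r s d : R3 R -> C) (g v w gp : R3 R -> 'rV[C]_3).
Local Notation lc := (inL2_L2c oO).
Local Notation lv := (inL2v_L2v oO).
Context (a c o : R) (a0 : 0 < a) (c0 : 0 < c).
Context (f u : R3 R -> 'rV[C]_3).
Context (f_H1 : inHv K Omega 1 f) (u_XT : inXT K Omega u).
Context (u_sol : forall v, inXT K Omega v ->
  a%:C * ipv Omega (curl K Omega u) (curl K Omega v)
  + c%:C * ip Omega (div K Omega u) (div K Omega v)
  - o%:C * ipv Omega u v = ipv Omega f v).
Context (u_H3 : inHv K Omega 3 u).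

Let E := curl K Omega u.
Let dl := div K Omega u.
Let C1 := curl K Omega E.
Let gd := grad K Omega dl.

Let uE : is_curl K Omega u E. Proof. exact: (inHv_curl oO u_H3).1. Qed.
Let HE : inHv K Omega 2 E. Proof. exact: (inHv_curl oO u_H3).2. Qed.
Let ud : is_div K Omega u dl. Proof. exact: (inHv_div oO u_H3).1. Qed.
Let Hd : inH K Omega 2 dl. Proof. exact: (inHv_div oO u_H3).2. Qed.
Let EC : is_curl K Omega E C1. Proof. exact: (inHv_curl oO HE).1. Qed.
Let HC : inHv K Omega 1 C1. Proof. exact: (inHv_curl oO HE).2. Qed.
Let dg : is_grad K Omega dl gd. Proof. exact: (inH_grad Hd).1. Qed.
Let Hg : inHv K Omega 1 gd. Proof. exact: (inH_grad Hd).2. Qed.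
Let Lf : inL2v K Omega f. Proof. exact: inHv_inL2v f_H1. Qed.
Let Lu : inL2v K Omega u. Proof. exact: inHv_inL2v u_H3. Qed.
Let LE : inL2v K Omega E. Proof. exact: inHv_inL2v HE. Qed.
Let LC : inL2v K Omega C1. Proof. exact: inHv_inL2v HC. Qed.
Let Lg : inL2v K Omega gd. Proof. exact: inHv_inL2v Hg. Qed.
Let Ld : inL2 K Omega dl. Proof. exact: inH_inL2 Hd. Qed.

Let rhs : R3 R -> 'rV[C]_3 :=
  fun x => a%:C *: C1 x + ((- c)%:C *: gd x + (- o)%:C *: u x).

Let Lrhs : inL2v K Omega rhs.
Proof. by apply: inL2vD; rewrite //; [exact: inL2vZ|apply: inL2vD => //; exact: inL2vZ]. Qed.

Let ipv_rhs v : inL2v K Omega v -> ipv Omega rhs v =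
  a%:C * ipv Omega C1 v - c%:C * ipv Omega gd v - o%:C * ipv Omega u v.
Proof.
move=> Lv.
have L1 : L2v Omega (fun x => a%:C *: C1 x) by exact: (L2vZ oO _ (lv LC)).
have L2 : L2v Omega (fun x => (- c)%:C *: gd x) by exact: (L2vZ oO _ (lv Lg)).
have L3 : L2v Omega (fun x => (- o)%:C *: u x) by exact: (L2vZ oO _ (lv Lu)).
apply: (etrans (ipvDl oO L1 (L2vD oO L2 L3) (lv Lv))).
rewrite -addrA; congr (_ + _); first exact: (ipvZl oO _ (lv LC) (lv Lv)).
apply: (etrans (ipvDl oO L2 L3 (lv Lv))); congr (_ + _).
  by apply: (etrans (ipvZl oO _ (lv Lg) (lv Lv))); rewrite rmorphN mulNr.
by apply: (etrans (ipvZl oO _ (lv Lu) (lv Lv))); rewrite rmorphN mulNr.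
Qed.

(** Test fields belong to X_T, and all derivatives can be moved back onto u. *)
Lemma strong_equation : ae_eqO Omega f rhs.
Proof.
apply: (fundamental_lemma_L2v K oO (lv Lf) (lv Lrhs)) => j phi tp.
have [Phi tPhi single] := vtest_single K oO j tp.
have XT := vtest_inXT K oO tPhi.
have Lt := vtest_inL2v K oO tPhi.
have tc := vtest_is_curl K oO tPhi; have td := vtest_is_div K oO tPhi.
apply: (etrans (esym (single f Lf))); apply: (etrans _ (single rhs Lrhs)).
rewrite -(u_sol XT) (ipv_rhs Lt); congr (_ - _); congr (_ + _).
  congr (_ * _).
  have e := curl_unique oO (curlP tc) tc.
  apply: (etrans (ipv_aer oO _ _ (lv LE) e)).
  - by apply: lv => i; exact: (curlP tc i).1.
  - exact: (lv (vtest_curl_inL2v K oO tPhi)).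
  exact: (ipv_vtest_curl oO tPhi LE EC).
rewrite -mulrN; congr (_ * _).
apply: (etrans (ip_aer oO (lc (divP td).1) (lc td.1) (lc Ld) (div_unique oO (divP td) td))).
exact: (ip_vtest_div_grad oO tPhi Ld dg).
Qed.

(** The strong equation tested with v is compared with the variational one:
    the terms in u cancel, and so do those in div u since the normal trace of v
    vanishes against div u, which lies in H^1. *)
Lemma curl_curl_XT v : inXT K Omega v ->
  ipv Omega E (curl K Omega v) = ipv Omega C1 v.
Proof.
move=> XTv; have [[Lv [w vw] [d vd]] nv] := XTv.
have := u_sol XTv; rewrite (ipv_ael oO (lv Lf) (lv Lrhs) (lv Lv) strong_equation).
rewrite (ipv_rhs Lv) => /addIr.
have vD := divP vd.
have := nv _ (inHS Hd); rewrite /normal_trace.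
rewrite (ipvC oO (lv Lg) (lv Lv)) (ipC oO (lc Ld) (lc vD.1)) -rmorphD => z.
have {}z : ipv Omega gd v + ip Omega dl (div K Omega v) = 0.
  by apply: (inv_inj (@conjcK R)); rewrite z conjc0.
move: z => /eqP; rewrite addrC addr_eq0 => /eqP ->.
rewrite mulrN => /addIr; apply: mulfI.
by rewrite -(rmorph0 (@real_complex R)) (inj_eq (@complexI R)) gt_eqF.
Qed.

(** Let r represent the functional p |-> (curl E, grad p) in H^1, and let s
    solve the Neumann problem with right-hand side r. As grad s is a curl-free
    field of X_T, the functional vanishes at s, that is, (r, s) = 0 in H^1;
    but (s, r) in H^1 is the square of the L^2 norm of r. *)
Lemma curl_curl_grad q g : inL2 K Omega q -> is_grad K Omega q g ->
  ipv Omega C1 g = 0.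
Proof.
move=> Lq qg; have L0 := inL2_0 K oO.
have [r [gr [Lr rg rE]]] := neumann oO LC L0.
have [s [gs [Ls sg sE]]] := neumann oO (inL2v_0 K oO) Lr.
have Lgr : inL2v K Omega gr by move=> i; exact: (rg i).1.
have Lgs : inL2v K Omega gs by move=> i; exact: (sg i).1.
have ipv0 z : ipv Omega (fun=> 0) z = 0.
  rewrite /ipv /cint /Rintegral.
  by apply: complex_ext => /=; rewrite integral0_eq// => x _;
     rewrite big1// => i _; rewrite mxE mul0r.
(* div (grad s) = s - r with a vanishing normal derivative *)
have XTs : inXT K Omega gs.
  apply: (@inXT_intro _ K _ oO gs (fun x => s x + (- 1)%:C * r x) (fun=> 0)) => //.
  - exact: curl_grad sg.
  - by apply: inL2D => //; exact: inL2Z.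
  - move=> p gp Lp pg; have := sE p gp Lp pg; rewrite ipv0 add0r => e.
    rewrite (ipDl oO (lc Ls) (L2cZ oO _ (lc Lr)) (lc Lp)) (ipZl oO _ (lc Lr) (lc Lp)).
    by rewrite rmorphN1 mulN1r addrA -e subrr.
have ip0r (z : R3 R -> C) : ip Omega (fun=> 0) z = 0 by exact: ip0l.
have Z : ipv Omega C1 gs = 0.
  rewrite -(curl_curl_XT XTs).
  have cs := curl_grad oO sg.
  rewrite (ipv_aer oO _ (lv (inL2v_0 K oO)) (lv LE) (curl_unique oO (curlP cs) cs)).
    by rewrite (ipvC oO (lv (inL2v_0 K oO)) (lv LE)) ipv0 conjc0.
  by apply: lv => i; exact: (curlP cs i).1.
have e1 := rE s gs Ls sg; rewrite ip0r addr0 Z in e1.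
have e2 := sE r gr Lr rg; rewrite ipv0 add0r in e2.
have rr : ip Omega r r = 0.
  rewrite e2 (ipvC oO (lv Lgr) (lv Lgs)) (ipC oO (lc Lr) (lc Ls)) -rmorphD -e1.
  exact: conjc0.
have r0 : ae_eqO Omega r (fun=> 0).
  by apply: (ip_eq0 oO (lc Lr)); rewrite rr.
have gr0 : ae_eqO Omega gr (fun=> 0).
  apply: (fundamental_lemma_L2v K oO (lv Lgr) (lv (inL2v_0 K oO))) => i phi tp.
  have /is_gradP[_ rgE] := rg; rewrite -rgE// component0 ip0l.
  rewrite (ip_ael oO (lc Lr) (lc L0) _ r0) ?ip0l ?oppr0//.
  exact: (test_L2c K oO (test_derive (basis3 i) tp)).
have Lgv : inL2v K Omega g by move=> i; exact: (qg i).1.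
have := rE q g Lq qg; rewrite ip0r addr0 => ->.
rewrite (ipv_ael oO (lv Lgr) (lv (inL2v_0 K oO)) (lv Lgv) gr0) ipv0 add0r.
by rewrite (ip_ael oO (lc Lr) (lc L0) (lc Lq) r0) ip0r.
Qed.

(** Subtracting from w the gradient of a solution of a Neumann problem gives
    a field of X_T with the same curl. *)
Lemma tangential_trace_curl w : inHv K Omega 1 w ->
  tangential_trace K Omega E w = 0.
Proof.
move=> Hw; have [ww _] := inHv_curl oO Hw; have Lw := inHv_inL2v Hw.
have L0 := inL2_0 K oO.
have [q [g [Lq qg qE]]] := neumann oO Lw L0.
have Lgv : inL2v K Omega g by move=> i; exact: (qg i).1.
pose v x := (- 1)%:C *: g x + w x.
have Lv : inL2v K Omega v by apply: inL2vD => //; exact: inL2vZ.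
have ipv_v z : inL2v K Omega z -> ipv Omega v z = - ipv Omega g z + ipv Omega w z.
  move=> Lz; apply: (etrans (ipvDl oO (L2vZ oO _ (lv Lgv)) (lv Lw) (lv Lz))).
  congr (_ + _); apply: (etrans (ipvZl oO _ (lv Lgv) (lv Lz))).
  by rewrite rmorphN1 mulN1r.
have vc := is_curl_lin oO (- 1) (lv Lgv) (lv Lw) (curl_grad oO qg) ww.
have XTv : inXT K Omega v.
  apply: (@inXT_intro _ K _ oO v (fun x => (- 1)%:C * q x) _ Lv vc).
    exact: inL2Z.
  move=> p gp Lp pg; have Lgp : inL2v K Omega gp by move=> i; exact: (pg i).1.
  have := qE p gp Lp pg; rewrite ip0l addr0 => e.
  rewrite (ipv_v _ Lgp) e (ipZl oO _ (lc Lq) (lc Lp)) rmorphN1 mulN1r.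
  by rewrite addKr subrr.
have LW : inL2v K Omega (curl K Omega w) by move=> i; exact: (ww i).1.
have e1 : ipv Omega E (curl K Omega v) = ipv Omega E (curl K Omega w).
  have Lcv : inL2v K Omega (curl K Omega v) by move=> i; exact: (curlP vc i).1.
  apply: (ipv_aer oO (lv Lcv) (lv LW) (lv LE)).
  apply: filterS (curl_unique oO (curlP vc) vc) => x h Ox.
  by rewrite (h Ox) scaler0 add0r.
have e2 : ipv Omega C1 v = ipv Omega C1 w.
  apply: (etrans (ipvDr oO (L2vZ oO _ (lv Lgv)) (lv Lw) (lv LC))).
  have z := etrans (ipvZr oO (- 1)%:C (lv Lgv) (lv LC))
    (congr1 (fun t => (- 1)%:C^* * t) (curl_curl_grad Lq qg)).
  by apply: (etrans (congr1 (fun t => t + ipv Omega C1 w) z)); rewrite mulr0 add0r.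
rewrite /tangential_trace; apply/eqP; rewrite subr_eq0; apply/eqP.
exact: (etrans (esym e2) (etrans (esym (curl_curl_XT XTv)) e1)).
Qed.

Let is_divZ (t : R) v d : inL2v K Omega v -> is_div K Omega v d ->
  is_div K Omega (fun x => t%:C *: v x) (fun x => t%:C * d x).
Proof.
move=> Lv vd; have := is_div_lin oO (t - 1) (lv Lv) (lv Lv) vd vd.
congr is_div; apply/funext => x.
  by rewrite rmorphB rmorph1 scalerBl scale1r subrK.
by rewrite rmorphB rmorph1 mulrBl mul1r subrK.
Qed.

Let is_curlZ (t : R) v w : inL2v K Omega v -> is_curl K Omega v w ->
  is_curl K Omega (fun x => t%:C *: v x) (fun x => t%:C *: w x).
Proof.
move=> Lv vw; have := is_curl_lin oO (t - 1) (lv Lv) (lv Lv) vw vw.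
by congr is_curl; apply/funext => x; rewrite rmorphB rmorph1 scalerBl scale1r subrK.
Qed.

Let vp : R3 R -> C := fun x => - dl x.

Let minus2E : (- 2)%:C = - 1 - 1 :> C.
Proof. by apply: complex_ext; rewrite /=; ring. Qed.

Let vpE : vp = (fun x => (- 2)%:C * dl x + dl x).
Proof. by apply/funext => x; rewrite /vp minus2E mulrBl mulN1r mul1r subrK. Qed.

Lemma pressure_H2 : inH K Omega 2 vp.
Proof. by rewrite vpE; exact: inH_lin. Qed.

Let gvp := grad K Omega vp.
Let vg : is_grad K Omega vp gvp. Proof. exact: (inH_grad pressure_H2).1. Qed.
Let Hgvp : inHv K Omega 1 gvp. Proof. exact: (inH_grad pressure_H2).2. Qed.
Let Lgvp : inL2v K Omega gvp. Proof. exact: inHv_inL2v Hgvp. Qed.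

Let grad_vp : ae_eqO Omega gvp (fun x => - gd x).
Proof.
have gv := is_grad_lin oO (- 2) (lc Ld) (lc Ld) dg dg; rewrite -vpE in gv.
apply: filterS (grad_unique oO vg gv) => x h Ox.
by rewrite (h Ox) minus2E scalerBl scaleN1r scale1r subrK.
Qed.

Let c_neq0 : c%:C != 0 :> C.
Proof. by rewrite -(rmorph0 (@real_complex R)) (inj_eq (@complexI R)) gt_eqF. Qed.
Let a_neq0 : a%:C != 0 :> C.
Proof. by rewrite -(rmorph0 (@real_complex R)) (inj_eq (@complexI R)) gt_eqF. Qed.

Let sol_g : R3 R -> 'rV[C]_3 := fun x =>
  (c^-1)%:C *: f x + ((c^-1 * o)%:C *: u x + (- (c^-1 * a))%:C *: C1 x).

Let gvp_sol : ae_eqO Omega gvp sol_g.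
Proof.
apply: filterS2 grad_vp strong_equation => x h1 h2 Ox; rewrite (h1 Ox) /sol_g (h2 Ox) /rhs.
apply/rowP => i; rewrite !mxE !rmorphN !rmorphM !fmorphV /=.
move: (C1 x 0 i) (gd x 0 i) (u x 0 i) a%:C c%:C o%:C c_neq0 => X Y Z A B D B0.
by field.
Qed.

Let C1_sol : ae_eqO Omega C1 (fun x =>
  (a^-1)%:C *: f x + ((a^-1 * o)%:C *: u x + (- (a^-1 * c))%:C *: gvp x)).
Proof.
apply: filterS2 grad_vp strong_equation => x h1 h2 Ox; rewrite (h1 Ox) (h2 Ox) /rhs.
apply/rowP => i; rewrite !mxE !rmorphN !rmorphM !fmorphV /=.
move: (C1 x 0 i) (gd x 0 i) (u x 0 i) a%:C c%:C o%:C a_neq0 => X Y Z A B D A0.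
by field.
Qed.

Let fd : is_div K Omega f (div K Omega f). Proof. exact: (inHv_div oO f_H1).1. Qed.
Let fc : is_curl K Omega f (curl K Omega f). Proof. exact: (inHv_curl oO f_H1).1. Qed.

Let L2sum (x y z : R) v1 v2 v3 : inL2v K Omega v1 -> inL2v K Omega v2 -> inL2v K Omega v3 ->
  inL2v K Omega (fun t => x%:C *: v1 t + (y%:C *: v2 t + z%:C *: v3 t)).
Proof.
by move=> H1 H2 H3; apply: (inL2vD oO (inL2vZ oO _ H1) (inL2vD oO (inL2vZ oO _ H2) (inL2vZ oO _ H3))).
Qed.

Let gvp_div : ae_eqO Omega (div K Omega gvp)
  (fun x => (c^-1)%:C * div K Omega f x + (c^-1 * o)%:C * dl x).
Proof.
have Cd := is_divZ (- (c^-1 * a)) LC (div_curl oO EC).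
have U := is_div_lin oO (c^-1 * o) (lv Lu) (lv (inL2vZ oO _ LC)) ud Cd.
have F := is_div_lin oO c^-1 (lv Lf) (lv (inL2vD oO (inL2vZ oO _ Lu) (inL2vZ oO _ LC))) fd U.
have G := is_div_ae oO (lv (L2sum _ _ _ Lf Lu LC)) (lv Lgvp) (ae_eqO_sym gvp_sol) F.
apply: filterS (div_unique oO (divP G) G) => x h Ox.
by rewrite (h Ox) mulr0 addr0.
Qed.

Lemma pressure_helmholtz (k : R) : k = c^-1 * o ->
  ae_eqO Omega (fun x => laplacian K Omega vp x + k%:C * vp x)
    (fun x => (c^-1)%:C * div K Omega f x).
Proof.
move=> ->; apply: filterS gvp_div => x h Ox.
by rewrite /laplacian (h Ox) /vp mulrN addrK.
Qed.

(** The strong equation gives the normal trace of grad (- div u) as a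
    combination of those of f, u and curl E; the last two are zero. *)
Lemma pressure_neumann :
  eq_trace K Omega (normal_derivative K Omega vp)
     (fun q => (c^-1)%:C * normal_trace K Omega f q).
Proof.
move=> q Hq; rewrite /normal_derivative /normal_trace -/gvp.
have qg := (inH_grad Hq).1; have Lq := inH_inL2 Hq.
have Lgq : inL2v K Omega (grad K Omega q) by move=> i; exact: (qg i).1.
have Ldf := fd.1.
have gd' := (inHv_div oO Hgvp).1.
have n0 := u_XT.2 q Hq; rewrite /normal_trace -/dl in n0.
have e1 := ipv_ael oO (lv Lgvp) (lv (L2sum _ _ _ Lf Lu LC)) (lv Lgq) gvp_sol.
have e2 := ip_ael oO (lc gd'.1) (L2cD oO (L2cZ oO _ (lc Ldf)) (L2cZ oO _ (lc Ld))) (lc Lq) gvp_div.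
have e3 := ipvDl oO (L2vZ oO (c^-1)%:C (lv Lf))
  (L2vD oO (L2vZ oO (c^-1 * o)%:C (lv Lu)) (L2vZ oO (- (c^-1 * a))%:C (lv LC))) (lv Lgq).
have e4 := ipvDl oO (L2vZ oO (c^-1 * o)%:C (lv Lu)) (L2vZ oO (- (c^-1 * a))%:C (lv LC)) (lv Lgq).
have e5 := ipvZl oO (c^-1)%:C (lv Lf) (lv Lgq).
have e6 := ipvZl oO (c^-1 * o)%:C (lv Lu) (lv Lgq).
have e7 := ipvZl oO (- (c^-1 * a))%:C (lv LC) (lv Lgq).
have e8 := ipDl oO (L2cZ oO (c^-1)%:C (lc Ldf)) (L2cZ oO (c^-1 * o)%:C (lc Ld)) (lc Lq).
have e9 := ipZl oO (c^-1)%:C (lc Ldf) (lc Lq).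
have e10 := ipZl oO (c^-1 * o)%:C (lc Ld) (lc Lq).
have e11 := curl_curl_grad Lq qg.
have e67 := congr2 +%R e6 (etrans e7 (congr1 (fun t => (- (c^-1 * a))%:C * t) e11)).
have V := etrans e1 (etrans e3 (congr2 +%R e5 (etrans e4 e67))).
have S := etrans e2 (etrans e8 (congr2 +%R e9 e10)).
have G (b e k x y z w : C) : z + w = 0 ->
    (b * x + (e * z + k * 0)) + (b * y + e * w) = b * (x + y).
  by move=> zw; rewrite mulr0 addr0 addrACA -mulrDr -mulrDr zw mulr0 addr0.
exact: etrans (congr2 +%R V S) (G _ _ _ _ _ _ _ n0).
Qed.

Lemma vorticity_maxwell (k : R) : k = a^-1 * o ->
  ae_eqO Omega (fun x => curl K Omega C1 x - k%:C *: E x)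
    (fun x => (a^-1)%:C *: curl K Omega f x).
Proof.
move=> ->.
have Gc := is_curlZ (- (a^-1 * c)) Lgvp (curl_grad oO vg).
have U := is_curl_lin oO (a^-1 * o) (lv Lu) (lv (inL2vZ oO _ Lgvp)) uE Gc.
have F := is_curl_lin oO a^-1 (lv Lf) (lv (inL2vD oO (inL2vZ oO _ Lu) (inL2vZ oO _ Lgvp))) fc U.
have G := is_curl_ae oO (lv (L2sum _ _ _ Lf Lu Lgvp)) (lv LC) (ae_eqO_sym C1_sol) F.
apply: filterS (curl_unique oO (curlP G) G) => x h Ox.
by rewrite (h Ox) scaler0 addr0 addrK.
Qed.

Lemma vorticity_H2 : inHv K Omega 2 E.
Proof. exact: HE. Qed.

Lemma vorticity_div : ae_eqO Omega (div K Omega E) (fun=> 0).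
Proof. have D0 := div_curl oO uE; exact: (div_unique oO (divP D0) D0). Qed.

End elasticity.

Theorem theorem3p6 (R : realType) (K : scalar_field) (Omega : set (R3 R))
  (Omega_open : open Omega) (Omega_nonempty : Omega !=set0)
  (Omega_connected : connected Omega) (Omega_bounded : bounded_set Omega)
  (Omega_sc : simply_connected Omega)
  (Omega_lip : lipschitz_boundary Omega)
  (bd_connected : connected (boundary Omega))
  (bd_C21 : piecewise_C21_boundary Omega)
  (lambda mu omega : R) (lambda_gt0 : 0 < lambda) (mu_gt0 : 0 < mu)
  (omega_gt0 : 0 < omega)
  (f u : R3 R -> 'rV[R[i]]_3)
  (f_H1 : inHv K Omega 1 f) (u_XT : inXT K Omega u)
  (u_sol : forall v : R3 R -> 'rV[R[i]]_3, inXT K Omega v ->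
     mu%:C * ipv Omega (curl K Omega u) (curl K Omega v)
     + (lambda + 2 * mu)%:C * ip Omega (div K Omega u) (div K Omega v)
     - (omega ^+ 2)%:C * ipv Omega u v
     = ipv Omega f v)
  (u_H3 : inHv K Omega 3 u) :
  let kp : R := omega / Num.sqrt (lambda + 2 * mu) in
  let ks : R := omega / Num.sqrt mu in
  let vp : R3 R -> R[i] := fun x => - div K Omega u x in
  let Es : R3 R -> 'rV[R[i]]_3 := curl K Omega u in
  (* all the derivatives of vp and Es below are L^2 functions *)
  (inH K Omega 2 vp /\ inHv K Omega 2 Es) /\
  ((\forall x \ae leb3 R, Omega x ->
      laplacian K Omega vp x + (kp ^+ 2)%:C * vp x
      = ((lambda + 2 * mu)^-1)%:C * div K Omega f x) /\
   eq_trace K Omega (normal_derivative K Omega vp)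
     (fun q => ((lambda + 2 * mu)^-1)%:C * normal_trace K Omega f q)) /\
  [/\ (\forall x \ae leb3 R, Omega x ->
        curl K Omega (curl K Omega Es) x - (ks ^+ 2)%:C *: Es x
        = (mu^-1)%:C *: curl K Omega f x),
      (\forall x \ae leb3 R, Omega x -> div K Omega Es x = 0) &
      eq_tracev K Omega (tangential_trace K Omega Es) (cst 0)].
Proof.
move=> kp ks vp Es.
have c_gt0 : 0 < lambda + 2 * mu by rewrite addr_gt0// mulr_gt0.
have square_k (c : R) : 0 < c -> (omega / Num.sqrt c) ^+ 2 = c^-1 * omega ^+ 2.
  by move=> c0; rewrite expr_div_n sqr_sqrtr ?ltW// mulrC.
split; first by split; [exact: (pressure_H2 Omega_open u_H3)|exact: (vorticity_H2 Omega_open u_H3)].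
split; first split.
- exact: (pressure_helmholtz Omega_open c_gt0 f_H1 u_sol u_H3 (square_k _ c_gt0)).
- exact: (pressure_neumann Omega_open mu_gt0 c_gt0 f_H1 u_XT u_sol u_H3).
split.
- exact: (vorticity_maxwell Omega_open mu_gt0 f_H1 u_sol u_H3 (square_k _ mu_gt0)).
- exact: (vorticity_div Omega_open u_H3).
- by move=> w Hw; exact: (tangential_trace_curl Omega_open mu_gt0 f_H1 u_sol u_H3 Hw).
Qed.
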